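(* Let $\mathbf{k}$ be an algebraically closed field of characteristic $0$, let $X\subset\mathbb{A}^n_{\mathbf{k}}$ be an irreducible affine variety of dimension $s$, and let $U$ be a finite-dimensional simple $\mathfrak{gl}_s(\mathbf{k})$-module. Then: (1) the Rudakov module $R_p(U)$ is a simple $A\mathcal{V}$-module for any non-singular point $p\in X$; (2) if $X$ is smooth, then any gauge $A\mathcal{V}$-module associated with $U$ is simple.
   Context: **Basic objects.** $I_X=\langle g_1,\dots,g_m\rangle\subset\mathbf{k}[x_1,\dots,x_n]$ is the ideal of all polynomials vanishing on $X$, $A=\mathbf{k}[x_1,\dots,x_n]/I_X$, and $\mathcal{V}=\mathrm{Der}_{\mathbf{k}}(A)$ is the Lie algebra of polynomial vector fields on $X$. An $A\mathcal{V}$-module is a vector space $M$ which is both an $A$-module and a $\mathcal{V}$-module such that $\eta\cdot(f\cdot m)=\eta(f)\cdot m+f\cdot(\eta\cdot m)$ for all $\eta\in\mathcal{V}$, $f\in A$, $m\in M$; equivalently, $M$ is a module over the smash product $A\#\mathcal{U}(\mathcal{V})$, where $\mathcal{U}$ denotes the universal enveloping algebra. Submodules and simplicity are understood with respect to both actions. For a Lie subalgebra of $\mathcal{V}$, the corresponding smash product is defined in the same way. **Charts.** Let $J=(\partial g_i/\partial x_j)$ be the Jacobian matrix with entries in $A$, let $r$ be its rank over the fraction field of $A$, and let $h$ range over the nonzero $r\times r$ minors of $J$ (standard minors). The charts $N(h)=\{p\in X: h(p)\neq0\}$ form the standard atlas (they cover $X$ if $X$ is smooth; any non-singular point lies in some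 $N(h)$). The standard chart parameters $t_1,\dots,t_s$ in $N(h)$ are the variables $x_k$ for which the $k$-th column of $J$ is not part of the minor $h$. They are algebraically independent, the derivations $\partial/\partial t_i$ extend uniquely to the localization $A_{(h)}$ of $A$ at $h$, $\mathrm{Der}(A_{(h)})=\bigoplus_i A_{(h)}\frac{\partial}{\partial t_i}$, and $\mathcal{V}\subset\mathrm{Der}(A_{(h)})$. **The algebra $\mathfrak{L}_+$.** Let $\mathfrak{L}=\bigoplus_{i=1}^s\mathbf{k}[X_1,\dots,X_s]\frac{\partial}{\partial X_i}$ and $\hat{\mathfrak{L}}=\bigoplus_{i=1}^s\mathbf{k}[[X_1,\dots,X_s]]\frac{\partial}{\partial X_i}$. If $Q$ is a monomial of degree $d$, then $Q\frac{\partial}{\partial X_i}$ has degree $d-1$. For $l\geq-1$, $\mathfrak{L}(l)$ (resp. $\hat{\mathfrak L}(l)$) is the subalgebra of elements with no terms of degree less than $l$, and $\mathfrak{L}_+=\mathfrak{L}(0)$. One has $\mathfrak{L}_+/\mathfrak{L}(1)\simeq\mathfrak{gl}_s(\mathbf{k})$ via $X_k\frac{\partial}{\partial X_i}\mapsto E_{ki}$ (the matrix units), so a $\mathfrak{gl}_s(\mathbf{k})$-module is an $\mathfrak{L}_+$-module $(U,\rho)$ on which $\mathfrak{L}(1)$ acts by zero. **Rudakov modules.** Let $p\in X$ be non-singular, $p\in N(h)$, let $\mathfrak{m}_p\subset A$ be the maximal ideal of functions vanishing at $p$, and for $l\ge -1$ put $\mathcal{V}(l)=\{\eta\in\mathcal{V}:\eta(A)\subset\mathfrak{m}_p^{l+1}\}$,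 $\mathcal{V}_+=\mathcal{V}(0)$. Let $\bar t_i=t_i-t_i(p)$ be the centered standard chart parameters; these are local parameters at $p$, and Taylor expansion $\bar t_i\mapsto X_i$ gives embeddings $A\subset\mathbf{k}[[X_1,\dots,X_s]]$ and $\mathcal{V}\subset\hat{\mathfrak{L}}$ with $\mathcal{V}(l)=\hat{\mathfrak L}(l)\cap\mathcal{V}$. This induces an isomorphism $\mathcal{V}_+/\mathcal{V}(1)\simeq\mathfrak{L}_+/\mathfrak{L}(1)\simeq\mathfrak{gl}_s(\mathbf{k})$. Through it $U$ becomes a $\mathcal{V}_+$-module with $\mathcal{V}(1)U=0$, and with $f\cdot u=f(p)u$ for $f\in A$ it becomes an $A\#\mathcal{U}(\mathcal{V}_+)$-module. The Rudakov module is the induced module $R_p(U)=A\#\mathcal{U}(\mathcal{V})\otimes_{A\#\mathcal{U}(\mathcal{V}_+)}U$. **Gauge modules.** Fix a chart $N(h)$ with standard chart parameters $t_1,\dots,t_s$ and a finite-dimensional $\mathfrak{L}_+$-module $(U,\rho)$. Gauge fields are maps $B_i:A_{(h)}\otimes U\to A_{(h)}\otimes U$ ($1\le i\le s$) such that (i) each $B_i$ is $A_{(h)}$-linear; (ii) each $B_i$ commutes with $\rho(\mathfrak{L}_+)$ (acting on the factor $U$); (iii) $[\frac{\partial}{\partial t_i}+B_i,\frac{\partial}{\partial t_j}+B_j]=0$ as operators on $A_{(h)}\otimes U$ for all $i,j$. Given gauge fields, $A_{(h)}\otimes U$ is an $A\mathcal{V}$-module with $A$ acting by multiplication on the first factor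 and with the action of $\mathcal{V}\subset\mathrm{Der}(A_{(h)})$ determined by $$\Big(f\tfrac{\partial}{\partial t_i}\Big)\cdot(g\otimes u)=f\tfrac{\partial g}{\partial t_i}\otimes u+gfB_i(1\otimes u)+\sum_{k\in\mathbb{Z}_+^s\setminus\{0\}}\frac{1}{k!}\,g\,\frac{\partial^kf}{\partial t^k}\otimes\rho\Big(X^k\tfrac{\partial}{\partial X_i}\Big)u$$ (a finite sum; $\mathbb{Z}_+$ denotes the non-negative integers, $k!=\prod_i k_i!$). When $U$ is a simple $\mathfrak{gl}_s(\mathbf{k})$-module the last sum is $\sum_{k=1}^s g\frac{\partial f}{\partial t_k}\otimes E_{ki}u$. A local gauge module in the chart $N(h)$ is an $A\mathcal{V}$-submodule of such an $A_{(h)}\otimes U$ that is finitely generated as an $A$-module. An $A\mathcal{V}$-module $M$ is a gauge module associated with $U$ if for each chart $N(h)$ of the standard atlas it is isomorphic to a local gauge module contained in $A_{(h)}\otimes U$ for some choice of gauge fields $\{B_i\}$ in that chart. *)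

(* Defs.v *)
From HB Require Import structures.
From mathcomp Require Import all_boot all_order all_algebra.
From mathcomp Require finmap monalg functions.
From mathcomp Require Import boolp.
(* monalg and mpoly declare incompatible notations *)
Import -(notations) functions.
Import -(notations) finmap.
Import -(notations) monalg.
From mathcomp Require Import mpoly.

Set Implicit Arguments.
Unset Strict Implicit.
Unset Printing Implicit Defensive.

Import GRing.Theory.
Local Open Scope ring_scope.
Local Open Scope quotient_scope.

Section ZariskiTopology.
Variables (k : closedFieldType) (n : nat).

Definition zero_locus (S : {mpoly k[n]} -> Prop) (p : 'I_n -> k) : Prop :=
  forall f, S f -> f.@[p] = 0.

Definition zclosed (Z : ('I_n -> k) -> Prop) : Prop :=
  exists S, forall p, Z p <-> zero_locus S p.

Definition zirreducible (Z : ('I_n -> k) -> Prop) : Prop :=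
  (exists p, Z p) /\
  (forall Z1 Z2, zclosed Z1 -> zclosed Z2 -> (forall p, Z p -> Z1 p \/ Z2 p) ->
     (forall p, Z p -> Z1 p) \/ (forall p, Z p -> Z2 p)).

Record variety := Variety {
  points :> ('I_n -> k) -> Prop;
  variety_closed : zclosed points;
  variety_irreducible : zirreducible points }.

End ZariskiTopology.

Section CoordinateRing.
Variables (k : closedFieldType) (n : nat) (X : variety k n).

Definition vanishing (f : {mpoly k[n]}) : bool :=
  `[< forall p, X p -> f.@[p] = 0 >].

Lemma vanishing_idealr : idealr_closed vanishing.
Proof.
have [[p Xp] _] := variety_irreducible X; split.
- by apply/asboolP => q _; rewrite meval0.
- apply/negP => /asboolP/(_ p Xp); rewrite meval1 => /eqP.
  by rewrite oner_eq0.
- move=> a u v /asboolP hu /asboolP hv; apply/asboolP => q Xq.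
  by rewrite mevalD mevalM hu // hv // mulr0 addr0.
Qed.

Lemma vanishing_prime : prime_idealr_closed vanishing.
Proof.
move=> u v /asboolP huv.
have [_ irr] := variety_irreducible X.
pose Z f (p : 'I_n -> k) := f.@[p] = 0.
have cZ f : zclosed (Z f).
  exists (fun g => g = f) => p; split; first by move=> h g ->.
  by move=> h; apply: h.
have cov p : X p -> Z u p \/ Z v p.
  move=> Xp; have /eqP := huv p Xp; rewrite mevalM mulf_eq0.
  by case/orP=> /eqP; [left | right].
by case: (irr _ _ (cZ u) (cZ v) cov) => h; apply/orP; [left | right];
  apply/asboolP.
Qed.

HB.instance Definition _ :=
  isIdealr.Build {mpoly k[n]} vanishing vanishing_idealr.
HB.instance Definition _ :=
  isPrimeIdealrClosed.Build {mpoly k[n]} vanishing vanishing_prime.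

Definition vanishing_ideal : prime_idealr {mpoly k[n]} := vanishing.

Definition coord_ring : Type := {ideal_quot vanishing_ideal}.

HB.instance Definition _ := GRing.ComNzRing.on coord_ring.

Definition to_coord (f : {mpoly k[n]}) : coord_ring := \pi_{ideal_quot vanishing_ideal} f.

Lemma to_coord_zmod : zmod_morphism to_coord.
Proof. by move=> f g; rewrite /to_coord rmorphB. Qed.
Lemma to_coord_monoid : monoid_morphism to_coord.
Proof. by split=> [|f g]; rewrite /to_coord ?rmorph1 ?rmorphM. Qed.
HB.instance Definition _ :=
  GRing.isZmodMorphism.Build {mpoly k[n]} coord_ring to_coord to_coord_zmod.
HB.instance Definition _ :=
  GRing.isMonoidMorphism.Build {mpoly k[n]} coord_ring to_coord to_coord_monoid.

Definition coord_unit : pred coord_ring := fun x => `[< exists y, y * x = 1 >].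
Definition coord_inv (x : coord_ring) : coord_ring :=
  if pselect (exists y, y * x = 1) is left h then projT1 (cid h) else x.

Lemma coord_mulVx : {in coord_unit, left_inverse 1 coord_inv *%R}.
Proof.
move=> x /asboolP h; rewrite /coord_inv; case: pselect => // h'.
by case: (cid h').
Qed.
Lemma coord_unitPl (x y : coord_ring) : y * x = 1 -> coord_unit x.
Proof. by move=> h; apply/asboolP; exists y. Qed.
Lemma coord_inv_out : {in [predC coord_unit], coord_inv =1 id}.
Proof.
move=> x /negP h; rewrite /coord_inv; case: pselect => // h'.
by case: h; apply/asboolP.
Qed.
HB.instance Definition _ := GRing.ComNzRing_hasMulInverse.Build coord_ring
  coord_mulVx coord_unitPl coord_inv_out.
HB.instance Definition _ := GRing.ComUnitRing_isIntegral.Build coord_ring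
  (@Quotient.rquot_IdomainAxiom _ vanishing_ideal).

Definition coord_scale (c : k) (a : coord_ring) : coord_ring := to_coord c%:MP * a.

Lemma coord_scaleA c d a : coord_scale c (coord_scale d a) = coord_scale (c * d) a.
Proof. by rewrite /coord_scale mulrA -rmorphM -mpolyCM. Qed.
Lemma coord_scale1 : left_id 1 coord_scale.
Proof. by move=> a; rewrite /coord_scale rmorph1 mul1r. Qed.
Lemma coord_scaleDr : right_distributive coord_scale +%R.
Proof. by move=> c a b; rewrite /coord_scale mulrDr. Qed.
Lemma coord_scaleDl a : {morph coord_scale^~ a : c d / c + d}.
Proof. by move=> c d; rewrite /coord_scale mpolyCD rmorphD mulrDl. Qed.
HB.instance Definition _ := GRing.Zmodule_isLmodule.Build k coord_ring
  coord_scaleA coord_scale1 coord_scaleDr coord_scaleDl.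
Lemma coord_scaleAl (c : k) (a b : coord_ring) : c *: (a * b) = (c *: a) * b.
Proof. exact: mulrA. Qed.
HB.instance Definition _ := GRing.Lmodule_isLalgebra.Build k coord_ring coord_scaleAl.
HB.instance Definition _ := GRing.Lalgebra_isComAlgebra.Build k coord_ring.

(* For p in X this does not depend on the representative of a. *)
Definition evalA (p : 'I_n -> k) (a : coord_ring) : k := (repr a).@[p].

Definition funfield : Type := {fraction coord_ring}.
HB.instance Definition _ := GRing.Field.on funfield.
Definition toK (a : coord_ring) : funfield := FracField.tofrac a.
Lemma toK_zmod : zmod_morphism toK.
Proof. exact: tofrac_is_zmod_morphism. Qed.
Lemma toK_monoid : monoid_morphism toK.
Proof. exact: tofrac_is_monoid_morphism. Qed.
HB.instance Definition _ :=
  GRing.isZmodMorphism.Build coord_ring funfield toK toK_zmod.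
HB.instance Definition _ :=
  GRing.isMonoidMorphism.Build coord_ring funfield toK toK_monoid.

Definition funfield_scale (c : k) (x : funfield) : funfield := toK c%:A * x.

Lemma funfield_scaleA c d x :
  funfield_scale c (funfield_scale d x) = funfield_scale (c * d) x.
Proof. by rewrite /funfield_scale mulrA -rmorphM -scalerAl mul1r scalerA. Qed.
Lemma funfield_scale1 : left_id 1 funfield_scale.
Proof. by move=> x; rewrite /funfield_scale scale1r rmorph1 mul1r. Qed.
Lemma funfield_scaleDr : right_distributive funfield_scale +%R.
Proof. by move=> c x y; rewrite /funfield_scale mulrDr. Qed.
Lemma funfield_scaleDl x : {morph funfield_scale^~ x : c d / c + d}.
Proof. by move=> c d; rewrite /funfield_scale scalerDl rmorphD mulrDl. Qed.
HB.instance Definition _ := GRing.Zmodule_isLmodule.Build k funfield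
  funfield_scaleA funfield_scale1 funfield_scaleDr funfield_scaleDl.
Lemma funfield_scaleAl (c : k) (x y : funfield) : c *: (x * y) = (c *: x) * y.
Proof. exact: mulrA. Qed.
HB.instance Definition _ :=
  GRing.Lmodule_isLalgebra.Build k funfield funfield_scaleAl.
HB.instance Definition _ := GRing.Lalgebra_isComAlgebra.Build k funfield.

Lemma toK_scale c a : toK (c *: a) = c *: toK a.
Proof. by rewrite -[RHS]/(toK c%:A * toK a) -rmorphM mulr_algl. Qed.

(* The dimension of X is the transcendence degree over k of its function
   field. *)
Definition alg_independent d (x : 'I_d -> funfield) : Prop :=
  forall q : {mpoly k[d]}, mmap (in_alg funfield) x q = 0 -> q = 0.

Definition has_dim (s : nat) : Prop :=
  (exists x : 'I_s -> funfield, alg_independent x) /\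
  (forall x : 'I_s.+1 -> funfield, ~ alg_independent x).

Section Localization.
Variable h : coord_ring.

(* x = a / h ^ N; h is a nonzero minor in every use. *)
Definition is_loc (x : funfield) : bool :=
  `[< exists a N, x * toK h ^+ N = toK a >].

Lemma is_loc_subalg : GRing.subalg_closed is_loc.
Proof.
split.
- by apply/asboolP; exists 1, 0%N; rewrite rmorph1 mulr1.
- move=> c x y /asboolP[a [N ha]] /asboolP[b [M hb]]; apply/asboolP.
  exists (c *: (a * h ^+ M) + b * h ^+ N), (N + M)%N.
  have -> : toK (c *: (a * h ^+ M) + b * h ^+ N) =
      c *: (toK a * toK h ^+ M) + toK b * toK h ^+ N.
    by rewrite -rmorphXn -rmorphM -toK_scale -!rmorphXn -!rmorphM -rmorphD.
  rewrite -ha -hb exprD mulrDl -scalerAl !mulrA.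
  by congr (_ + _); rewrite -!mulrA; congr (_ * _); rewrite mulrC.
- move=> x y /asboolP[a [N ha]] /asboolP[b [M hb]]; apply/asboolP.
  exists (a * b), (N + M)%N.
  have -> : toK (a * b) = toK a * toK b by exact: rmorphM.
  by rewrite -ha -hb exprD mulrACA.
Qed.
HB.instance Definition _ :=
  GRing.isSubalgClosed.Build k funfield is_loc is_loc_subalg.

Record loc : Type := Loc { loc_val : funfield; _ : is_loc loc_val }.
HB.instance Definition _ := [isSub for loc_val].
HB.instance Definition _ := [Choice of loc by <:].
HB.instance Definition _ := [SubChoice_isSubComNzRing of loc by <:].
HB.instance Definition _ := [SubZmodule_isSubLmodule of loc by <:].
HB.instance Definition _ := [SubNzRing_SubLmodule_isSubLalgebra of loc by <:].
HB.instance Definition _ := GRing.Lalgebra_isComAlgebra.Build k loc.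

Lemma toK_is_loc (a : coord_ring) : is_loc (toK a).
Proof. by apply/asboolP; exists a, 0%N; rewrite mulr1. Qed.
Definition to_loc (a : coord_ring) : loc := Loc (toK_is_loc a).

Lemma loc_repr (x : loc) : exists aN : coord_ring * nat,
  loc_val x * toK h ^+ aN.2 = toK aN.1.
Proof. by case: x => x /= /asboolP[a [N e]]; exists (a, N). Qed.

(* For h(p) <> 0 this does not depend on the fraction chosen. *)
Definition eval_loc (p : 'I_n -> k) (x : loc) : k :=
  let aN := projT1 (cid (loc_repr x)) in evalA p aN.1 / evalA p h ^+ aN.2.

End Localization.
End CoordinateRing.

Section QuotientModule.
Variables (k : fieldType) (V : lmodType k) (R : V -> Prop).

Definition submodule (P : V -> Prop) : Prop :=
  P 0 /\ forall c x y, P x -> P y -> P (c *: x + y).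

Definition gen_submod (x : V) : bool :=
  `[< forall P, submodule P -> (forall r, R r -> P r) -> P x >].

Lemma gen_submod_linear c x y : gen_submod x -> gen_submod y -> gen_submod (c *: x + y).
Proof.
move=> /asboolP hx /asboolP hy; apply/asboolP => P sP RP.
by apply: (proj2 sP); [exact: hx | exact: hy].
Qed.
Lemma gen_submod0 : gen_submod 0.
Proof. by apply/asboolP => P []. Qed.
Lemma gen_submod_zmod : zmod_closed gen_submod.
Proof.
split=> [|x y hx hy]; first exact: gen_submod0.
by rewrite addrC -scaleN1r; apply: gen_submod_linear.
Qed.
HB.instance Definition _ := GRing.isZmodClosed.Build V gen_submod gen_submod_zmod.

Definition gen_submod_sub : zmodClosed V := GRing.ZmodClosed.clone V gen_submod _.
Definition quot_mod : Type := Quotient.quot gen_submod_sub.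
HB.instance Definition _ := GRing.Zmodule.on quot_mod.

Definition to_quot_mod (x : V) : quot_mod := \pi_(Quotient.quot gen_submod_sub) x.
Definition quot_mod_scale (c : k) (x : quot_mod) : quot_mod :=
  to_quot_mod (c *: repr x).

Lemma to_quot_modB : zmod_morphism to_quot_mod.
Proof. by move=> x y; rewrite /to_quot_mod raddfB. Qed.
HB.instance Definition _ :=
  GRing.isZmodMorphism.Build V quot_mod to_quot_mod to_quot_modB.

Lemma to_quot_modP x y : to_quot_mod x = to_quot_mod y <-> gen_submod (x - y).
Proof.
by split=> [/eqP|h]; [|apply/eqP]; rewrite -(Quotient.idealrBE gen_submod_sub).
Qed.

Lemma quot_modK (x : quot_mod) : to_quot_mod (repr x) = x.
Proof. exact: reprK. Qed.

Lemma to_quot_modZ c x : to_quot_mod (c *: x) = quot_mod_scale c (to_quot_mod x).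
Proof.
apply/to_quot_modP; rewrite -scalerBr -[_ *: _]addr0.
by apply: gen_submod_linear gen_submod0; apply/to_quot_modP; rewrite quot_modK.
Qed.

Lemma quot_mod_scaleA c d x :
  quot_mod_scale c (quot_mod_scale d x) = quot_mod_scale (c * d) x.
Proof. by rewrite -(quot_modK x) -!to_quot_modZ scalerA. Qed.
Lemma quot_mod_scale1 : left_id 1 quot_mod_scale.
Proof. by move=> x; rewrite /quot_mod_scale scale1r quot_modK. Qed.
Lemma quot_mod_scaleDr : right_distributive quot_mod_scale +%R.
Proof.
move=> c x y; rewrite -(quot_modK x) -(quot_modK y) -raddfD -!to_quot_modZ.
by rewrite scalerDr raddfD.
Qed.
Lemma quot_mod_scaleDl x : {morph quot_mod_scale^~ x : c d / c + d}.
Proof. by move=> c d /=; rewrite /quot_mod_scale scalerDl raddfD. Qed.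
HB.instance Definition _ := GRing.Zmodule_isLmodule.Build k quot_mod
  quot_mod_scaleA quot_mod_scale1 quot_mod_scaleDr quot_mod_scaleDl.

End QuotientModule.

Section QuotientAlgebra.
Variables (k : fieldType) (F : lalgType k) (R : F -> Prop).

Definition ideal2 (P : F -> Prop) : Prop :=
  [/\ P 0, forall x y, P x -> P y -> P (x - y) &
      forall a x, P x -> P (a * x) /\ P (x * a)].

Definition ideal2_gen (x : F) : bool :=
  `[< forall P, ideal2 P -> (forall r, R r -> P r) -> P x >].

Lemma ideal2_gen_zmod : zmod_closed ideal2_gen.
Proof.
split=> [|x y /asboolP hx /asboolP hy]; apply/asboolP => P iP RP.
  by case: iP.
by case: (iP) => _ h _; apply: h; [exact: hx | exact: hy].
Qed.
HB.instance Definition _ := GRing.isZmodClosed.Build F ideal2_gen ideal2_gen_zmod.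

Lemma ideal2_genM a x : ideal2_gen x -> ideal2_gen (a * x) /\ ideal2_gen (x * a).
Proof.
move=> /asboolP hx; split; apply/asboolP => P iP RP; case: (iP) => _ _ h.
  by have [] := h a x (hx P iP RP).
by have [] := h a x (hx P iP RP).
Qed.

Definition ideal2_sub : zmodClosed F := GRing.ZmodClosed.clone F ideal2_gen _.
Definition quot_alg : Type := Quotient.quot ideal2_sub.
HB.instance Definition _ := GRing.Zmodule.on quot_alg.

Definition to_quot_alg (x : F) : quot_alg := \pi_(Quotient.quot ideal2_sub) x.

Lemma to_quot_algB : zmod_morphism to_quot_alg.
Proof. by move=> x y; rewrite /to_quot_alg raddfB. Qed.
HB.instance Definition _ :=
  GRing.isZmodMorphism.Build F quot_alg to_quot_alg to_quot_algB.

Lemma to_quot_algP x y : to_quot_alg x = to_quot_alg y <-> ideal2_gen (x - y).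
Proof.
by split=> [/eqP|h]; [|apply/eqP]; rewrite -(Quotient.idealrBE ideal2_sub).
Qed.

Lemma quot_algK (x : quot_alg) : to_quot_alg (repr x) = x.
Proof. exact: reprK. Qed.

Definition quot_alg_mul (x y : quot_alg) : quot_alg :=
  to_quot_alg (repr x * repr y).

Lemma to_quot_algM x y :
  to_quot_alg (x * y) = quot_alg_mul (to_quot_alg x) (to_quot_alg y).
Proof.
set x' := repr (to_quot_alg x); set y' := repr (to_quot_alg y).
apply/to_quot_algP.
have -> : x * y - x' * y' = (x - x') * y + x' * (y - y').
  by rewrite mulrBl mulrBr addrA subrK.
apply: (@rpredD _ ideal2_sub).
  by apply: (ideal2_genM _ _).2; apply/to_quot_algP; rewrite quot_algK.
by apply: (ideal2_genM _ _).1; apply/to_quot_algP; rewrite quot_algK.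
Qed.

Lemma quot_alg_mulA : associative quot_alg_mul.
Proof.
move=> x y z; rewrite -(quot_algK x) -(quot_algK y) -(quot_algK z).
by rewrite -!to_quot_algM mulrA.
Qed.
Lemma quot_alg_mul1 : left_id (to_quot_alg 1) quot_alg_mul.
Proof. by move=> x; rewrite -(quot_algK x) -to_quot_algM mul1r. Qed.
Lemma quot_alg_mulr1 : right_id (to_quot_alg 1) quot_alg_mul.
Proof. by move=> x; rewrite -(quot_algK x) -to_quot_algM mulr1. Qed.
Lemma quot_alg_mulDl : left_distributive quot_alg_mul +%R.
Proof.
move=> x y z; rewrite -(quot_algK x) -(quot_algK y) -(quot_algK z).
by rewrite -raddfD -!to_quot_algM mulrDl raddfD.
Qed.
Lemma quot_alg_mulDr : right_distributive quot_alg_mul +%R.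
Proof.
move=> x y z; rewrite -(quot_algK x) -(quot_algK y) -(quot_algK z).
by rewrite -raddfD -!to_quot_algM mulrDr raddfD.
Qed.
HB.instance Definition _ := GRing.Zmodule_isPzRing.Build quot_alg
  quot_alg_mulA quot_alg_mul1 quot_alg_mulr1 quot_alg_mulDl quot_alg_mulDr.

Lemma to_quot_alg_monoid : monoid_morphism to_quot_alg.
Proof. by split=> // x y; rewrite to_quot_algM. Qed.
HB.instance Definition _ :=
  GRing.isMonoidMorphism.Build F quot_alg to_quot_alg to_quot_alg_monoid.

Definition quot_alg_scale (c : k) (x : quot_alg) : quot_alg :=
  to_quot_alg c%:A * x.

Lemma quot_alg_scaleA c d x :
  quot_alg_scale c (quot_alg_scale d x) = quot_alg_scale (c * d) x.
Proof. by rewrite /quot_alg_scale mulrA -rmorphM mulr_algl scalerA. Qed.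
Lemma quot_alg_scale1 : left_id 1 quot_alg_scale.
Proof. by move=> x; rewrite /quot_alg_scale scale1r rmorph1 mul1r. Qed.
Lemma quot_alg_scaleDr : right_distributive quot_alg_scale +%R.
Proof. by move=> c x y; rewrite /quot_alg_scale mulrDr. Qed.
Lemma quot_alg_scaleDl x : {morph quot_alg_scale^~ x : c d / c + d}.
Proof. by move=> c d; rewrite /quot_alg_scale scalerDl rmorphD mulrDl. Qed.
HB.instance Definition _ := GRing.Zmodule_isLmodule.Build k quot_alg
  quot_alg_scaleA quot_alg_scale1 quot_alg_scaleDr quot_alg_scaleDl.

End QuotientAlgebra.

Section FreeModule.
Variables (k : fieldType) (K : choiceType) (L : lmodType k) (phi : K -> L).

(* The linear extension to the free k-module on K of a map defined on its
   basis. *)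
Definition malg_lift (z : malg K k) : L :=
  \sum_(q <- monalg.msupp z) monalg.mcoeff q z *: phi q.

Lemma malg_liftEw (d : finmap.finset_of (Phant K)) z :
  finmap.fsubset (monalg.msupp z) d ->
  malg_lift z = \sum_(q <- d) monalg.mcoeff q z *: phi q.
Proof.
move=> le; rewrite [LHS](finmap.big_fset_incl _ le) //= => x xd.
by move/monalg.mcoeff_outdom ->; rewrite scale0r.
Qed.

Lemma malg_lift_linear c z1 z2 :
  malg_lift (c *: z1 + z2) = c *: malg_lift z1 + malg_lift z2.
Proof.
pose d := finmap.fsetU (monalg.msupp z1) (monalg.msupp z2).
have d1 : finmap.fsubset (monalg.msupp z1) d by exact: finmap.fsubsetUl.
have d2 : finmap.fsubset (monalg.msupp z2) d by exact: finmap.fsubsetUr.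
have d3 : finmap.fsubset (monalg.msupp (c *: z1 + z2)) d.
  apply: (finmap.fsubset_trans (monalg.msuppD_le _ _)).
  by apply: finmap.fsetSU; exact: monalg.msuppZ_le.
rewrite (malg_liftEw d1) (malg_liftEw d2) (malg_liftEw d3).
rewrite scaler_sumr -big_split; apply: eq_bigr => q _ /=.
by rewrite monalg.mcoeffD monalg.mcoeffZ scalerDl scalerA.
Qed.

Lemma malg_liftU q : malg_lift (mkmalgU q 1) = phi q.
Proof.
rewrite (malg_liftEw monalg.msuppU_le) finmap.big_seq_fset1.
by rewrite monalg.mcoeffUU scale1r.
Qed.

End FreeModule.

(* M (x)_B N for a k-algebra B, a right B-module M and a left B-module N, the
   actions of B being given by [ract] and [lact]: the free k-module on M * N
   modulo k-bilinearity and B-balancedness. *)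
Section Tensor.
Variables (k : fieldType) (B : Type) (M N : lmodType k).
Variables (ract : M -> B -> M) (lact : B -> N -> N).

Local Notation free_pairs := (malg (M * N)%type k).
Local Notation elt m n := (mkmalgU (m, n) (1 : k) : free_pairs).

Inductive tensor_rel : free_pairs -> Prop :=
| tensor_rel_linl c m m' n :
    tensor_rel (elt (c *: m + m') n - (c *: elt m n + elt m' n))
| tensor_rel_linr c m n n' :
    tensor_rel (elt m (c *: n + n') - (c *: elt m n + elt m n'))
| tensor_rel_balanced m b n :
    tensor_rel (elt (ract m b) n - elt m (lact b n)).

Definition tensor : Type := quot_mod tensor_rel.
HB.instance Definition _ := GRing.Lmodule.on tensor.

Definition ptensor (m : M) (n : N) : tensor := to_quot_mod tensor_rel (elt m n).

(* The linear map sending m (x) n to phi m n. *)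
Definition tensor_lift (L : lmodType k) (phi : M -> N -> L) (t : tensor) : L :=
  malg_lift (fun q : (M * N)%type => phi q.1 q.2) (repr t).

Lemma tensor_lift_pure (L : lmodType k) (phi : M -> N -> L) :
  (forall c m m' n, phi (c *: m + m') n = c *: phi m n + phi m' n) ->
  (forall c m n n', phi m (c *: n + n') = c *: phi m n + phi m n') ->
  (forall m b n, phi (ract m b) n = phi m (lact b n)) ->
  forall m n, tensor_lift phi (ptensor m n) = phi m n.
Proof.
move=> linl linr bal m n; rewrite /tensor_lift.
set f := malg_lift _; have fU m' n' : f (elt m' n') = phi m' n'.
  exact: malg_liftU.
have fD c x y : f (c *: x + y) = c *: f x + f y by exact: malg_lift_linear.
have f0 : f 0 = 0 by have := fD (-1) 0 0; rewrite scaler0 addr0 scaleN1r addNr.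
have fA x y : f (x + y) = f x + f y by have := fD 1 x y; rewrite !scale1r.
have fZ c x : f (c *: x) = c *: f x by rewrite -[c *: x]addr0 fD f0 addr0.
have fB x y : f (x - y) = f x - f y by rewrite fA -[- y]scaleN1r fZ scaleN1r.
have /to_quot_modP/asboolP hs : to_quot_mod tensor_rel (repr (ptensor m n)) =
  to_quot_mod tensor_rel (elt m n) by rewrite quot_modK.
rewrite -fU; apply/eqP; rewrite -subr_eq0 -fB; apply/eqP.
apply: (hs (fun z => f z = 0)) => [|r]; first by split=> // c x y fx fy;
  rewrite fD fx fy scaler0 addr0.
by case=> *; rewrite fB ?fA ?fZ !fU ?linl ?linr ?bal ?subrr.
Qed.

End Tensor.

Section Derivations.
Variables (k : fieldType) (B : comAlgType k).

Definition derivation (D : B -> B) : Prop :=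
  (forall c x y, D (c *: x + y) = c *: D x + D y) /\
  (forall x y, D (x * y) = D x * y + x * D y).

Definition is_der (D : B -> B) : bool := `[< derivation D >].

Lemma is_der_submod : GRing.submod_closed is_der.
Proof.
split=> [|c D E /asboolP[Dl DM] /asboolP[El EM]]; apply/asboolP.
  have z x : (0 : B -> B) x = 0 by [].
  by split=> [c x y|x y]; rewrite !z ?scaler0 ?mul0r ?mulr0 addr0.
have e x : (c *: D + E : B -> B) x = c *: D x + E x by [].
split=> [d x y|x y]; rewrite !e.
  by rewrite Dl El !scalerDr !scalerA (mulrC c d) addrACA.
by rewrite DM EM scalerDr mulrDl mulrDr -scalerAl -scalerAr addrACA.
Qed.
HB.instance Definition _ :=
  GRing.isSubmodClosed.Build k (B -> B) is_der is_der_submod.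

Record der : Type := Der { der_fun :> B -> B; der_subproof : is_der der_fun }.
HB.instance Definition _ := [isSub for der_fun].
HB.instance Definition _ := [Choice of der by <:].
HB.instance Definition _ := [SubChoice_isSubZmodule of der by <:].
HB.instance Definition _ := [SubZmodule_isSubLmodule of der by <:].

Lemma is_der_bracket (D E : der) : is_der (fun x => D (E x) - E (D x)).
Proof.
case: D E => [D /asboolP[Dl DM]] [E /asboolP[El EM]] /=; apply/asboolP.
have DA x y : D (x + y) = D x + D y by have := Dl 1 x y; rewrite !scale1r.
have EA x y : E (x + y) = E x + E y by have := El 1 x y; rewrite !scale1r.
split=> [c x y|x y].
  by rewrite El Dl Dl El scalerBr opprD addrACA.
rewrite EM DM DA EA !DM !EM mulrBl mulrBr.
rewrite [D x * E y + _]addrC addrACA [E x * D y + x * _]addrC.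
rewrite [E (D x) * y + _ + _]addrACA [E x * D y + _]addrC.
by rewrite opprD addrACA subrr addr0 opprD addrACA.
Qed.
Definition der_bracket (D E : der) : der := Der (is_der_bracket D E).

End Derivations.

Section AVModules.
Variables (k : closedFieldType) (n : nat) (X : variety k n).
Local Notation A := (coord_ring X).
Local Notation V := (der A).

Section Actions.
Variables (M : lmodType k) (actA : A -> M -> M) (actV : V -> M -> M).

Record AV_module : Prop := {
  AV_A_linl : forall c f g m, actA (c *: f + g) m = c *: actA f m + actA g m;
  AV_A_linr : forall f c m m', actA f (c *: m + m') = c *: actA f m + actA f m';
  AV_A_one : forall m, actA 1 m = m;
  AV_A_mul : forall f g m, actA (f * g) m = actA f (actA g m);
  AV_V_linl : forall c (D E : V) m,
    actV (c *: D + E) m = c *: actV D m + actV E m;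
  AV_V_linr : forall D c m m', actV D (c *: m + m') = c *: actV D m + actV D m';
  AV_V_bracket : forall D E m,
    actV (der_bracket D E) m = actV D (actV E m) - actV E (actV D m);
  AV_leibniz : forall (D : V) f m,
    actV D (actA f m) = actA (D f) m + actA f (actV D m) }.

Definition AV_submodule (N : M -> Prop) : Prop :=
  [/\ submodule N, forall f m, N m -> N (actA f m) &
      forall D m, N m -> N (actV D m)].

Definition AV_simple : Prop :=
  [/\ AV_module, exists m : M, m <> 0 &
      forall N, AV_submodule N -> (forall m, N m -> m = 0) \/ (forall m, N m)].

Definition A_fin_gen (N : M -> Prop) : Prop :=
  exists d (e : 'I_d -> M), (forall i, N (e i)) /\
    forall m, N m -> exists f : 'I_d -> A, m = \sum_(i < d) actA (f i) (e i).

End Actions.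

(* The smash product A # U(P) of A with the enveloping algebra of a Lie
   subalgebra P of V, presented by generators and relations: a module over it
   is the same thing as a vector space with compatible actions of A and P. *)
Section SmashProduct.
Variable P : pred V.

Definition smash_gen : Type := (A + {D : V | P D})%type.
HB.instance Definition _ := Choice.on smash_gen.

Local Notation free_alg := (malg (fmonom smash_gen) k).

Definition freeA (f : A) : free_alg := mkmalgU (fmu (inl f : smash_gen)) 1.
Definition freeV (D : {D : V | P D}) : free_alg :=
  mkmalgU (fmu (inr D : smash_gen)) 1.

Inductive smash_rel : free_alg -> Prop :=
| smash_A_lin c f g : smash_rel (freeA (c *: f + g) - (c *: freeA f + freeA g))
| smash_A_one : smash_rel (freeA 1 - 1)
| smash_A_mul f g : smash_rel (freeA (f * g) - freeA f * freeA g)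
| smash_V_lin c D E F : val F = c *: val D + val E ->
    smash_rel (freeV F - (c *: freeV D + freeV E))
| smash_V_bracket D E F : val F = der_bracket (val D) (val E) ->
    smash_rel (freeV F - (freeV D * freeV E - freeV E * freeV D))
| smash_leibniz D f :
    smash_rel (freeV D * freeA f - (freeA (val D f) + freeA f * freeV D)).

Definition smash : Type := quot_alg smash_rel.
HB.instance Definition _ := GRing.PzRing.on smash.
HB.instance Definition _ := GRing.Lmodule.on smash.

Definition smashA (f : A) : smash := to_quot_alg smash_rel (freeA f).
Definition smashV (D : {D : V | P D}) : smash :=
  to_quot_alg smash_rel (freeV D).

(* The action on M of an element of the smash product, given the action of the
   generators; when the latter respects the relations, the chosen
   representative of the element does not matter. *)
Definition smash_act (M : lmodType k) (act : smash_gen -> M -> M)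
    (b : smash) (m : M) : M :=
  malg_lift (fun w : fmonom smash_gen => foldr act m w) (repr b).

End SmashProduct.

Definition smash_full : Type := smash (fun=> true).
HB.instance Definition _ := GRing.PzRing.on smash_full.
HB.instance Definition _ := GRing.Lmodule.on smash_full.

Definition full_gen (P : pred V) (x : smash_gen P) : smash_full :=
  match x with
  | inl f => smashA (fun=> true) f
  | inr D => smashV (exist (fun=> true) (val D) isT)
  end.

(* The algebra morphism A # U(P) -> A # U(V). *)
Definition smash_incl (P : pred V) (b : smash P) : smash_full :=
  smash_act (fun x s => full_gen x * s) b 1.

(* A # U(V) (x)_(A # U(P)) U, where [act] is the action on U of the generators
   of A # U(P), and its A V-module structure. *)
Section Induced.
Variables (P : pred V) (U : lmodType k) (act : smash_gen P -> U -> U).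

Definition induced : Type :=
  tensor (fun (s : smash_full) (b : smash P) => s * smash_incl b)
    (smash_act act).
HB.instance Definition _ := GRing.Lmodule.on induced.

Definition induced_mul (s : smash_full) : induced -> induced :=
  tensor_lift (fun s' u => ptensor _ _ (s * s') u : induced).
Definition inducedA (f : A) : induced -> induced :=
  induced_mul (smashA (fun=> true) f).
Definition inducedV (D : V) : induced -> induced :=
  induced_mul (smashV (exist (fun=> true) D isT)).

End Induced.
End AVModules.

Section Charts.
Variables (k : closedFieldType) (n : nat) (X : variety k n).
Variables (m : nat) (g : 'I_m -> {mpoly k[n]}) (s : nat).
Local Notation A := (coord_ring X).
Local Notation V := (der A).

Definition generates_ideal : Prop :=
  forall f : {mpoly k[n]}, vanishing X f <->
    exists q : 'I_m -> {mpoly k[n]}, f = \sum_(i < m) q i * g i.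

Definition jacobian : 'M[A]_(m, n) := \matrix_(i, j) to_coord X (g i)^`M(j).

Definition jac_rank : nat := \rank (map_mx (@toK k n X) jacobian).

Definition jacobian_at (p : 'I_n -> k) : 'M[k]_(m, n) :=
  \matrix_(i, j) ((g i)^`M(j)).@[p].

(* s stands for dim X, so the Jacobian matrix has rank n - dim X at p. *)
Definition nonsingular (p : 'I_n -> k) : Prop :=
  X p /\ (\rank (jacobian_at p) + s = n)%N.

Definition smooth : Prop := forall p, X p -> nonsingular p.

(* A chart of the standard atlas: the rows and the columns of a nonzero
   r x r minor of the Jacobian matrix, and the indices of the remaining
   columns, all listed in increasing order. *)
Record chart := Chart {
  chart_row : 'I_jac_rank -> 'I_m;
  chart_col : 'I_jac_rank -> 'I_n;
  chart_par : 'I_s -> 'I_n;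
  _ : {homo chart_row : i j / (i < j)%N};
  _ : {homo chart_col : i j / (i < j)%N};
  _ : {homo chart_par : i j / (i < j)%N};
  _ : forall j, (j \in codom chart_par) = (j \notin codom chart_col);
  _ : \det (mxsub chart_row chart_col jacobian) != 0 }.

Definition minor (c : chart) : A :=
  \det (mxsub (chart_row c) (chart_col c) jacobian).

Definition in_chart (c : chart) (p : 'I_n -> k) : Prop :=
  X p /\ evalA p (minor c) != 0.

Section InChart.
Variable c : chart.
Local Notation Ah := (loc (minor c)).

Definition param (i : 'I_s) : A := to_coord X 'X_(chart_par c i).

Definition is_partial (i : 'I_s) (D : der Ah) : Prop :=
  forall j, D (to_loc (minor c) (param j)) = (j == i)%:R.

(* d/dt_i on A_(h): the unique derivation mapping t_j to delta_ij. *)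
Definition partial (i : 'I_s) : der Ah :=
  if pselect (exists D, is_partial i D) is left e then projT1 (cid e) else 0.

(* The coefficient f_i of d/dt_i in D = \sum_i f_i d/dt_i. *)
Definition coef (D : V) (i : 'I_s) : Ah := to_loc (minor c) (D (param i)).

Variables (U : vectType k) (rho : 'M[k]_s -> 'End(U)).

Section Rudakov.
Variable p : 'I_n -> k.

Definition Vplus : pred V := fun D => `[< forall f, evalA p (D f) = 0 >].

(* The image of D in gl_s is \sum_(i, j) (d f_i / d t_j)(p) E_ji: the degree 0
   part of the Taylor expansion of \sum_i f_i d/dt_i at p is
   \sum_(i, j) (d f_i / d t_j)(p) X_j d/dX_i. *)
Definition rudakov_gl (D : V) : 'M[k]_s :=
  \sum_(i < s) \sum_(j < s)
     eval_loc p (partial j (coef D i)) *: delta_mx j i.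

Definition rudakov_act (x : smash_gen Vplus) (u : U) : U :=
  match x with
  | inl f => evalA p f *: u
  | inr D => rho (rudakov_gl (val D)) u
  end.

Definition rudakov : Type := induced rudakov_act.
HB.instance Definition _ := GRing.Lmodule.on rudakov.

Definition rudakovA : A -> rudakov -> rudakov := @inducedA _ _ _ _ _ rudakov_act.
Definition rudakovV : V -> rudakov -> rudakov := @inducedV _ _ _ _ _ rudakov_act.

End Rudakov.

(* A_(h) (x)_k U; the elements gpure f u are its pure tensors. *)
Definition gauge_space : Type :=
  tensor (fun (f : Ah) (a : k) => a *: f) (fun (a : k) (u : U) => a *: u).
HB.instance Definition _ := GRing.Lmodule.on gauge_space.

Definition gpure (f : Ah) (u : U) : gauge_space := ptensor _ _ f u.
Definition glift (phi : Ah -> U -> gauge_space) : gauge_space -> gauge_space :=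
  tensor_lift phi.

Definition gmul (f : Ah) : gauge_space -> gauge_space :=
  glift (fun f' u => gpure (f * f') u).
Definition gpartial (i : 'I_s) : gauge_space -> gauge_space :=
  glift (fun f u => gpure (partial i f) u).
Definition grho (a : 'M[k]_s) : gauge_space -> gauge_space :=
  glift (fun f u => gpure f (rho a u)).

(* gmul f, gpartial i and grho a act on A_(h) (x) U as multiplication by f,
   d/dt_i (x) 1 and 1 (x) rho a; L_+ acts on U through gl_s. *)
Definition gauge_fields (B : 'I_s -> gauge_space -> gauge_space) : Prop :=
  [/\ forall i x y, B i (x + y) = B i x + B i y,
      forall i f x, B i (gmul f x) = gmul f (B i x),
      forall i a x, B i (grho a x) = grho a (B i x) &
      forall i j x,
        let nabla l (y : gauge_space) := gpartial l y + B l y in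
        nabla i (nabla j x) - nabla j (nabla i x) = 0].

Definition gaugeA (f : A) : gauge_space -> gauge_space :=
  gmul (to_loc (minor c) f).

(* The action of D = \sum_i f_i d/dt_i. As U is a gl_s-module, only the terms
   of order one in the partial derivatives of the f_i are nonzero, and
   X_j d/dX_i acts on U by E_ji. *)
Definition gaugeV (B : 'I_s -> gauge_space -> gauge_space) (D : V) :
    gauge_space -> gauge_space :=
  glift (fun f u =>
    \sum_(i < s)
      (gpure (coef D i * partial i f) u
       + gmul (f * coef D i) (B i (gpure 1 u))
       + \sum_(j < s)
           gpure (f * partial j (coef D i)) (rho (delta_mx j i) u))).

Definition local_gauge_module (B : 'I_s -> gauge_space -> gauge_space)
    (N : gauge_space -> Prop) : Prop :=
  AV_submodule gaugeA (gaugeV B) N /\ A_fin_gen gaugeA N.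

End InChart.

Section Gauge.
Variables (U : vectType k) (rho : 'M[k]_s -> 'End(U)).
Variables (M : lmodType k) (actA : A -> M -> M) (actV : V -> M -> M).

Definition AV_iso_onto (c : chart)
    (B : 'I_s -> gauge_space c U -> gauge_space c U)
    (N : gauge_space c U -> Prop) (phi : M -> gauge_space c U) : Prop :=
  [/\ forall a x y, phi (a *: x + y) = a *: phi x + phi y,
      forall f x, phi (actA f x) = gaugeA f (phi x),
      forall D x, phi (actV D x) = gaugeV rho B D (phi x),
      injective phi &
      forall y, N y <-> exists x, y = phi x].

Definition gauge_module : Prop :=
  AV_module actA actV /\
  forall c : chart,
  exists B : 'I_s -> gauge_space c U -> gauge_space c U, gauge_fields rho B /\
    exists N : gauge_space c U -> Prop, local_gauge_module rho B N /\
    exists phi : M -> gauge_space c U, AV_iso_onto B N phi.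

End Gauge.
End Charts.

Section GlModules.
Variables (k : fieldType) (s : nat) (U : vectType k) (rho : 'M[k]_s -> 'End(U)).

Definition gl_module : Prop :=
  (forall c a b u, rho (c *: a + b) u = c *: rho a u + rho b u) /\
  (forall a b u,
     rho (a *m b - b *m a) u = rho a (rho b u) - rho b (rho a u)).

Definition gl_simple : Prop :=
  [/\ gl_module, exists u : U, u <> 0 &
      forall W : {vspace U}, (forall a w, w \in W -> rho a w \in W) ->
        W = 0%VS \/ W = fullv].

End GlModules.

(* Main.v *)
From HB Require Import structures.
Require Import Defs.
From mathcomp Require Import all_boot all_order all_algebra.
From mathcomp Require finmap monalg functions.
From mathcomp Require Import boolp ssrAC ring.
Import -(notations) functions.
Import -(notations) finmap.
Import -(notations) monalg.
From mathcomp Require Import mpoly.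

Set Implicit Arguments.
Unset Strict Implicit.
Unset Printing Implicit Defensive.

Import GRing.Theory.
Local Open Scope ring_scope.

(** On a chart N(h) with parameters t_1, .., t_s, the derivations h d/dt_i are
    vector fields on X. So a submodule over A and V is stable, up to powers of
    h, under the partial derivatives; and it is stable under gl_s, because the
    action of f D minus f times the action of D only involves df and gl_s.

    Rudakov modules. R_p(U) is filtered by the number of fields tau_i,
    proportional to h d/dt_i, applied to 1 (x) U ([filt]). The functions
    t_i - t_i(p) decrease this number, and the Euler operator, the sum of the
    tau_i (t_i - t_i(p)), acts as the scalar - d, modulo fewer fields, on what
    is obtained with d fields ([filt_euler]). In characteristic 0, a nonzero
    submodule therefore contains a nonzero element of 1 (x) U, then 1 (x) U
    since U is simple, then everything ([delta_module_simple]). That R_p(U) is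
    not zero is seen by mapping it to the coinduced module of the linear maps
    A_(h) -> U, where 1 (x) u goes to g |-> g(p) u ([rudakov_delta_neq0]).

    Gauge modules. In A_(h) (x) U, localize a nonzero submodule N at h. The
    result is stable under gl_s, hence under End(U) by Burnside's theorem
    ([burnside]), and under the operators d/dt_i + B_i. So the functions q for
    which it contains q (x) U form a nonzero ideal of A_(h) stable under the
    d/dt_i. Such an ideal contains a nonzero polynomial in the t_i, because A
    is algebraic over them when dim X = s, and the derivatives of this
    polynomial reach a nonzero constant ([differentially_simple]). Thus a power
    of h multiplies any given element x of the gauge module into N
    ([gauge_full]). On a smooth variety the minors h have no common zero
    ([smooth_chart]), so the Nullstellensatz ([coord_nullstellensatz]) puts x
    itself in N. *)

(** * Linear maps and submodules as predicates *)

Section LinearPred.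
Variables (k : pzRingType) (V W : lmodType k).

(** Most linear maps below are obtained by descending a formula to a quotient;
    their linearity is kept as a property, next to the other facts about the
    formula. *)
Definition klinear (f : V -> W) := forall c x y, f (c *: x + y) = c *: f x + f y.

Variable f : V -> W.
Hypothesis fL : klinear f.
Lemma klinD x y : f (x + y) = f x + f y.
Proof. by have := fL 1 x y; rewrite !scale1r. Qed.
Lemma klin0 : f 0 = 0.
Proof. by apply: (addrI (f 0)); rewrite -klinD !addr0. Qed.
Lemma klinZ c x : f (c *: x) = c *: f x.
Proof. by rewrite -[c *: x]addr0 fL klin0 addr0. Qed.
Lemma klinB x y : f (x - y) = f x - f y.
Proof. by rewrite -[- y]scaleN1r klinD klinZ scaleN1r. Qed.
Lemma klin_sum (I : Type) (r : seq I) (P : pred I) F :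
  f (\sum_(i <- r | P i) F i) = \sum_(i <- r | P i) f (F i).
Proof. exact: (big_morph f klinD klin0). Qed.
End LinearPred.

Section Submodules.
Variables (k : fieldType) (V : lmodType k) (P : V -> Prop).
Hypothesis sP : submodule P.
Lemma submodule0 : P 0. Proof. by case: sP. Qed.
Lemma submoduleD x y : P x -> P y -> P (x + y).
Proof. by move=> Px Py; have := proj2 sP 1 x y Px Py; rewrite scale1r. Qed.
Lemma submoduleZ c x : P x -> P (c *: x).
Proof. by move=> Px; have := proj2 sP c x 0 Px submodule0; rewrite addr0. Qed.
Lemma submoduleB x y : P x -> P y -> P (x - y).
Proof. by move=> Px Py; apply: submoduleD => //; rewrite -scaleN1r; apply: submoduleZ. Qed.
Lemma submodule_sum (I : Type) (r : seq I) (Q : pred I) F :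
  (forall i, Q i -> P (F i)) -> P (\sum_(i <- r | Q i) F i).
Proof. by move=> PF; apply: big_ind => //; [exact: submodule0 | exact: submoduleD]. Qed.
End Submodules.

Lemma klin_comp (k : pzRingType) (V1 V2 V3 : lmodType k) (F : V2 -> V3) (G : V1 -> V2) :
  klinear F -> klinear G -> klinear (fun x => F (G x)).
Proof. by move=> FL GL a x y; rewrite GL FL. Qed.
Lemma klin_add (k : pzRingType) (V1 V2 : lmodType k) (F G : V1 -> V2) :
  klinear F -> klinear G -> klinear (fun x => F x + G x).
Proof. by move=> FL GL a x y; rewrite GL FL scalerDr addrACA. Qed.
Lemma klin_bigsum (k : pzRingType) (V1 V2 : lmodType k) (I : Type) (r : seq I) (F : I -> V1 -> V2) :
  (forall i, klinear (F i)) -> klinear (fun x => \sum_(i <- r) F i x).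
Proof.
move=> FL a x y; rewrite scaler_sumr -big_split /=; apply: eq_bigr => i _.
exact: FL.
Qed.


Lemma klin_scale (k : fieldType) (a : k) (V W : lmodType k) (F : V -> W) :
  klinear F -> klinear (fun x => a *: F x).
Proof. by move=> FL b x y; rewrite FL scalerDr !scalerA mulrC. Qed.

(** * Polynomials in several variables *)

Section MPolyTools.
Variables (n : nat) (R : comNzRingType).

Lemma mpoly_alg_ind (P : {mpoly R[n]} -> Prop) :
  (forall c, P c%:MP) -> (forall i, P 'X_i) ->
  (forall p q, P p -> P q -> P (p + q)) ->
  (forall p q, P p -> P q -> P (p * q)) -> forall p, P p.
Proof.
move=> PC PX PD PM; elim/mpolyind => [|c m p _ _ Pp]; first by rewrite -mpolyC0.
apply: PD => //; rewrite -mul_mpolyC; apply: (PM) => //.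
rewrite mpolyXE_id; apply: (big_ind P) => [|x y|i _]; [exact: PC 1|exact: PM|].
by elim: (m i) => [|e IH]; [exact: PC 1 | rewrite exprS; apply: PM].
Qed.

End MPolyTools.

Section Muni.
Variables (n : nat) (R : comNzRingType).
Local Notation widen := (widen_ord (leqnSn n)).

Lemma muniXwiden (i : 'I_n) : muni ('X_(widen i) : {mpoly R[n.+1]}) = ('X_i)%:P.
Proof.
rewrite /muni mmapX mmap1U; case: splitP => [j eq|j].
  by congr ('X__)%:P; apply/val_inj => /=; rewrite -eq.
by rewrite ord1 /= addn0 => /eqP /=; rewrite ltn_eqF.
Qed.

Lemma muniXmax : muni ('X_ord_max : {mpoly R[n.+1]}) = 'X.
Proof.
rewrite /muni mmapX mmap1U; case: splitP => //; case=> j lt_jn /eqP /=.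
by have := lt_jn; rewrite ltn_neqAle eq_sym => /andP[/negbTE->].
Qed.

Lemma ord_widenP (P : 'I_n.+1 -> Prop) :
  (forall i, P (widen i)) -> P ord_max -> forall i, P i.
Proof.
move=> Pw Pm i; have [lt_in|] := ltnP i n.
  by have -> : i = widen (Ordinal lt_in) by apply/val_inj.
move=> le_ni; have -> // : i = ord_max.
by apply/val_inj/eqP; rewrite eqn_leq /= le_ni -ltnS ltn_ord.
Qed.

(** With [muni_eq0], this reduces statements on n + 1 variables to univariate
    polynomials over n variables. *)
Lemma mmap_muni (S : comNzRingType) (f : {rmorphism R -> S})
    (h : 'I_n.+1 -> S) p :
  mmap f h p = (map_poly (mmap f (h \o widen)) (muni p)).[h ord_max].
Proof.
elim/mpoly_alg_ind: p => [c|i|p q IHp IHq|p q IHp IHq].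
- by rewrite muniC map_polyC /= hornerC !mmapC.
- rewrite mmapX mmap1U; elim/ord_widenP: i => [i|].
    by rewrite muniXwiden map_polyC /= hornerC mmapX mmap1U.
  by rewrite muniXmax map_polyX hornerX.
- by rewrite !rmorphD /= hornerD IHp IHq.
- by rewrite !rmorphM /= hornerM IHp IHq.
Qed.

Lemma muni_eq0 (p : {mpoly R[n.+1]}) : muni p = 0 -> p = 0.
Proof.
move=> p0; rewrite -[p]comp_mpoly_id /comp_mpoly.
by rewrite mmap_muni p0 rmorph0 horner0.
Qed.

End Muni.

Lemma msize_mderiv (R : nzRingType) n (i : 'I_n) (p : {mpoly R[n]}) d :
  (msize p <= d.+1)%N -> (msize p^`M(i) <= d)%N.
Proof.
move=> pd; rewrite msizeE; apply/bigmax_leqP_seq => m mp _.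
have /msize_mdeg_lt : (m + U_(i))%MM \in msupp p.
  move: mp; rewrite !mcoeff_msupp mcoeff_mderiv; apply: contraNneq => ->.
  by rewrite mul0rn.
by rewrite mdegD mdeg1 addn1 => /leq_trans/(_ pd).
Qed.

Lemma mderiv_eq0_const (R : idomainType) n (p : {mpoly R[n]}) :
  [pchar R] =i pred0 -> (forall i, p^`M(i) = 0) -> p = (p@_0)%:MP.
Proof.
move=> /pcharf0P char0 dp; apply/mpolyP => m; rewrite mcoeffC.
have [->|m0] := eqVneq m 0%MM; first by rewrite mulr1.
rewrite mulr0.
have [i mi] : exists i, m i != 0%N.
  apply/existsP; apply: contraNT m0; rewrite negb_exists => /forallP mz.
  by apply/eqP/mnmP => i; rewrite mnm0E; apply/eqP; have := mz i; rewrite negbK.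
have := congr1 (mcoeff (m - U_(i))) (dp i).
rewrite mcoeff_mderiv mcoeff0 submK; last by rewrite lep1mP.
by rewrite -mulr_natr => /eqP; rewrite mulf_eq0 char0 orbF => /eqP.
Qed.

(** After division by a power of 'X, the relation P(a) = 0 has a nonzero
    constant term, which is then a multiple of a. *)
Lemma dependent_divides (S : comNzRingType) (R : idomainType)
    (f : {rmorphism S -> R}) (a : R) (P : {poly S}) :
  a != 0 -> P != 0 -> (map_poly f P).[a] = 0 ->
  exists2 r, r != 0 & exists b, f r = b * a.
Proof.
move=> a0; elim/poly_ind: P => [|P r IH]; first by rewrite eqxx.
move=> P0; rewrite rmorphD rmorphM /= map_polyX map_polyC /= hornerMXaddC => /eqP.
have [r0|r0] := eqVneq r 0; last first.
  rewrite addrC addr_eq0 => /eqP e; exists r => //.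
  by exists (- (map_poly f P).[a]); rewrite e mulNr.
move: P0; rewrite r0 polyC0 (rmorph0 f) !addr0 mulf_eq0 (negbTE a0) orbF => P0 /eqP.
by apply: IH; apply: contraNneq P0 => ->; rewrite mul0r.
Qed.

(** * Hilbert's Nullstellensatz *)

Section TopCoefficient.
Variable R : comNzRingType.
Implicit Types (p q : {poly R}) (a b : R).

(** A coefficient of degree d that need not be the leading one: it is
    compatible with sums and products even when it vanishes. *)
Definition has_top (p : {poly R}) d a := (size p <= d.+1)%N /\ p`_d = a.

Lemma has_top1 : has_top 1 0 1.
Proof. by split; rewrite ?size_poly1 // coef1. Qed.

Lemma has_topM p q d e a b :
  has_top p d a -> has_top q e b -> has_top (p * q) (d + e) (a * b).
Proof.
move=> [sp <-] [sq <-]; split.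
  apply: leq_trans (size_polyMleq _ _) _.
  by rewrite -subn1 leq_subLR (leq_trans (leq_add sp sq)) // addSn addnS.
rewrite coefM (bigD1 (inord d)) //= inordK ?ltnS ?leq_addr // addKn.
rewrite big1 ?addr0 // => i; rewrite -val_eqE /= inordK ?ltnS ?leq_addr //.
case: ltngtP => // [lt_id _|lt_di _]; last by rewrite nth_default ?mul0r ?(leq_trans sp).
rewrite [q`__]nth_default ?mulr0 //; apply: leq_trans sq _.
by rewrite ltn_subRL ltn_add2r.
Qed.

Lemma has_topX p d a e : has_top p d a -> has_top (p ^+ e) (d * e) (a ^+ e).
Proof.
move=> tp; elim: e => [|e IH]; first by rewrite muln0; exact: has_top1.
by rewrite mulnS !exprS; apply: has_topM.
Qed.

Lemma has_top_prod (I : Type) (r : seq I) (F : I -> {poly R}) (d : I -> nat) (a : I -> R) :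
  (forall i, has_top (F i) (d i) (a i)) ->
  has_top (\prod_(i <- r) F i) (\sum_(i <- r) d i) (\prod_(i <- r) a i).
Proof.
move=> tF; elim: r => [|i r IH]; first by rewrite !big_nil; exact: has_top1.
by rewrite !big_cons; apply: has_topM.
Qed.

Lemma has_top_line (u c : R) : has_top (u%:P + c%:P * 'X) 1 c.
Proof.
split; last by rewrite coefD coefC coefMX coefC add0r.
apply: leq_trans (size_polyD _ _) _; rewrite geq_max.
rewrite (leq_trans (size_polyC_leq1 _)) //.
by apply: leq_trans (size_polyMleq _ _) _; rewrite size_polyX addn2 ltnS size_polyC_leq1.
Qed.

Lemma has_top0 p d : (size p <= d)%N -> has_top p d 0.
Proof. by move=> sp; split; [exact: leqW | rewrite nth_default]. Qed.

Lemma has_topD p q d a b :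
  has_top p d a -> has_top q d b -> has_top (p + q) d (a + b).
Proof.
move=> [sp <-] [sq <-]; rewrite /has_top coefD; split=> //.
by apply: leq_trans (size_polyD _ _) _; rewrite geq_max sp.
Qed.

Lemma has_topC p d a c : has_top p d a -> has_top (c%:P * p) d (c * a).
Proof.
move=> tp; rewrite -[d]add0n; apply: has_topM => //.
by split; rewrite ?size_polyC_leq1 // coefC.
Qed.

End TopCoefficient.

Section Lines.
Variables (n : nat) (k : comNzRingType) (R : comNzRingType).
Variables (f : {rmorphism k -> R}) (u : 'I_n -> R) (c : 'I_n -> k).

(** The polynomial p(u + Z c) in Z. *)
Definition on_line : {rmorphism {mpoly k[n]} -> {poly R}} :=
  mmap (polyC \o f) (fun i => (u i)%:P + (f (c i))%:P * 'X).

(** The homogeneous component of highest degree. *)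
Definition top_form (p : {mpoly k[n]}) : {mpoly k[n]} :=
  \sum_(m <- msupp p | mdeg m == (msize p).-1) p@_m *: 'X_[m].

Lemma top_form_neq0 p : p != 0 -> top_form p != 0.
Proof.
move=> p0; apply/eqP => /mpolyP/(_ (mlead p)) /eqP.
rewrite /top_form raddf_sum /= mcoeff0 big_mkcond.
rewrite (bigD1_seq (mlead p)) ?mlead_supp ?msupp_uniq //=.
rewrite -(mlead_deg p0) eqxx mcoeffZ mcoeffX eqxx mulr1.
rewrite big1 ?addr0 ?mleadc_eq0 ?(negbTE p0) // => m nm.
by case: ifP => // _; rewrite mcoeffZ mcoeffX (negbTE nm) mulr0.
Qed.

(** In a direction c where the top form does not vanish, p becomes monic in the
    parameter of the lines, up to a constant. This normalization is the first
    step of the Nullstellensatz. *)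
Lemma has_top_on_line p :
  has_top (on_line p) (msize p).-1 (f (top_form p).@[c]).
Proof.
rewrite /on_line /= /mmap /top_form (raddf_sum (meval c)) /= (raddf_sum f) /= [X in has_top _ _ X]big_mkcond /=.
suff key (r : seq 'X_{1..n}) : {subset r <= msupp p} ->
    has_top (\sum_(m <- r)
        (f p@_m)%:P * mmap1 (fun i => (u i)%:P + (f (c i))%:P * 'X) m)
      (msize p).-1
      (\sum_(m <- r) (if mdeg m == (msize p).-1
                      then f (p@_m *: 'X_[m]).@[c] else 0)).
  exact: key.
elim: r => [|m r IH] rp.
  by rewrite !big_nil; split; rewrite ?size_poly0 ?coef0.
rewrite !big_cons; apply: has_topD; last first.
  by apply: IH => x xr; apply: rp; rewrite inE xr orbT.
have /msize_mdeg_lt lt_m : m \in msupp p by apply: rp; rewrite inE eqxx.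
have tm : has_top (mmap1 (fun i => (u i)%:P + (f (c i))%:P * 'X) m) (mdeg m)
    (f ('X_[m]).@[c]).
  rewrite mevalX rmorph_prod /= /mmap1 mdegE.
  apply: has_top_prod => i; have := has_topX (m i) (has_top_line (u i) (f (c i))).
  by rewrite mul1n rmorphXn.
case: eqP => [<-|/eqP ne].
  by rewrite mevalZ rmorphM /=; apply: has_topC.
apply: has_top0.
have lt_m' : (mdeg m < (msize p).-1)%N.
  by rewrite ltn_neqAle ne -ltnS (leq_trans lt_m) // leqSpred.
apply: leq_trans lt_m'; by have [] := has_topC (f p@_m) tm.
Qed.

End Lines.

Section Nullstellensatz.
Variable k : closedFieldType.

Lemma mpoly_nonzero_point n (p : {mpoly k[n]}) : p != 0 -> exists a, p.@[a] != 0.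
Proof.
elim: n p => [|n IH] p p0.
  exists (fun=> 0); move: p0; rewrite [p]nvar0_mpolyC mevalC.
  by apply: contra_neq => ->; rewrite mpolyC0.
have : lead_coef (muni p) != 0.
  by rewrite lead_coef_eq0; apply: contra_neq p0; exact: muni_eq0.
case/IH=> b pb; have : map_poly (meval b) (muni p) != 0.
  apply/eqP => /polyP/(_ (size (muni p)).-1); rewrite coef_map coef0 /=.
  by apply/eqP.
case/closed_nonrootP => z; rewrite /root => pz.
exists (fun i => if unlift ord_max i is Some j then b j else z).
rewrite /meval mmap_muni unlift_none; move: pz; congr (_.[_] != 0).
apply: eq_map_poly => q /=; rewrite /meval; apply: eq_bigr => m _; congr (_ * _).
apply: mmap1_eq => i /=.
have -> : widen_ord (leqnSn n) i = lift ord_max i by apply/val_inj; rewrite /= /bump leqNgt ltn_ord.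
by rewrite liftK.
Qed.

Definition ideal (R : comNzRingType) (I : R -> Prop) :=
  [/\ I 0, forall x y, I x -> I y -> I (x + y) & forall a x, I x -> I (a * x)].

Lemma ideal_sum (R : comNzRingType) (I : R -> Prop) (T : Type) (r : seq T)
    (F : T -> R) :
  ideal I -> (forall i, I (F i)) -> I (\sum_(i <- r) F i).
Proof. by move=> [I0 ID _] IF; apply: (big_ind I). Qed.

Lemma ideal_opp (R : comNzRingType) (I : R -> Prop) x : ideal I -> I x -> I (- x).
Proof. by move=> [_ _ IM] /(IM (-1)); rewrite mulN1r. Qed.

(** Nakayama's lemma for the fiber of S[X]/I at ev. Since P is monic, S[X]/I is
    generated over S by the powers of X below the degree of P. If an element of
    I becomes 1 in the fiber, each of these powers is a combination of all of
    them with coefficients in the kernel of ev. With N the matrix of these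
    coefficients, det (1 - N) lies in I and is sent to 1 by ev. *)
Lemma nakayama_fiber (S : comNzRingType) (ev : {rmorphism S -> k})
    (I : {poly S} -> Prop) P g :
  ideal I -> P \is monic -> I P -> I g -> map_poly ev g = 1 ->
  exists2 r, I r%:P & ev r = 1.
Proof.
move=> Iid Pm IP Ig g1; have [I0 ID IM] := Iid.
pose d := (size P).-1.
pose a l (j : 'I_d) := (Pdiv.Ring.rmodp 'X^l P)`_j.
have red l : I ('X^l - \sum_(j < d) (a l j)%:P * 'X^j).
  have e := Pdiv.RingMonic.rdivp_eq Pm 'X^l.
  have -> : \sum_(j < d) (a l j)%:P * 'X^j = Pdiv.Ring.rmodp 'X^l P.
    under eq_bigr do rewrite mul_polyC.
    rewrite -(poly_def d (fun j => (Pdiv.Ring.rmodp 'X^l P)`_j)).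
    apply/polyP => j; rewrite coef_poly; case: ltnP => // le_dj.
    rewrite nth_default // (leq_trans _ le_dj) // -ltnS /d.
    by rewrite prednK ?size_poly_gt0 ?Pdiv.CommonRing.ltn_rmodpN0 ?monic_neq0.
  by rewrite {1}e addrK; apply: IM.
(* Modulo I, X^i = X^i c with c = 1 - g, whose coefficients vanish in the fiber. *)
pose c : {poly S} := 1 - g.
have evc l : ev c`_l = 0.
  by rewrite coefB rmorphB /= -(coef_map ev g) /= g1 !coef1 rmorph_nat subrr.
pose N := \matrix_(i < d, j < d) \sum_(l < size c) c`_l * a (l + i)%N j.
have relN (i : 'I_d) : I ('X^i - \sum_j (N i j)%:P * 'X^j).
  have -> : 'X^i - \sum_j (N i j)%:P * 'X^j =
     'X^i * g + \sum_(l < size c) (c`_l)%:P *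
        ('X^(l + i) - \sum_(j < d) (a (l + i)%N j)%:P * 'X^j).
    under [in RHS]eq_bigr do rewrite mulrBr mulr_sumr.
    rewrite sumrB exchange_big addrA /=; congr (_ - _); last first.
      apply: eq_bigr => j _; rewrite mxE rmorph_sum /= mulr_suml.
      by apply: eq_bigr => l _; rewrite polyCM mulrA.
    have -> : \sum_(l < size c) (c`_l)%:P * 'X^(l + i) = 'X^i * c.
      rewrite -[c in RHS]coefK poly_def mulr_sumr; apply: eq_bigr => l _.
      by rewrite -mul_polyC exprD [RHS]mulrC mulrA.
    by rewrite -mulrDr /c addrC subrK mulr1.
  apply: ID; first exact: IM.
  by apply: ideal_sum => // l; apply: IM.
pose Q := 1%:M - N.
have relQ (i : 'I_d) : I (\sum_j (Q i j)%:P * 'X^j).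
  suff -> : \sum_j (Q i j)%:P * 'X^j = 'X^i - \sum_j (N i j)%:P * 'X^j by [].
  under eq_bigr do rewrite mxE [(- N) _ _]mxE polyCB mulrBl.
  rewrite sumrB; congr (_ - _); rewrite (bigD1 i) //= mxE eqxx mul1r big1 ?addr0 //.
  by move=> j ji; rewrite mxE eq_sym (negbTE ji) mul0r.
have evQ : ev (\det Q) = 1.
  rewrite -det_map_mx map_mxB map_mx1.
  have -> : map_mx ev N = 0.
    apply/matrixP => i j; rewrite !mxE rmorph_sum big1 // => l _.
    by rewrite rmorphM /= evc mul0r.
  by rewrite subr0 det1.
exists (\det Q) => //.
have detI (i : 'I_d) : I ((\det Q)%:P * 'X^i).
  have -> : (\det Q)%:P * 'X^i = \sum_l (\adj Q i l)%:P * \sum_j (Q l j)%:P * 'X^j.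
    under eq_bigr do rewrite mulr_sumr.
    rewrite exchange_big /= (bigD1 i) //= [X in _ + X]big1 ?addr0 => [|j ji].
      have /matrixP/(_ i i) := mul_adj_mx Q; rewrite !mxE eqxx mulr1n => <-.
      by rewrite rmorph_sum /= mulr_suml; apply: eq_bigr => l _; rewrite polyCM mulrA.
    transitivity ((\sum_l \adj Q i l * Q l j)%:P * 'X^j).
      by rewrite rmorph_sum /= mulr_suml; apply: eq_bigr => l _; rewrite polyCM mulrA.
    have /matrixP/(_ i j) := mul_adj_mx Q.
    by rewrite !mxE eq_sym (negbTE ji) mulr0n => ->; rewrite mul0r.
  by apply: ideal_sum => // l; apply: IM; exact: relQ.
have [d0|d0] := posnP d; last by have := detI (Ordinal d0); rewrite mulr1.
have P1 : P = 1.
  have sP : size P = 1%N by rewrite -(prednK (_ : 0 < size P)%N) ?size_poly_gt0 ?monic_neq0 // -/d d0.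
  have /size1_polyC e : (size P <= 1)%N by rewrite sP.
  by move/monicP: Pm; rewrite e lead_coefC => ->.
by rewrite -[_%:P]mulr1 -P1; apply: IM.
Qed.


(** A nonzero element of least size divides all the others. *)
Lemma proper_ideal_root (H : {poly k} -> Prop) :
  ideal H -> ~ H 1 -> exists z, forall v, H v -> root v z.
Proof.
move=> Hid H1; have [H0 HD HM] := Hid.
have [all0|] := pselect (forall v, H v -> v = 0).
  by exists 0 => v /all0 ->; exact: root0.
move=> /existsNP[w /not_implyP[Hw w0]].
pose has_size s := `[< exists v, [/\ H v, v != 0 & size v = s] >].
have ex_size : exists s, has_size s.
  by exists (size w); apply/asboolP; exists w; split=> //; apply/eqP.
case: (ex_minnP ex_size) => _ /asboolP[v [Hv v0 <-]] min_v.
have [z vz] : exists z, root v z.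
  apply/closed_rootP/eqP => /eqP/size_poly1P[e e0 ve]; apply: H1.
  by have := HM (e^-1)%:P v Hv; rewrite ve -polyCM mulVf.
exists z => x Hx; have xv : x %% v = 0.
  apply: contraTeq (ltn_modpN0 x v0) => xv0; rewrite -leqNgt; apply: min_v.
  apply/asboolP; exists (x %% v); split=> //.
  rewrite -[x %% v](addKr (x %/ v * v)) -divp_eq.
  by apply: HD => //; apply: ideal_opp => //; apply: HM.
by rewrite (divp_eq x v) xv addr0 rootM vz orbT.
Qed.

(** Induction on the number of variables. Along the lines of a suitable
    direction, the ideal contains a monic polynomial. By induction the elements
    that are constant on these lines have a common zero b; by
    [nakayama_fiber] the restriction of the ideal to the line through b is
    proper, and it has a root by [proper_ideal_root]. *)
Lemma nullstellensatz n (I : {mpoly k[n]} -> Prop) :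
  ideal I -> (forall a, exists2 f, I f & f.@[a] != 0) -> I 1.
Proof.
elim: n I => [|n IH] I Iid noroot.
  have [f If] := noroot (fun=> 0); rewrite [f]nvar0_mpolyC mevalC => f0.
  have [_ _ IM] := Iid; have := IM (f@_0)^-1%:MP f If.
  by rewrite {2}[f]nvar0_mpolyC -mpolyCM mulVf // mpolyC1.
have [I0 ID IM] := Iid.
have [f If f0] : exists2 f, I f & f != 0.
  have [f If fv] := noroot (fun=> 0); exists f => //.
  by apply: contra_neq fv => ->; rewrite meval0.
have X0 : 'X_ord_max != 0 :> {mpoly k[n.+1]}.
  apply/eqP => /(congr1 (meval (fun=> 1))); rewrite mevalXU meval0.
  by apply/eqP; exact: oner_neq0.
have [c] := mpoly_nonzero_point (mulf_neq0 (top_form_neq0 f0) X0).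
rewrite mevalM mevalXU mulf_eq0 negb_or => /andP[cf cmax].
pose y (i : 'I_n.+1) : {mpoly k[n]} :=
  if unlift ord_max i is Some j then 'X_j else 0.
pose Phi := on_line (@mpolyC n k) y c.
pose z : {mpoly k[n.+1]} := (c ord_max)^-1 *: 'X_ord_max.
pose psi : {rmorphism {mpoly k[n]} -> {mpoly k[n.+1]}} :=
  mmap (@mpolyC n.+1 k) (fun j => 'X_(lift ord_max j) - c (lift ord_max j) *: z).
pose Psi (g : {poly {mpoly k[n]}}) := (map_poly psi g).[z].
have PsiD g1 g2 : Psi (g1 + g2) = Psi g1 + Psi g2 by rewrite /Psi rmorphD hornerD.
have PsiM g1 g2 : Psi (g1 * g2) = Psi g1 * Psi g2 by rewrite /Psi rmorphM hornerM.
have PsiC r : Psi r%:P = psi r by rewrite /Psi map_polyC hornerC.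
have PsiX : Psi 'X = z by rewrite /Psi map_polyX hornerX.
have psiC (r : k) : psi r%:MP = r%:MP by rewrite /psi /= mmapC.
have PhiX i : Phi 'X_i = (y i)%:P + (c i)%:MP%:P * 'X.
  by rewrite /Phi /on_line /= mmapX mmap1U.
have PhiC (r : k) : Phi r%:MP = (r%:MP)%:P by rewrite /Phi /on_line /= mmapC.
have PhiD p q : Phi (p + q) = Phi p + Phi q by apply: rmorphD.
have PhiM p q : Phi (p * q) = Phi p * Phi q by apply: rmorphM.
have PhiK g : Psi (Phi g) = g.
  elim/mpoly_alg_ind: g => [r|i|p q IHp IHq|p q IHp IHq].
  - by rewrite PhiC PsiC psiC.
  - rewrite PhiX PsiD PsiM PsiX !PsiC psiC /y mul_mpolyC.
    case: unliftP => [j ->|->]; first by rewrite /psi /= mmapX mmap1U subrK.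
    by rewrite rmorph0 add0r /z scalerA mulfV // scale1r.
  - by rewrite PhiD PsiD; congr (_ + _).
  - by rewrite PhiM PsiM; congr (_ * _).
pose I' g := I (Psi g).
have I'id : ideal I'.
  split=> [|g1 g2|g1 g2]; rewrite /I' ?PsiD ?PsiM; [|exact: ID|exact: IM].
  by rewrite /Psi rmorph0 horner0.
have I'Phi g : I g -> I' (Phi g) by rewrite /I' PhiK.
(* The polynomial f of I, made monic along the lines of direction c. *)
pose u := (top_form f).@[c].
pose P := (u^-1%:MP)%:P * Phi f.
have Pm : P \is monic.
  have [] := has_topC (u^-1%:MP) (has_top_on_line (@mpolyC n k) y c f).
  rewrite -mpolyCM mulVf // mpolyC1 -/Phi -/P => sP P1; apply/monicP.
  suff sizeP : size P = (msize f).-1.+1 by rewrite lead_coefE sizeP.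
  apply/eqP; rewrite eqn_leq sP ltnNge.
  by apply/negP => /(nth_default 0); rewrite P1 => /eqP; rewrite oner_eq0.
have I'P : I' P by have [_ _] := I'id; apply; exact: I'Phi.
apply: contrapT => I1.
have [b Jb] : exists b, forall r, I' r%:P -> r.@[b] = 0.
  apply: contrapT => nb; apply: I1.
  have e1 : Psi 1%:P = 1 by rewrite PsiC; apply: rmorph1.
  rewrite -e1; apply: (IH (fun r => I' r%:P)).
    have [I'0 I'D I'M] := I'id.
    by split=> [//|r1 r2|r1 r2]; rewrite ?polyCD ?polyCM; [exact: I'D|exact: I'M].
  move=> b; apply: contrapT => nr; apply: nb; exists b => r I'r.
  by apply/eqP; apply: contrapT => /negP rb; apply: nr; exists r.
pose H (v : {poly k}) := exists2 g, I' g & v = map_poly (meval b) g.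
have H1 : ~ H 1.
  move=> [g Ig /esym g1].
  have [r Ir r1] := nakayama_fiber I'id Pm I'P Ig g1.
  by have /eqP := Jb r Ir; rewrite r1 oner_eq0.
have Hid : ideal H.
  have [I'0 I'D I'M] := I'id; split=> [|_ _ [g1 Ig1 ->] [g2 Ig2 ->]|v _ [g Ig ->]].
  - by exists 0; rewrite ?rmorph0.
  - by exists (g1 + g2); [exact: I'D | rewrite rmorphD].
  exists (map_poly (@mpolyC n k) v * g); first exact: I'M.
  rewrite rmorphM /= -map_poly_comp; congr (_ * _).
  by apply/esym/map_poly_id => x _ /=; rewrite mevalC.
have [z0 Hz] := proper_ideal_root Hid H1.
pose a (i : 'I_n.+1) := (if unlift ord_max i is Some j then b j else 0) + c i * z0.
have [g Ig /eqP] := noroot a; apply.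
suff <- : (map_poly (meval b) (Phi g)).[z0] = g.@[a].
  by apply/eqP; apply: Hz; exists (Phi g) => //; exact: I'Phi.
elim/mpoly_alg_ind: (g) => [r|i|p q IHp IHq|p q IHp IHq].
- by rewrite PhiC map_polyC /= hornerC !mevalC.
- rewrite PhiX rmorphD rmorphM /= !map_polyC map_polyX /= !hornerE mevalC mevalXU.
  by rewrite /a /y; case: unliftP => [j|] _; rewrite ?mevalXU ?meval0.
- by rewrite PhiD mevalD rmorphD hornerD; congr (_ + _).
- by rewrite PhiM mevalM rmorphM hornerM; congr (_ * _).
Qed.

End Nullstellensatz.

(** * Burnside's theorem *)

Section Burnside.
Import VectorInternalTheory.
Variables (k : closedFieldType) (U : vectType k).

(** W is a subspace of greatest dimension among those contained in P. *)
Lemma prop_vspace (P : U -> Prop) :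
  P 0 -> (forall c x y, P x -> P y -> P (c *: x + y)) ->
  exists W : {vspace U}, forall u, u \in W <-> P u.
Proof.
move=> P0 PL.
pose Q d := `[< exists W : {vspace U}, (forall u, u \in W -> P u) /\ \dim W = d >].
have exQ : exists d, Q d.
  exists 0%N; apply/asboolP; exists 0%VS; rewrite dimv0; split=> // u.
  by rewrite memv0 => /eqP->.
have leQ d : Q d -> (d <= \dim {:U})%N.
  by move=> /asboolP[W [_ <-]]; apply: dimvS; exact: subvf.
case: (ex_maxnP exQ leQ) => _ /asboolP[W [WP <-]] maxW.
exists W => u; split=> [|Pu]; first exact: WP.
apply: contrapT => /negP uW.
have /maxW : Q (\dim (W + <[u]>)%VS).
  apply/asboolP; exists (W + <[u]>)%VS; split=> // _ /memv_addP[w Ww [_ /vlineP[c ->]] ->].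
  by rewrite addrC; apply: PL => //; exact: WP.
have u0 : u != 0 by apply: contraNneq uW => ->; exact: mem0v.
rewrite dimv_disjoint_sum.
  by rewrite dim_vline u0 addn1 ltnn.
apply/eqP; rewrite -subv0; apply/subvP => x /memv_capP[Wx /vlineP[c ex]].
rewrite memv0 ex scaler_eq0 (negbTE u0) orbF; apply: contraNT uW => c0.
by move/(memvZ c^-1): Wx; rewrite ex scalerA mulVf // scale1r.
Qed.

Lemma lfun_eigen (f : 'End(U)) :
  (exists u : U, u <> 0) -> exists c, exists2 u, u <> 0 & f u = c *: u.
Proof.
case=> u0 /eqP u0N.
have : size (char_poly (f2mx f)) != 1%N.
  rewrite size_char_poly eqSS; apply: contraNneq u0N => d0.
  rewrite -(v2rK u0) (_ : v2r u0 = 0) ?linear0 //.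
  by apply/rowP => i; have := ltn_ord i; rewrite {2}d0.
case/closed_rootP => c; rewrite -eigenvalue_root_char => /eigenvalueP[v vc v0].
exists c, (r2v v).
  by move/(congr1 v2r); rewrite r2vK linear0; apply/eqP.
by rewrite unlock /= r2vK vc linearZ.
Qed.

Variables (I : Type) (ops : I -> 'End(U)).
Hypothesis nontrivial : exists u : U, u <> 0.
Hypothesis irreducible : forall W : {vspace U},
  (forall i w, w \in W -> ops i w \in W) -> W = 0%VS \/ W = fullv.

Lemma irreducible_prop (P : U -> Prop) :
  P 0 -> (forall c x y, P x -> P y -> P (c *: x + y)) ->
  (forall i u, P u -> P (ops i u)) ->
  (exists2 u, P u & u <> 0) -> forall u, P u.
Proof.
move=> P0 PL Pops [u Pu u0] v; have [W WP] := prop_vspace P0 PL.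
case: (@irreducible W) => [i w /WP/(Pops i)/WP //|W0|Wf]; last first.
  by apply/WP; rewrite Wf memvf.
by move/WP: Pu; rewrite W0 memv0 => /eqP/u0.
Qed.

Variable P : 'End(U) -> Prop.
Hypothesis P1 : P \1%VF.
Hypothesis PL : forall c x y, P x -> P y -> P (c *: x + y).
Hypothesis Pops : forall i r, P r -> P (ops i \o r)%VF.

Let P0 : P 0. Proof. by have := PL (-1) P1 P1; rewrite scaleN1r addNr. Qed.

(** Jacobson density, by induction on the dimension of W = W' + <w>. If all the
    elements of P killing W also kill v, then r w |-> r v, for r in P killing
    W', is a well-defined endomorphism of U that commutes with the operators.
    By Schur's lemma it is a scalar c, so v - c w is killed by whatever kills
    W', and lies in W' by induction. *)
Lemma density (W : {vspace U}) v : v \notin W ->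
  exists r, [/\ P r, forall w, w \in W -> r w = 0 & r v <> 0].
Proof.
move eW : (\dim W) => d; elim: d W eW v => [|d IH] W eW v vW.
  exists \1%VF; split=> // [w|]; rewrite id_lfunE.
    by move/eqP: eW; rewrite dimv_eq0 => /eqP->; rewrite memv0 => /eqP.
  by move=> v0; move: vW; rewrite v0 mem0v.
pose w := vpick W.
have w0 : w != 0 by rewrite vpick0 -dimv_eq0 eW.
have wW : w \in W by exact: memv_pick.
pose W' := (W :\: <[w]>)%VS.
have capW : (W :&: <[w]> = <[w]>)%VS by apply/capv_idPr; rewrite -memvE.
have eW' : \dim W' = d.
  have := dimv_cap_compl W <[w]>; rewrite capW dim_vline w0 eW.
  by move=> /eqP; rewrite add1n eqSS => /eqP.
have wW' : w \notin W'.
  apply/negP => wW'; have : w \in (W' :&: <[w]>)%VS.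
    by rewrite memv_cap wW' memv_line.
  by rewrite capv_diff memv0 (negbTE w0).
have W'W x : x \in W -> exists2 y, y \in W' & exists c, x = y + c *: w.
  rewrite -{1}(addv_diff_cap W <[w]>) capW => /memv_addP[y yW' [_ /vlineP[c ->] ->]].
  by exists y => //; exists c.
pose J r := P r /\ forall x, x \in W' -> r x = 0.
have JL c r r' : J r -> J r' -> J (c *: r + r').
  move=> [Pr r0] [Pr' r'0]; split; first exact: PL.
  by move=> x xW; rewrite add_lfunE scale_lfunE r0 // r'0 // scaler0 addr0.
have Jops i r : J r -> J (ops i \o r)%VF.
  move=> [Pr r0]; split; first exact: Pops.
  by move=> x xW; rewrite comp_lfunE r0 // linear0.
apply: contrapT => nr.
have Jv r : J r -> r w = 0 -> r v = 0.
  move=> [Pr r0] rw; apply: contrapT => rv; apply: nr; exists r; split=> // x.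
  by move=> /W'W[y yW [c ->]]; rewrite linearD linearZ /= rw r0 // scaler0 addr0.
have [r0 [Pr0 r0W r0w]] := IH W' eW' w wW'.
have Jw u : exists2 r, J r & r w = u.
  move: u; apply: irreducible_prop => [|c x y [r Jr <-] [r' Jr' <-]|i u [r Jr <-]|].
  - by exists 0; [split=> // x _; rewrite zero_lfunE|rewrite zero_lfunE].
  - by exists (c *: r + r'); [exact: JL | rewrite add_lfunE scale_lfunE].
  - by exists (ops i \o r)%VF; [exact: Jops | rewrite comp_lfunE].
  - by exists (r0 w) => //; exists r0.
pose R u := projT1 (cid2 (Jw u)).
have JR u : J (R u) by rewrite /R; case: cid2.
have Rw u : R u w = u by rewrite /R; case: cid2.
have Jeq r r' : J r -> J r' -> r w = r' w -> r v = r' v.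
  move=> Jr Jr' e; apply/eqP; rewrite -subr_eq0; apply/eqP.
  have := Jv (-1 *: r' + r) (JL _ _ _ Jr' Jr).
  by rewrite !add_lfunE !scale_lfunE !scaleN1r e addNr addrC; apply.
pose f0 u := R u v.
have f0L : linear f0.
  move=> c x y; rewrite /f0 -scale_lfunE -add_lfunE; apply: Jeq => //; first exact: JL.
  by rewrite add_lfunE scale_lfunE !Rw.
pose F := GRing.isLinear.Build k U U _ f0 f0L.
pose fL : {linear U -> U} := HB.pack f0 F.
have fE u : linfun fL u = f0 u by rewrite lfunE.
have [c [u u0 fu]] := lfun_eigen (linfun fL) nontrivial.
have fc x : f0 x = c *: x.
  move: x; apply: irreducible_prop => [|d' x y ex ey|i x ex|].
  - by rewrite -fE linear0 scaler0.
  - by rewrite f0L ex ey scalerDr !scalerA mulrC.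
  - transitivity (ops i (f0 x)); last by rewrite ex linearZ.
    transitivity ((ops i \o R x)%VF v); last by rewrite comp_lfunE.
    by apply: Jeq => //; [exact: Jops | rewrite comp_lfunE !Rw].
  - by exists u; rewrite // -fE.
have /(IH W' eW')[r [Pr rW]] : v - c *: w \notin W'.
  apply: contra vW => vW'; rewrite -(subrK (c *: w) v).
  apply: memvD; first by apply: subvP vW'; exact: diffvSl.
  exact: memvZ.
case; rewrite linearB linearZ /= -fc; apply/eqP; rewrite subr_eq0; apply/eqP.
by apply: Jeq => //; rewrite Rw.
Qed.

(** By density, P contains an operator that kills all the vectors of a basis
    but one; composing it with operators gives all the maps
    u |-> (i-th coordinate of u) x, and these span End(U). *)
Theorem burnside r : P r.
Proof.
pose b := vbasis {:U}.
have coordE u : u = \sum_i coord b i u *: b`_i by apply: coord_vbasis; exact: memvf.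
have Pcoord i x : exists2 q, P q & forall u, q u = coord b i u *: x.
  have freeb : free b by exact: basis_free (vbasisP _).
  have [W WE] : exists W : {vspace U}, forall u, u \in W <-> coord b i u = 0.
    apply: prop_vspace => [|c y z ey ez]; first exact: linear0.
    by rewrite linearP /= ey ez mulr0 addr0.
  have biW : b`_i \notin W.
    by apply/negP => /WE; rewrite coord_free // eqxx => /eqP; rewrite oner_eq0.
  have [q [Pq q0 qbi]] := density biW.
  move: x; apply: irreducible_prop => [|c x y [q1 Pq1 e1] [q2 Pq2 e2]|j x [q1 Pq1 e1]|].
  - by exists 0 => // u; rewrite zero_lfunE scaler0.
  - exists (c *: q1 + q2) => [|u]; first exact: PL.
    by rewrite add_lfunE scale_lfunE e1 e2 scalerDr !scalerA mulrC.
  - exists (ops j \o q1)%VF => [|u]; first exact: Pops.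
    by rewrite comp_lfunE e1 linearZ.
  - exists (q b`_i) => //; exists q => // u.
    rewrite {1}[u]coordE linear_sum (bigD1 i) //= big1 ?addr0 ?linearZ // => j ji.
    rewrite linearZ /= q0 ?scaler0 //; apply/WE.
    by rewrite coord_free // (negbTE ji).
have Psum (n : nat) (q : 'I_n -> 'End(U)) : (forall i, P (q i)) -> P (\sum_i q i).
  by move=> Pq; apply: big_ind => // x y Px Py; rewrite -[x]scale1r; exact: PL.
pose q i := projT1 (cid2 (Pcoord i (r b`_i))).
suff -> : r = \sum_i q i.
  by apply: Psum => i; rewrite /q; case: cid2.
apply/lfunP => u; rewrite sum_lfunE {1}[u]coordE linear_sum.
apply: eq_bigr => i _; rewrite linearZ /q /=.
by case: cid2 => /= q' _ ->.
Qed.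

End Burnside.

(** * Derivations *)

Section DerTheory.
Variables (k : fieldType) (B : comAlgType k).
Implicit Types D E : der B.

Lemma der_linear D : linear D.
Proof. by have /asboolP[h _] := der_subproof D; exact: h. Qed.
Lemma derM D x y : D (x * y) = D x * y + x * D y.
Proof. by have /asboolP[_ h] := der_subproof D; exact: h. Qed.
Lemma derD D x y : D (x + y) = D x + D y.
Proof. by have := der_linear D 1 x y; rewrite !scale1r. Qed.
Lemma der0 D : D 0 = 0.
Proof. by apply: (addrI (D 0)); rewrite -derD !addr0. Qed.
Lemma derN D x : D (- x) = - D x.
Proof. by apply/eqP; rewrite -addr_eq0 -derD addNr der0. Qed.
Lemma derB D x y : D (x - y) = D x - D y.
Proof. by rewrite derD derN. Qed.
Lemma derZ D c x : D (c *: x) = c *: D x.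
Proof. by rewrite -[c *: x]addr0 der_linear der0 addr0. Qed.
Lemma der1 D : D 1 = 0.
Proof. by apply: (addrI (D 1)); rewrite -{1}[D 1]mulr1 -{2}[D 1]mul1r -derM mulr1 addr0. Qed.
Lemma derC D c : D c%:A = 0.
Proof. by rewrite derZ der1 scaler0. Qed.
Lemma der_nat D m : D m%:R = 0.
Proof. by elim: m => [|m IH]; rewrite ?der0 // mulrS derD der1 IH addr0. Qed.
Lemma der_sum D (I : Type) (r : seq I) (P : pred I) F :
  D (\sum_(i <- r | P i) F i) = \sum_(i <- r | P i) D (F i).
Proof. exact: (big_morph D (derD D) (der0 D)). Qed.
Lemma der_ext D E : D =1 E -> D = E.
Proof. by move=> e; apply: val_inj; apply/funext. Qed.

Lemma der_addE D E x : (D + E : der B) x = D x + E x. Proof. by []. Qed.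
Lemma der_oppE D x : (- D : der B) x = - D x. Proof. by []. Qed.
Lemma der_scaleE c D x : (c *: D : der B) x = c *: D x. Proof. by []. Qed.
Lemma der_zeroE x : (0 : der B) x = 0. Proof. by []. Qed.
Lemma der_bracketE D E x : der_bracket D E x = D (E x) - E (D x).
Proof. by []. Qed.

Lemma der_mulP (f : B) D : is_der (fun x => f * D x).
Proof.
apply/asboolP; split=> [c x y|x y].
  by rewrite der_linear mulrDr scalerAr.
by rewrite derM mulrDr mulrA !(mulrCA _ x).
Qed.
Definition der_mul (f : B) D : der B := Der (der_mulP f D).
Lemma der_mulE f D x : der_mul f D x = f * D x. Proof. by []. Qed.

Variables (n : nat) (x : 'I_n -> B).
Definition polyev (f : {mpoly k[n]}) : B := mmap (in_alg B) x f.

Lemma polyevC c : polyev c%:MP = c%:A. Proof. exact: mmapC. Qed.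
Lemma polyev1 : polyev 1 = 1. Proof. by rewrite -mpolyC1 polyevC scale1r. Qed.
Lemma polyevX i : polyev 'X_i = x i. Proof. by rewrite /polyev mmapX mmap1U. Qed.
Lemma polyevD f g : polyev (f + g) = polyev f + polyev g.
Proof. exact: mmapD. Qed.
Lemma polyevM f g : polyev (f * g) = polyev f * polyev g.
Proof. by rewrite /polyev rmorphM. Qed.

(** The chain rule. *)
Lemma der_polyev D f : D (polyev f) = \sum_j polyev f^`M(j) * D (x j).
Proof.
elim/mpoly_alg_ind: f => [c|i|p q IHp IHq|p q IHp IHq].
- rewrite polyevC derC big1 // => j _.
  by rewrite mderivC /polyev mmap0 mul0r.
- rewrite polyevX (bigD1 i) //= big1 => [|j ji]; rewrite mderivX mnm1E.
    rewrite eqxx (_ : (_ - _ = 0)%MM) ?addr0.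
      by rewrite scale1r mpolyX0 polyev1 mul1r.
    by apply/mnmP => l; rewrite mnmBE subnn mnm0E.
  by rewrite eq_sym (negbTE ji) scale0r /polyev mmap0 mul0r.
- rewrite polyevD derD IHp IHq -big_split /=; apply: eq_bigr => j _.
  by rewrite mderivD polyevD mulrDl.
- rewrite polyevM derM IHp IHq mulr_suml mulr_sumr -big_split /=.
  apply: eq_bigr => j _; rewrite mderivM polyevD !polyevM mulrDl.
  by rewrite mulrA mulrAC.
Qed.

End DerTheory.

(** * Coordinate rings *)

Section CoordTheory.
Variables (k : closedFieldType) (n : nat) (X : variety k n).
Local Notation A := (coord_ring X).
Implicit Types (a b : A) (p : 'I_n -> k).

Lemma to_coordK a : to_coord X (repr a) = a.
Proof. exact: reprK. Qed.

Lemma to_coord_eq f g :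
  to_coord X f = to_coord X g <-> forall p, X p -> f.@[p] = g.@[p].
Proof.
have -> : (to_coord X f = to_coord X g) <-> vanishing X (f - g).
  by split=> [/eqP|h]; [|apply/eqP]; rewrite -(Quotient.idealrBE (vanishing_ideal X)).
split=> [/asboolP h p Xp|h]; [|apply/asboolP => p Xp].
  by apply/eqP; rewrite -subr_eq0 -mevalB h.
by rewrite mevalB h // subrr.
Qed.

Lemma evalA_to_coord p f : X p -> evalA p (to_coord X f) = f.@[p].
Proof. by move=> Xp; apply: (iffLR (to_coord_eq _ _) _ p Xp); exact: to_coordK. Qed.

Lemma evalA_inj a b : (forall p, X p -> evalA p a = evalA p b) -> a = b.
Proof. by rewrite -(to_coordK a) -(to_coordK b) => h; apply/to_coord_eq => p Xp;
  rewrite -!evalA_to_coord // h. Qed.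

Lemma to_coord_scale c f : to_coord X (c *: f) = c *: to_coord X f.
Proof. by rewrite -mul_mpolyC rmorphM. Qed.

Section Eval.
Variables (p : 'I_n -> k) (Xp : X p).
Lemma evalA0 : evalA p (0 : A) = 0.
Proof. by rewrite -(rmorph0 (to_coord X)) evalA_to_coord // meval0. Qed.
Lemma evalA1 : evalA p (1 : A) = 1.
Proof. by rewrite -(rmorph1 (to_coord X)) evalA_to_coord // meval1. Qed.
Lemma evalAD a b : evalA p (a + b) = evalA p a + evalA p b.
Proof.
by rewrite -(to_coordK a) -(to_coordK b) -rmorphD !evalA_to_coord // mevalD.
Qed.
Lemma evalAN a : evalA p (- a) = - evalA p a.
Proof. by rewrite -(to_coordK a) -rmorphN !evalA_to_coord // mevalN. Qed.
Lemma evalAB a b : evalA p (a - b) = evalA p a - evalA p b.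
Proof. by rewrite evalAD evalAN. Qed.
Lemma evalAM a b : evalA p (a * b) = evalA p a * evalA p b.
Proof.
by rewrite -(to_coordK a) -(to_coordK b) -rmorphM !evalA_to_coord // mevalM.
Qed.
Lemma evalAX a m : evalA p (a ^+ m) = evalA p a ^+ m.
Proof. by elim: m => [|m IH]; rewrite ?evalA1 // !exprS evalAM IH. Qed.
Lemma evalAZ c a : evalA p (c *: a) = c * evalA p a.
Proof. by rewrite -(to_coordK a) -to_coord_scale !evalA_to_coord // mevalZ. Qed.
End Eval.

Lemma to_coord_polyev f : to_coord X f = polyev (fun i => to_coord X 'X_i) f.
Proof.
elim/mpoly_alg_ind: f => [c|i|p q IHp IHq|p q IHp IHq].
- by rewrite polyevC -mulr_algl mulr1 -[c%:MP]mulr1 mul_mpolyC to_coord_scale rmorph1.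
- by rewrite polyevX.
- by rewrite polyevD rmorphD /= IHp IHq.
- by rewrite polyevM rmorphM /= IHp IHq.
Qed.

(** The common zeros of the inverse image of I in k[x_1, .., x_n] lie on X,
    because this inverse image contains the equations of X. *)
Lemma coord_nullstellensatz (I : A -> Prop) :
  ideal I -> (forall p, X p -> exists2 f, I f & evalA p f <> 0) -> I 1.
Proof.
move=> [I0 ID IM] noroot; rewrite -(rmorph1 (to_coord X)).
apply: (nullstellensatz (I := fun f => I (to_coord X f))).
  by split=> [|x y|x y]; rewrite ?rmorph0 ?rmorphD ?rmorphM //; [exact: ID|exact: IM].
move=> p; have [Xp|nXp] := pselect (X p).
  have [f If fp] := noroot p Xp; exists (repr f); first by rewrite to_coordK.
  by rewrite -evalA_to_coord // to_coordK; apply/eqP.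
have [S XS] := variety_closed X.
apply: contrapT => nf; apply: nXp; apply/XS => f Sf; apply/eqP.
apply: contrapT => /negP fp; apply: nf; exists f => //.
suff -> : to_coord X f = 0 by [].
rewrite -(rmorph0 (to_coord X)); apply/to_coord_eq => q /XS Xq.
by rewrite meval0 Xq.
Qed.

Section DerOfVector.
Variables (m : nat) (g : 'I_m -> {mpoly k[n]}).
Hypothesis gX : generates_ideal X g.
Variable d : 'I_n -> A.
Hypothesis dg : forall i, \sum_j to_coord X (g i)^`M(j) * d j = 0.

Let Dp (f : {mpoly k[n]}) := \sum_j to_coord X f^`M(j) * d j.

Let DpL c f f' : Dp (c *: f + f') = c *: Dp f + Dp f'.
Proof.
rewrite /Dp scaler_sumr -big_split; apply: eq_bigr => j _ /=.
by rewrite mderivD mderivZ rmorphD /= to_coord_scale mulrDl scalerAl.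
Qed.

Let DpM f f' : Dp (f * f') = Dp f * to_coord X f' + to_coord X f * Dp f'.
Proof.
rewrite /Dp mulr_suml mulr_sumr -big_split; apply: eq_bigr => j _ /=.
by rewrite mderivM rmorphD !rmorphM /= mulrDl mulrA [_ * d j]mulrAC.
Qed.

Let Dp_coord f f' : to_coord X f = to_coord X f' -> Dp f = Dp f'.
Proof.
move=> e; rewrite -[f](subrK f') -[f - f']scale1r DpL scale1r.
have /gX[q ->] : vanishing X (f - f').
  by apply/asboolP => p Xp; rewrite mevalB (iffLR (to_coord_eq _ _) e) // subrr.
suff -> : Dp (\sum_i q i * g i) = 0 by rewrite add0r.
have D0 : Dp 0 = 0 by have := DpL (-1) 0 0; rewrite scaler0 addr0 scaleN1r addNr.
have DD f1 f2 : Dp (f1 + f2) = Dp f1 + Dp f2.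
  by have := DpL 1 f1 f2; rewrite !scale1r.
rewrite (big_morph Dp DD D0) big1 // => i _; rewrite DpM [Dp (g i)]dg mulr0 addr0.
suff -> : to_coord X (g i) = 0 by rewrite mulr0.
rewrite -(rmorph0 (to_coord X)); apply/to_coord_eq => p Xp; rewrite meval0.
have /asboolP : vanishing X (g i); last exact.
apply/gX; exists (fun j => (j == i)%:R); rewrite (bigD1 i) //= eqxx mul1r.
by rewrite big1 ?addr0 // => j /negbTE->; rewrite mul0r.
Qed.

(** By the chain rule, D has to be induced by f |-> sum_j (df/dx_j) d_j. The
    hypothesis on d says that this map kills the generators g_i modulo the
    ideal of X, so it preserves that ideal. *)
Lemma der_of_vector : exists D : der A, forall j, D (to_coord X 'X_j) = d j.
Proof.
have De f : Dp (repr (to_coord X f)) = Dp f by apply: Dp_coord; rewrite to_coordK.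
have Dder : is_der (fun a : A => Dp (repr a)).
  apply/asboolP; split=> [c a b|a b];
    rewrite -{1}(to_coordK a) -{1}(to_coordK b).
    by rewrite -to_coord_scale -rmorphD De DpL.
  by rewrite -rmorphM De DpM !to_coordK.
exists (Der Dder) => j /=; rewrite De /Dp (bigD1 j) //= big1 => [|i ij].
  rewrite addr0 mderivX mnm1E eqxx (_ : (_ - _ = 0)%MM) ?scale1r ?mpolyX0 ?rmorph1 ?mul1r //.
  by apply/mnmP => l; rewrite mnmBE subnn mnm0E.
by rewrite mderivX mnm1E eq_sym (negbTE ij) scale0r rmorph0 mul0r.
Qed.

End DerOfVector.
End CoordTheory.

(** * Rings of fractions *)

Section Fractions.
Variables (k : fieldType) (A B : comAlgType k) (f : A -> B) (h : A) (hinv : B).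

(** B is the ring of fractions of A whose denominators are the powers of h.
    What follows only depends on this description of A_(h), not on its
    realization inside the function field. *)
Record fractions : Prop := Fractions {
  frac_zmod : zmod_morphism f;
  frac_monoid : monoid_morphism f;
  frac_scale : scalable f;
  frac_inj : injective f;
  frac_hinv : hinv * f h = 1;
  fracE : forall x, exists a N, x * f h ^+ N = f a }.

Hypothesis fracB : fractions.

Let fB : zmod_morphism f. Proof. by case: fracB. Qed.
Let f1 : f 1 = 1. Proof. by case: fracB => _ []. Qed.
Let fM : {morph f : a b / a * b}. Proof. by case: fracB => _ []. Qed.
Let fZ : scalable f. Proof. by case: fracB. Qed.
Let f_inj : injective f. Proof. by case: fracB. Qed.
Let hinvM : hinv * f h = 1. Proof. by case: fracB. Qed.
Let f0 : f 0 = 0. Proof. by rewrite -(subrr 0) fB subrr. Qed.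
Let fD a b : f (a + b) = f a + f b.
Proof. by rewrite -[b in LHS]opprK fB -[- b]sub0r fB f0 sub0r opprK. Qed.
Let fX a N : f (a ^+ N) = f a ^+ N.
Proof. by elim: N => [|N IH]; rewrite ?f1 // !exprS fM IH. Qed.

Lemma frac_expK N : hinv ^+ N * f h ^+ N = 1.
Proof. by rewrite -exprMn hinvM expr1n. Qed.

Lemma frac_cancel N x y : x * f h ^+ N = y * f h ^+ N -> x = y.
Proof.
move=> e; rewrite -[x]mulr1 -[y]mulr1 -(frac_expK N) ![hinv ^+ N * _]mulrC.
by rewrite !mulrA e.
Qed.

Lemma common_denom x y : exists a b N, x * f h ^+ N = f a /\ y * f h ^+ N = f b.
Proof.
have [[a [N ea]] [b [M eb]]] := (fracE fracB x, fracE fracB y).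
exists (a * h ^+ M), (b * h ^+ N), (N + M)%N.
by rewrite !fM !fX -ea -eb exprD; split; ring.
Qed.

Section Extension.
Variable D : der A.

(** The quotient rule for one fraction representing x; by [extend_funE] any
    other fraction gives the same value. *)
Definition extend_fun x : B :=
  let a := projT1 (cid (fracE fracB x)) in let N := projT1 (cid (projT2 (cid (fracE fracB x)))) in
  (f (D a) - x * f (D (h ^+ N))) * hinv ^+ N.

Lemma extend_funE x a N : x * f h ^+ N = f a ->
  extend_fun x * f h ^+ N = f (D a) - x * f (D (h ^+ N)).
Proof.
move=> ea; rewrite /extend_fun.
case: (cid _) => b /= eb'; case: (cid _) => M /= eb.
apply: (@frac_cancel M).
set u := f (D b) - _.
have -> : u * hinv ^+ M * f h ^+ N * f h ^+ M = u * f h ^+ N.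
  by rewrite mulrAC -(mulrA u) frac_expK mulr1.
have : a * h ^+ M = b * h ^+ N.
  by apply: f_inj; rewrite !fM !fX -ea -eb; ring.
move/(congr1 (fun c => f (D c))); rewrite !derM !fD !fM !fX.
rewrite -ea -eb /u => e; apply/eqP; rewrite -subr_eq0; apply/eqP.
transitivity ((f (D b) * f h ^+ N + x * f h ^+ M * f (D (h ^+ N))) -
 (f (D a) * f h ^+ M + x * f h ^+ N * f (D (h ^+ M)))); first ring.
by rewrite e subrr.
Qed.

Lemma extend_der : is_der extend_fun.
Proof.
apply/asboolP; split=> [c x y|x y]; have [a [b [N [ea eb]]]] := common_denom x y.
  apply: (@frac_cancel N); rewrite mulrDl -scalerAl (extend_funE ea) (extend_funE eb).
  rewrite (@extend_funE _ (c *: a + b)); last by rewrite mulrDl -scalerAl ea eb fD fZ.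
  rewrite derD derZ fD fZ mulrDl opprD scalerBr scalerAl.
  by rewrite addrACA.
apply: (@frac_cancel (N + N)).
rewrite (@extend_funE _ (a * b)); last by rewrite fM -ea -eb exprD; ring.
rewrite exprD derM.
transitivity ((extend_fun x * f h ^+ N) * (y * f h ^+ N) +
   (x * f h ^+ N) * (extend_fun y * f h ^+ N)); last by rewrite exprD; ring.
rewrite (extend_funE ea) (extend_funE eb) derM !fD !fM !fX.
by rewrite -ea -eb; ring.
Qed.
Definition extend : der B := Der extend_der.

Lemma extendE a : extend (f a) = f (D a).
Proof.
rewrite /extend /=; have := @extend_funE (f a) a 0; rewrite !expr0 !mulr1 => /(_ erefl) ->.
by rewrite der1 f0 mulr0 subr0.
Qed.
End Extension.

Lemma der_frac_eq (E F : der B) : (forall a, E (f a) = F (f a)) -> E = F.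
Proof.
move=> e; apply: der_ext => x; have [a [N ea]] := fracE fracB x.
apply: (@frac_cancel N); have := e a; rewrite -ea !derM -fX e.
exact: addIr.
Qed.

Lemma frac_eval_morph (ev : A -> k) (evB : B -> k) :
  (forall a b, ev (a * b) = ev a * ev b) ->
  (forall c a b, ev (c *: a + b) = c * ev a + ev b) ->
  (forall x a N, x * f h ^+ N = f a -> evB x * ev h ^+ N = ev a) ->
  ev h != 0 ->
  [/\ forall x y, evB (x * y) = evB x * evB y,
      forall c x y, evB (c *: x + y) = c * evB x + evB y &
      forall a, evB (f a) = ev a].
Proof.
move=> evM evP evE h0; split=> [x y|c x y|a]; last first.
- by have := evE (f a) a 0%N; rewrite !expr0 !mulr1; apply.
- have [a [b [N [ea eb]]]] := common_denom x y.
  have hN : ev h ^+ N != 0 by rewrite expf_neq0.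
  apply: (mulIf hN); rewrite (evE _ (c *: a + b)); last first.
    by rewrite mulrDl -scalerAl ea eb fD fZ.
  by rewrite evP -(evE _ _ _ ea) -(evE _ _ _ eb); ring.
have [a [b [N [ea eb]]]] := common_denom x y.
have hN : ev h ^+ (N + N) != 0 by rewrite expf_neq0.
apply: (mulIf hN); rewrite (evE _ (a * b)); last first.
  by rewrite fM -ea -eb exprD; ring.
by rewrite evM -(evE _ _ _ ea) -(evE _ _ _ eb) exprD; ring.
Qed.

End Fractions.

Section LocTheory.
Variables (k : closedFieldType) (n : nat) (X : variety k n) (h : coord_ring X).
Local Notation A := (coord_ring X).
Local Notation Ah := (loc h).
Hypothesis h0 : h != 0.
Implicit Types (x y : Ah) (a b : A).
Local Notation tl := (to_loc h).

Lemma to_loc_zmod : zmod_morphism tl.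
Proof. by move=> a b; apply: val_inj; rewrite /= !rmorphB. Qed.
Lemma to_loc_monoid : monoid_morphism tl.
Proof. by split=> [|a b]; apply: val_inj; rewrite /= ?rmorph1 ?rmorphM. Qed.
HB.instance Definition _ := GRing.isZmodMorphism.Build A Ah tl to_loc_zmod.
HB.instance Definition _ := GRing.isMonoidMorphism.Build A Ah tl to_loc_monoid.

Lemma to_locZ c a : tl (c *: a) = c *: tl a.
Proof. by apply: val_inj; rewrite [RHS]linearZ /= toK_scale. Qed.

Lemma to_loc_inj : injective tl.
Proof.
move=> a b /(congr1 val) /= /eqP; rewrite -subr_eq0 -rmorphB /= /toK tofrac_eq0.
by rewrite subr_eq0 => /eqP.
Qed.

Lemma is_loc_inv : is_loc h (toK h)^-1.
Proof.
apply/asboolP; exists 1, 1%N; rewrite expr1 mulVf ?rmorph1 //.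
by rewrite /toK tofrac_eq0.
Qed.
Definition hinv : Ah := Loc is_loc_inv.

Lemma loc_fracE x a N : loc_val x * toK h ^+ N = toK a <-> x * tl h ^+ N = tl a.
Proof.
split=> [e|/(congr1 (val : Ah -> _))]; last by rewrite rmorphM rmorphXn.
by apply: val_inj; rewrite rmorphM rmorphXn.
Qed.

Lemma loc_fractions : fractions tl h hinv.
Proof.
split; [exact: to_loc_zmod | exact: to_loc_monoid | exact: to_locZ
       | exact: to_loc_inj | | ].
  by apply: val_inj; rewrite rmorphM rmorph1 /= mulVf // /toK tofrac_eq0.
by move=> x; case: (loc_repr x) => -[a N] /= /loc_fracE e; exists a, N.
Qed.

Section EvalLoc.
Variables (p : 'I_n -> k) (Xp : X p) (hp : evalA p h != 0).

Lemma eval_loc_frac x a N : x * tl h ^+ N = tl a ->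
  eval_loc p x * evalA p h ^+ N = evalA p a.
Proof.
move=> ea; rewrite /eval_loc; case: cid => -[b M] /= /loc_fracE eb.
have hM : evalA p h ^+ M != 0 by rewrite expf_neq0.
apply: (mulIf hM); rewrite mulrAC divfK //.
rewrite -!evalAX // -!evalAM //; congr (evalA p _).
apply: to_loc_inj; rewrite !rmorphM !rmorphXn /= -ea -eb.
by rewrite -!mulrA; congr (_ * _); rewrite mulrC.
Qed.

Lemma eval_loc_morph :
  [/\ forall x y, eval_loc p (x * y) = eval_loc p x * eval_loc p y,
      forall c x y, eval_loc p (c *: x + y) = c * eval_loc p x + eval_loc p y &
      forall a, eval_loc p (tl a) = evalA p a].
Proof.
apply: (frac_eval_morph loc_fractions) => // [a b|c a b|]; last exact: eval_loc_frac.
  exact: evalAM.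
by rewrite evalAD // evalAZ.
Qed.

End EvalLoc.
End LocTheory.

(** * Standard charts *)

Section ChartTheory.
Variables (k : closedFieldType) (n s m : nat) (X : variety k n).
Variables (g : 'I_m -> {mpoly k[n]}) (gX : generates_ideal X g) (c : chart X g s).
Local Notation A := (coord_ring X).
Local Notation h := (minor c).
Local Notation Ah := (loc (minor c)).
Local Notation tl := (to_loc (minor c)).
Local Notation J := (jacobian X g).
Local Notation row_ := (chart_row c).
Local Notation col_ := (chart_col c).
Local Notation par_ := (chart_par c).
Local Notation M := (mxsub row_ col_ J).

Lemma minor_neq0 : h != 0.
Proof. by rewrite /minor; case: (c). Qed.

Lemma homo_ltn_inj (p q : nat) (f : 'I_p -> 'I_q) :
  {homo f : i j / (i < j)%N} -> injective f.
Proof.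
move=> fh i j e; apply: val_inj; case: (ltngtP (val i) (val j)) => //.
  by move=> lt_ij; have := fh i j lt_ij; rewrite e ltnn.
by move=> lt_ji; have := fh j i lt_ji; rewrite e ltnn.
Qed.

Lemma col_inj : injective col_. Proof. by apply: homo_ltn_inj; case: (c). Qed.
Lemma par_inj : injective par_. Proof. by apply: homo_ltn_inj; case: (c). Qed.
Lemma par_col j : (j \in codom par_) = (j \notin codom col_).
Proof. by case: (c). Qed.

Lemma sum_codom (V : zmodType) (p q : nat) (f : 'I_p -> 'I_q) (F : 'I_q -> V) :
  injective f -> \sum_(j in codom f) F j = \sum_i F (f i).
Proof.
move=> fI; transitivity (\sum_(j in f @: setT) F j).
  apply: eq_bigl => j.
  by apply/codomP/imsetP => [[i ->]|[i _ ->]]; exists i.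
rewrite big_imset => [|? ? _ _ /fI //]; apply: eq_bigl => i.
by rewrite inE.
Qed.

Lemma sum_par_col (V : zmodType) (F : 'I_n -> V) :
  \sum_j F j = \sum_i F (par_ i) + \sum_b F (col_ b).
Proof.
rewrite (bigID (fun j => j \in codom par_)) /= (sum_codom _ par_inj).
rewrite -(sum_codom _ col_inj); congr (_ + _); apply: eq_bigl => j.
by rewrite par_col negbK.
Qed.

Section Cramer.
Variable i : 'I_s.

(** The solution d of the linearized equations of X with d t_i' = h if i' = i
    and 0 otherwise. Its other coordinates are given by Cramer's rule. *)
Definition cramer (j : 'I_n) : A :=
  if [pick i' | par_ i' == j] is Some i' then (i' == i)%:R * h
  else if [pick b | col_ b == j] is Some b
  then - (\adj M *m (\col_a J (row_ a) (par_ i))) b 0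
  else 0.

Lemma cramer_par i' : cramer (par_ i') = (i' == i)%:R * h.
Proof.
rewrite /cramer; case: pickP => [i'' /eqP/par_inj-> //|/(_ i')].
by rewrite eqxx.
Qed.

Lemma cramer_col b : cramer (col_ b) = - (\adj M *m (\col_a J (row_ a) (par_ i))) b 0.
Proof.
rewrite /cramer; case: pickP => [i' /eqP e|_].
  by have := par_col (par_ i'); rewrite codom_f e codom_f.
by case: pickP => [b' /eqP/col_inj-> //|/(_ b)]; rewrite eqxx.
Qed.

Lemma cramer_row a : \sum_j J (row_ a) j * cramer j = 0.
Proof.
rewrite sum_par_col (bigD1 i) //= big1 => [|i' /negbTE i'i]; last first.
  by rewrite cramer_par i'i mul0r mulr0.
rewrite addr0 cramer_par eqxx mul1r.
under eq_bigr do rewrite cramer_col mulrN.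
rewrite sumrN; apply/eqP; rewrite subr_eq0; apply/eqP.
set v := \col_a _.
have := congr1 (fun B : 'M_(_, 1) => B a 0) (mulmxA M (\adj M) v).
rewrite mul_mx_adj mul_scalar_mx !mxE mulrC => <-.
by apply: eq_bigr => b _; rewrite !mxE.
Qed.

Local Notation tK := (@toK k n X).
(** The rows of the minor span all the rows of the Jacobian matrix over the
    function field, because the size of the minor is the rank of the matrix. *)
Lemma jacobian_rows (y : 'cV[A]_n) :
  (forall a, \sum_j J (row_ a) j * y j 0 = 0) -> J *m y = 0.
Proof.
move=> yrow; pose JK := map_mx tK J.
pose RK := rowsub row_ JK.
have RKy : RK *m map_mx tK y = 0.
  apply/matrixP => a b; rewrite [RHS]mxE (ord1 b).
  transitivity (tK (\sum_j J (row_ a) j * y j 0)); last by rewrite yrow rmorph0.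
  by rewrite mxE rmorph_sum; apply: eq_bigr => j _; rewrite rmorphM !mxE.
have MK : \rank (colsub col_ RK) = jac_rank X g.
  apply/eqP; rewrite -[_ == _]/(row_free _) row_free_unit unitmxE unitfE.
  have -> : colsub col_ RK = map_mx tK M by apply/matrixP => a b; rewrite !mxE.
  rewrite det_map_mx /toK tofrac_eq0; exact: minor_neq0.
have RKJ : (RK <= JK)%MS by exact: rowsub_sub.
have JKR : (JK <= RK)%MS.
  rewrite -(geq_leqif (mxrank_leqif_sup RKJ)).
  suff : (jac_rank X g <= \rank RK)%N by [].
  rewrite -[X in (X <= _)%N]MK -(mxrank_tr (colsub _ _)) -(mxrank_tr RK) mxrankS //.
  have -> : (colsub col_ RK)^T = rowsub col_ RK^T by apply/matrixP => a b; rewrite !mxE.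
  exact: rowsub_sub.
have : JK *m map_mx tK y = 0.
  by case/submxP: JKR => D ->; rewrite -mulmxA RKy mulmx0.
rewrite -map_mxM => /matrixP e; apply/matrixP => a b.
rewrite [RHS]mxE; have := e a b.
rewrite [map_mx _ _ _ _]mxE [X in _ = X -> _]mxE => /eqP.
by rewrite /toK tofrac_eq0 => /eqP.
Qed.

Lemma tau_exists : exists D : der A, forall j, D (param c j) = (j == i)%:R * h.
Proof.
have [|D DE] := der_of_vector gX (d := cramer); last first.
  by exists D => j; rewrite /param DE cramer_par.
move=> a; pose y : 'cV[A]_n := \col_j cramer j.
have /matrixP/(_ a 0) : J *m y = 0.
  apply: jacobian_rows => b; rewrite -[RHS](cramer_row b).
  by apply: eq_bigr => j _; rewrite [y _ _]mxE.
by rewrite !mxE => {2}<-; apply: eq_bigr => j _; rewrite !mxE.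
Qed.
End Cramer.

(** The vector field h d/dt_i on X. *)
Definition tau i : der A := projT1 (cid (tau_exists i)).
Lemma tau_param i j : tau i (param c j) = (j == i)%:R * h.
Proof. by rewrite /tau; case: cid. Qed.

Local Notation fracs := (loc_fractions minor_neq0).

Lemma to_loc_polyev f :
  tl (to_coord X f) = polyev (fun j => tl (to_coord X 'X_j)) f.
Proof.
elim/mpoly_alg_ind: f => [d|j|p q IHp IHq|p q IHp IHq].
- by rewrite to_coord_polyev !polyevC to_locZ rmorph1.
- by rewrite polyevX.
- by rewrite polyevD !rmorphD /= IHp IHq.
- by rewrite polyevM !rmorphM /= IHp IHq.
Qed.

Lemma der_to_coord (E : der Ah) f :
  E (tl (to_coord X f)) =
  \sum_j tl (to_coord X f^`M(j)) * E (tl (to_coord X 'X_j)).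
Proof.
rewrite to_loc_polyev der_polyev.
by apply: eq_bigr => j _; rewrite -(to_loc_polyev f^`M(j)).
Qed.

(** Differentiating the equations of X chosen by the chart gives a square
    linear system of determinant h for the values of E at the coordinates other
    than the t_i. *)
Lemma der_param_eq0 (E : der Ah) : (forall i, E (tl (param c i)) = 0) -> E = 0.
Proof.
move=> Epar; apply: (der_frac_eq fracs) => a; rewrite -(to_coordK a) der_to_coord der_zeroE.
pose e : 'cV[Ah]_(jac_rank X g) := \col_b E (tl (to_coord X 'X_(col_ b))).
have Me : map_mx tl M *m e = 0.
  apply/matrixP => b z; rewrite !mxE.
  have : E (tl (to_coord X (g (row_ b)))) = 0.
    suff -> : to_coord X (g (row_ b)) = 0 by rewrite rmorph0 der0.
    rewrite -(rmorph0 (to_coord X)); apply/to_coord_eq => p Xp; rewrite meval0.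
    have /asboolP : vanishing X (g (row_ b)); last exact.
    apply/gX; exists (fun j => (j == row_ b)%:R).
    rewrite (bigD1 (row_ b)) //= eqxx mul1r.
    by rewrite big1 ?addr0 // => j /negbTE->; rewrite mul0r.
  rewrite der_to_coord sum_par_col big1 ?add0r => [eb|i _]; last by rewrite Epar mulr0.
  by rewrite -[RHS]eb; apply: eq_bigr => j _; rewrite !mxE.
have e0 : tl h *: e = 0.
  have := congr1 (mulmx (\adj (map_mx tl M))) Me.
  by rewrite mulmx0 mulmxA mul_adj_mx mul_scalar_mx det_map_mx.
have ecol b : E (tl (to_coord X 'X_(col_ b))) = 0.
  apply: (@frac_cancel _ _ _ _ _ _ fracs 1).
  by have /matrixP/(_ b 0) := e0; rewrite !mxE mul0r expr1 mulrC.
rewrite sum_par_col !big1 ?addr0 // => [b _|i _].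
  by rewrite ecol mulr0.
by rewrite Epar mulr0.
Qed.

Lemma der_param_eq (E F : der Ah) :
  (forall i, E (tl (param c i)) = F (tl (param c i))) -> E = F.
Proof.
move=> e; apply/eqP; rewrite -subr_eq0; apply/eqP/der_param_eq0 => i.
by rewrite der_addE der_oppE e subrr.
Qed.

Local Notation pd := (partial c).

Lemma partial_param i j : pd i (tl (param c j)) = (j == i)%:R.
Proof.
rewrite /partial; case: pselect => [ex|[]]; first by case: cid.
exists (der_mul (hinv minor_neq0) (extend fracs (tau i))) => l.
rewrite der_mulE extendE tau_param rmorphM /= mulrCA.
by rewrite (frac_hinv fracs) mulr1 rmorph_nat.
Qed.

Lemma partialC i j x : pd i (pd j x) = pd j (pd i x).
Proof.
have := congr1 (fun E : der Ah => E x) (der_param_eq0 (E := der_bracket (pd i) (pd j)) _).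
rewrite der_bracketE der_zeroE => H; apply/eqP; rewrite -subr_eq0; apply/eqP/H => l.
by rewrite der_bracketE !partial_param !der_nat subrr.
Qed.

(** The vector field D in the coordinates of the chart. *)
Definition loc_der (D : der A) : der Ah := \sum_i der_mul (coef c D i) (pd i).

Lemma loc_derE D x : loc_der D x = \sum_i coef c D i * pd i x.
Proof.
rewrite /loc_der; elim/big_rec2: _ => [|i y E _ IH]; first by rewrite der_zeroE.
by rewrite der_addE IH.
Qed.

Lemma loc_der_to_loc D a : loc_der D (tl a) = tl (D a).
Proof.
have <- : extend fracs D = loc_der D.
  apply: der_param_eq => j; rewrite extendE loc_derE (bigD1 j) //= partial_param.
  rewrite eqxx mulr1 big1 ?addr0 // => i ij; rewrite partial_param eq_sym.
  by rewrite (negbTE ij) mulr0.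
by rewrite extendE.
Qed.

Lemma coef_bracket D E i :
  coef c (der_bracket D E) i = loc_der D (coef c E i) - loc_der E (coef c D i).
Proof. by rewrite /coef der_bracketE rmorphB /= -!loc_der_to_loc. Qed.
Lemma coefP d D E i : coef c (d *: D + E) i = d *: coef c D i + coef c E i.
Proof. by rewrite /coef der_addE der_scaleE rmorphD /= to_locZ. Qed.
Lemma coef_mul f D i : coef c (der_mul f D) i = tl f * coef c D i.
Proof. by rewrite /coef der_mulE rmorphM. Qed.
Lemma coef_tau i j : coef c (tau i) j = (j == i)%:R * tl h.
Proof. by rewrite /coef tau_param rmorphM rmorph_nat. Qed.

End ChartTheory.

(** * Differential ideals of a chart *)

Section DifferentialSimplicity.
Variables (k : closedFieldType) (n s m : nat) (X : variety k n).
Variables (g : 'I_m -> {mpoly k[n]}) (gX : generates_ideal X g) (c : chart X g s).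
Hypotheses (char0 : [pchar k] =i pred0) (dimX : has_dim X s).
Local Notation A := (coord_ring X).
Local Notation h := (minor c).
Local Notation Ah := (loc (minor c)).
Local Notation tl := (to_loc (minor c)).

Lemma to_loc_polyev_param f :
  tl (polyev (param c) f) = polyev (fun i => tl (param c i)) f.
Proof.
elim/mpoly_alg_ind: f => [d|i|p q IHp IHq|p q IHp IHq].
- by rewrite !polyevC to_locZ rmorph1.
- by rewrite !polyevX.
- by rewrite !polyevD rmorphD /= IHp IHq.
- by rewrite !polyevM rmorphM /= IHp IHq.
Qed.

Lemma partial_polyev i f :
  partial c i (tl (polyev (param c) f)) = tl (polyev (param c) f^`M(i)).
Proof.
rewrite !to_loc_polyev_param der_polyev (bigD1 i) //= (partial_param gX) eqxx mulr1.
by rewrite big1 ?addr0 // => j ji; rewrite (partial_param gX) (negbTE ji) mulr0.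
Qed.

(** The s + 1 elements t_1, .., t_s, a of the function field are algebraically
    dependent, as dim X = s. *)
Lemma param_dependent (a : A) : a != 0 ->
  exists2 f, f != 0 & exists b, polyev (param c) f = b * a.
Proof.
move=> a0; pose x (i : 'I_s.+1) : funfield X :=
  if unlift ord_max i is Some j then toK (param c j) else toK a.
have [Q Qx Q0] : exists2 Q : {mpoly k[s.+1]},
    mmap (in_alg (funfield X)) x Q = 0 & Q != 0.
  apply: contrapT => nQ; case: dimX => _ /(_ x); apply => Q Qx.
  by apply/eqP; apply: contrapT => /negP Q0; apply: nQ; exists Q.
have toK_polyev f : mmap (in_alg (funfield X)) (fun j => toK (param c j)) f =
    toK (polyev (param c) f).
  elim/mpoly_alg_ind: f => [d|i|p q IHp IHq|p q IHp IHq].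
  - by rewrite mmapC polyevC toK_scale rmorph1.
  - by rewrite mmapX mmap1U polyevX.
  - by rewrite polyevD !rmorphD /= IHp IHq.
  - by rewrite polyevM !rmorphM /= IHp IHq.
pose ev : {rmorphism {mpoly k[s]} -> A} := mmap (in_alg A) (param c).
have Qm0 : muni Q != 0 by apply: contra_neq Q0; exact: muni_eq0.
suff rootQ : (map_poly ev (muni Q)).[a] = 0.
  by have [f f0 [b fb]] := dependent_divides a0 Qm0 rootQ; exists f => //; exists b.
apply/eqP; rewrite -(tofrac_eq0) -[FracField.tofrac _]/(toK _) -horner_map -map_poly_comp.
apply/eqP; rewrite -[RHS]Qx mmap_muni {2}/x unlift_none; congr (_.[_]).
apply: eq_map_poly => f /=; rewrite -[mmap _ _ _ in LHS]/(polyev _ _) -toK_polyev.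
apply: eq_bigr => mu _; congr (_ * _); apply: mmap1_eq => i /=.
rewrite /x (_ : widen_ord _ _ = lift ord_max i) ?liftK //.
by apply/val_inj; rewrite /= /bump leqNgt ltn_ord.
Qed.

(** By [param_dependent], G contains the value of a nonzero polynomial f in the
    t_i. In characteristic 0 a nonconstant f has a nonzero partial derivative,
    which has smaller degree and also gives an element of G: descending, G
    contains a nonzero constant. *)
Lemma differentially_simple (G : Ah -> Prop) :
  ideal G -> (forall i q, G q -> G (partial c i q)) ->
  (exists2 q, G q & q <> 0) -> G 1.
Proof.
move=> [G0 GD GM] Gd [q Gq q0].
have h0 := minor_neq0 c; have fr := loc_fractions h0.
have [a [N ea]] := fracE fr q.
have a0 : a != 0.
  apply: contra_not_neq q0 => a0; apply: (@frac_cancel _ _ _ _ _ _ fr N).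
  by rewrite ea a0 rmorph0 mul0r.
have [f f0 [b fb]] := param_dependent a0.
have : G (tl (polyev (param c) f)).
  by rewrite fb rmorphM /= -ea; apply: (GM); rewrite mulrC; apply: GM.
have [d fd] : exists d, (msize f <= d)%N by exists (msize f).
elim: d f f0 fd {fb} => [|d IH] f f0 fd Gf.
  by move: fd; rewrite leqn0 msize_poly_eq0 (negbTE f0).
have [df|] := pselect (forall i, f^`M(i) = 0).
  have fE := mderiv_eq0_const char0 df.
  have c0 : f@_0 != 0 by apply: contraNneq f0 => e; rewrite fE e mpolyC0.
  move: Gf; rewrite fE polyevC to_locZ rmorph1 => /(GM ((f@_0)^-1)%:A).
  by rewrite mulr_algl scalerA mulVf // scale1r.
move=> /existsNP[i /eqP fi]; apply: (IH f^`M(i)) => //; first exact: msize_mderiv.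
by rewrite -partial_polyev; apply: Gd.
Qed.

End DifferentialSimplicity.

(** * Charts at the points of a smooth variety *)

Section ChartAtPoint.

Lemma increasing_enum (q r : nat) (S : {set 'I_q}) : #|S| = r ->
  exists2 f : 'I_r -> 'I_q, {homo f : i j / (i < j)%N} & codom f =i S.
Proof.
move=> <-; exists enum_val => [i j ij|x].
  suff lt_nth x0 : (nth x0 (enum S) i < nth x0 (enum S) j)%N.
    by rewrite (enum_val_nth (enum_default i)) (enum_val_nth (enum_default i) j).
  have tr : transitive (relpre (@nat_of_ord q) ltn) by move=> y x z; exact: ltn_trans.
  have sorted_enum : sorted (relpre (@nat_of_ord q) ltn) (enum S).
    rewrite /enum_mem; apply: sorted_filter => //.
    by rewrite -enumT -sorted_map val_enum_ord iota_ltn_sorted.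
  by apply: (sorted_ltn_nth tr _ sorted_enum) => //; rewrite inE -cardE.
apply/codomP/idP => [[i ->]|xS]; first exact: enum_valP.
by exists (enum_rank_in xS x); rewrite enum_rankK_in.
Qed.

Lemma row_minor_exists (F : fieldType) p q r (B : 'M[F]_(p, q)) : \rank B = r ->
  exists2 f : 'I_r -> 'I_p, {homo f : i j / (i < j)%N} & \rank (rowsub f B) = r.
Proof.
move=> rB; pose S := [set maxrankfun B i | i : 'I_(\rank B)].
have [f fh fS] : exists2 f : 'I_r -> 'I_p, {homo f : i j / (i < j)%N} & codom f =i S.
  by apply: increasing_enum; rewrite card_imset ?card_ord //; exact: maxrankfun_inj.
exists f => //; apply/eqP; rewrite eqn_leq rank_leq_row -{1}rB.
rewrite -(eq_maxrowsub B) mxrankS //.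
apply/row_subP => i; rewrite row_rowsub.
have /codomP[j ->] : maxrankfun B i \in codom f by rewrite fS imset_f.
by rewrite -row_rowsub row_sub.
Qed.

Lemma minor_exists (F : fieldType) p q r (B : 'M[F]_(p, q)) : \rank B = r ->
  exists f : 'I_r -> 'I_p, exists g : 'I_r -> 'I_q,
    [/\ {homo f : i j / (i < j)%N}, {homo g : i j / (i < j)%N} &
        \det (mxsub f g B) != 0].
Proof.
move=> /row_minor_exists[f fh rf]; have := rf; rewrite -mxrank_tr.
move=> /row_minor_exists[g gh rg]; exists f, g; split=> //.
have -> : mxsub f g B = (rowsub g (rowsub f B)^T)^T by apply/matrixP => i j; rewrite !mxE.
by rewrite -unitfE -unitmxE -row_free_unit /row_free mxrank_tr rg.
Qed.

Lemma minor_rank (F : fieldType) p q r (B : 'M[F]_(p, q)) (f : 'I_r -> 'I_p)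
    (g : 'I_r -> 'I_q) : \det (mxsub f g B) != 0 -> (r <= \rank B)%N.
Proof.
rewrite -unitfE -unitmxE -row_free_unit => /eqP <-.
have -> : mxsub f g B = (rowsub g (rowsub f B)^T)^T by apply/matrixP => i j; rewrite !mxE.
rewrite mxrank_tr; apply: leq_trans (mxrankS (rowsub_sub _ _)) _.
by rewrite mxrank_tr mxrankS // rowsub_sub.
Qed.

Variables (k : closedFieldType) (n s m : nat) (X : variety k n).
Variables (g : 'I_m -> {mpoly k[n]}).

Lemma eval_minor p r (f : 'I_r -> 'I_m) (f' : 'I_r -> 'I_n) : X p ->
  evalA p (\det (mxsub f f' (jacobian X g))) = \det (mxsub f f' (jacobian_at g p)).
Proof.
move=> Xp; pose F := fun a : coord_ring X => evalA p a.
rewrite /determinant.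
rewrite -[evalA p _]/(F _) (big_morph F (evalAD Xp) (evalA0 Xp)).
apply: eq_bigr => sg _; rewrite /F evalAM //; congr (_ * _).
  by rewrite evalAX // evalAN // evalA1.
rewrite (big_morph (evalA p) (evalAM Xp) (evalA1 Xp)); apply: eq_bigr => i _.
by rewrite !mxE evalA_to_coord.
Qed.

(** A minor that is not zero in A is not zero at some point of X, and the rank
    at every point is n - s. *)
Lemma smooth_jac_rank p : X p -> smooth X g s -> jac_rank X g = \rank (jacobian_at g p).
Proof.
move=> Xp sm; have [_ rp] := sm p Xp.
apply/eqP; rewrite eqn_leq; apply/andP; split.
  have [f [f' [_ _ d0]]] := @minor_exists _ _ _ _ (map_mx (@toK k n X) (jacobian X g)) erefl.
  have {d0} : \det (mxsub f f' (jacobian X g)) != 0.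
    apply: contraNneq d0 => e.
    have -> : mxsub f f' (map_mx (@toK k n X) (jacobian X g)) =
       map_mx (@toK k n X) (mxsub f f' (jacobian X g)) by apply/matrixP => i j; rewrite !mxE.
    by rewrite det_map_mx e rmorph0.
  move=> d0; have [q Xq dq] : exists2 q, X q & evalA q (\det (mxsub f f' (jacobian X g))) != 0.
    apply: contrapT => nq; case/eqP: d0; apply: evalA_inj => q Xq.
    rewrite evalA0 //; apply/eqP; apply: contrapT => /negP dq; apply: nq.
    by exists q.
  have [_ rq] := sm q Xq; move: dq; rewrite eval_minor // => /minor_rank.
  by rewrite (_ : \rank (jacobian_at g q) = \rank (jacobian_at g p)) //; apply: (@addIn s); rewrite rq rp.
have [f [f' [_ _ d0]]] := @minor_exists _ _ _ _ (jacobian_at g p) erefl.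
apply: (@minor_rank _ _ _ _ _ f f').
rewrite (_ : mxsub f f' _ = map_mx (@toK k n X) (mxsub f f' (jacobian X g))); last first.
  by apply/matrixP => i j; rewrite !mxE.
rewrite det_map_mx /toK tofrac_eq0; apply: contraNneq d0 => e.
by rewrite -(eval_minor _ _ Xp) e evalA0.
Qed.

Lemma smooth_chart p : smooth X g s -> X p -> exists c : chart X g s, in_chart c p.
Proof.
move=> sm Xp; have [_ rp] := sm p Xp.
have [f [f' [fh f'h d0]]] := minor_exists (esym (smooth_jac_rank Xp sm)).
have f'I := homo_ltn_inj f'h.
have [t th tS] : exists2 t : 'I_s -> 'I_n, {homo t : i j / (i < j)%N} &
    codom t =i ~: [set j | j \in codom f'].
  apply: increasing_enum; rewrite cardsCs setCK card_ord cardsE card_codom // card_ord.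
  rewrite (smooth_jac_rank Xp sm).
  by have := congr1 (subn^~ (\rank (jacobian_at g p))) rp; rewrite /= addKn.
have dA : \det (mxsub f f' (jacobian X g)) != 0.
  by apply: contraNneq d0 => e; rewrite -(eval_minor _ _ Xp) e evalA0.
have tf' j : (j \in codom t) = (j \notin codom f') by rewrite tS !inE.
by exists (Chart fh f'h th tf' dA); split=> //; rewrite /minor /= eval_minor.
Qed.

End ChartAtPoint.

(** * Tensor products *)

Lemma to_quot_mod_linear (k : fieldType) (V : lmodType k) (R : V -> Prop) :
  klinear (to_quot_mod R).
Proof. by move=> c x y; rewrite raddfD /= to_quot_modZ. Qed.

Lemma malg_ind (k : fieldType) (K : choiceType) (P : malg K k -> Prop) :
  submodule P -> (forall q, P (mkmalgU q 1)) -> forall z, P z.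
Proof.
move=> sP PU z; rewrite [z]monalg.monalgE.
apply: (submodule_sum sP) => q _.
suff -> : mkmalgU q (monalg.mcoeff q z) = monalg.mcoeff q z *: mkmalgU q 1 by apply: (submoduleZ sP).
apply/monalg.malgP => q'; rewrite monalg.mcoeffZ !monalg.mcoeffU.
by case: (_ == _); rewrite ?mulr1n ?mulr0n ?mulr1 ?mulr0.
Qed.

Section TensorTheory.
Variables (k : fieldType) (B : Type) (M N : lmodType k).
Variables (ract : M -> B -> M) (lact : B -> N -> N).
Local Notation T := (tensor ract lact).
Local Notation pt := (ptensor ract lact).

Let rel_eq x y : tensor_rel ract lact (x - y) ->
  to_quot_mod (tensor_rel ract lact) x = to_quot_mod (tensor_rel ract lact) y.
Proof. by move=> r; apply/to_quot_modP/asboolP => P _; apply. Qed.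

Lemma ptensorPl c m m' n : pt (c *: m + m') n = c *: pt m n + pt m' n.
Proof.
rewrite /ptensor -[RHS]to_quot_mod_linear; apply: rel_eq.
exact: tensor_rel_linl.
Qed.
Lemma ptensorPr c m n n' : pt m (c *: n + n') = c *: pt m n + pt m n'.
Proof.
rewrite /ptensor -[RHS]to_quot_mod_linear; apply: rel_eq.
exact: tensor_rel_linr.
Qed.
Lemma ptensor_balanced m b n : pt (ract m b) n = pt m (lact b n).
Proof. by apply: rel_eq; exact: tensor_rel_balanced. Qed.

Lemma tensor_ind (P : T -> Prop) :
  submodule P -> (forall m n, P (pt m n)) -> forall t, P t.
Proof.
move=> sP Pp t; rewrite -(quot_modK t).
apply: (malg_ind (P := fun z => P (to_quot_mod (tensor_rel ract lact) z))) => [|[m n]].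
  split=> [|c x y Px Py]; first by rewrite raddf0; exact: submodule0.
  by rewrite to_quot_mod_linear; apply: (proj2 sP).
exact: Pp.
Qed.

Section Lift.
Variables (L : lmodType k) (phi : M -> N -> L).
Definition bilinear_balanced := [/\
  forall c m m' n, phi (c *: m + m') n = c *: phi m n + phi m' n,
  forall c m n n', phi m (c *: n + n') = c *: phi m n + phi m n' &
  forall m b n, phi (ract m b) n = phi m (lact b n)].
Hypothesis phiP : bilinear_balanced.

Lemma tensor_liftE m n : tensor_lift phi (pt m n : T) = phi m n.
Proof. by case: phiP => ? ? ?; apply: tensor_lift_pure. Qed.

Lemma tensor_lift_linear : klinear (tensor_lift phi : T -> L).
Proof.
have [linl linr bal] := phiP.
rewrite /tensor_lift; set f := malg_lift _.
have fL : klinear f by move=> c x y; exact: malg_lift_linear.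
have f_eq x y : to_quot_mod (tensor_rel ract lact) x =
    to_quot_mod (tensor_rel ract lact) y -> f x = f y.
  move=> /to_quot_modP/asboolP hs.
  have fN z : f (- z) = - f z by rewrite -[- z]scaleN1r (klinZ fL) scaleN1r.
  apply/eqP; rewrite -subr_eq0 -fN -(klinD fL); apply/eqP.
  apply: (hs (fun z => f z = 0)) => [|r].
    by split=> [|c z1 z2 e1 e2]; rewrite ?(klin0 fL) // fL e1 e2 scaler0 addr0.
  have fU m n : f (mkmalgU (m, n) 1) = phi m n by exact: malg_liftU.
  case=> *; rewrite (klinD fL) fN ?(klinD fL) ?(klinZ fL) !fU.
  - by rewrite linl subrr.
  - by rewrite linr subrr.
  - by rewrite bal subrr.
move=> c x y; rewrite -fL; apply: f_eq.
by rewrite to_quot_mod_linear !quot_modK.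
Qed.
End Lift.
End TensorTheory.

(** * Calculus on gauge modules *)

Section GaugeCalculus.
Variables (k : fieldType) (R : comAlgType k) (U : vectType k) (T : lmodType k).
Variables (I : finType) (pd : I -> der R).
Variables (gp : R -> U -> T) (gm : R -> T -> T) (dp : I -> T -> T).
Variables (ge : 'End(U) -> T -> T) (gc : 'I_(\dim {:U}) -> T -> R).
Implicit Types (f : R) (y : T) (r : 'End(U)).

(** Calculus on R (x) U, for an algebra R with derivations d_i: [gp] are the
    pure tensors, [gm], [dp] and [ge] the actions of R, of the d_i and of
    End(U), and [gc] the coordinates in a basis of U. The space T is described
    by its operators rather than as a quotient. *)
Record gauge_calculus : Prop := GaugeCalculus {
  gp_linl : forall u, klinear (gp^~ u);
  gp_linr : forall f, klinear (gp f);
  gp_ind : forall P, submodule P -> (forall f u, P (gp f u)) -> forall y, P y;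
  gm_linear : forall f, klinear (gm f);
  dp_linear : forall i, klinear (dp i);
  ge_linear : forall r, klinear (ge r);
  gc_linear : forall j, klinear (gc j);
  gmE : forall f f' u, gm f (gp f' u) = gp (f * f') u;
  dpE : forall i f u, dp i (gp f u) = gp (pd i f) u;
  geE : forall r f u, ge r (gp f u) = gp f (r u);
  gcE : forall j f u, gc j (gp f u) = coord (vbasis {:U}) j u *: f }.

Hypothesis cal : gauge_calculus.
Let gpl := gp_linl cal.
Let gpr := gp_linr cal.
Let gmL := gm_linear cal.
Let dpL := dp_linear cal.
Let geL := ge_linear cal.
Let gcL := gc_linear cal.

Lemma gp_linear_eq (L : lmodType k) (F F' : T -> L) :
  klinear F -> klinear F' -> (forall f u, F (gp f u) = F' (gp f u)) -> F =1 F'.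
Proof.
move=> FL FL' e; apply: (gp_ind cal) => //; split=> [|a x y ex ey].
  by rewrite !klin0.
by rewrite FL FL' ex ey.
Qed.

Lemma gmM f f' y : gm f (gm f' y) = gm (f * f') y.
Proof.
move: y; apply: gp_linear_eq => [||f'' u]; [exact: klin_comp|exact: gmL|].
by rewrite !(gmE cal) mulrA.
Qed.
Lemma gm1 y : gm 1 y = y.
Proof.
move: y; apply: gp_linear_eq => [||f'' u]; [exact: gmL|by []|].
by rewrite (gmE cal) mul1r.
Qed.
Lemma gmP a f f' y : gm (a *: f + f') y = a *: gm f y + gm f' y.
Proof.
move: y; apply: (@gp_linear_eq _ _ (fun y => a *: gm f y + gm f' y)) => [||f'' u].
- exact: gmL.
- by apply: klin_add => //; apply: klin_scale.
- by rewrite !(gmE cal) mulrDl -scalerAl gpl.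
Qed.
Lemma gmD f f' y : gm (f + f') y = gm f y + gm f' y.
Proof. by have := gmP 1 f f' y; rewrite !scale1r. Qed.
Lemma gmZ a y : gm a%:A y = a *: y.
Proof.
have gm0 : gm 0 y = 0 by apply: (addrI (gm 0 y)); rewrite -gmD !addr0.
by have := gmP a 1 0 y; rewrite gm0 gm1 !addr0.
Qed.
Lemma dpM i f y : dp i (gm f y) = gm (pd i f) y + gm f (dp i y).
Proof.
move: y; apply: gp_linear_eq => [||f' u].
- exact: klin_comp.
- by apply: klin_add => //; exact: klin_comp.
- by rewrite !(gmE cal, dpE cal) derM (klinD (gpl u)).
Qed.
Lemma geM r f y : ge r (gm f y) = gm f (ge r y).
Proof.
move: y; apply: gp_linear_eq => [||f' u]; [exact: klin_comp|exact: klin_comp|].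
by rewrite !(gmE cal, geE cal).
Qed.
Lemma ge_comp r r' y : ge (r \o r')%VF y = ge r (ge r' y).
Proof.
move: y; apply: gp_linear_eq => [||f' u]; [exact: geL|exact: klin_comp|].
by rewrite !(geE cal) comp_lfunE.
Qed.
Lemma ge1 y : ge \1%VF y = y.
Proof.
move: y; apply: gp_linear_eq => [||f' u]; [exact: geL|by []|].
by rewrite (geE cal) id_lfunE.
Qed.
Lemma geP a r r' y : ge (a *: r + r') y = a *: ge r y + ge r' y.
Proof.
move: y; apply: (@gp_linear_eq _ _ (fun y => a *: ge r y + ge r' y)) => [||f u].
- exact: geL.
- by apply: klin_add => //; apply: klin_scale.
- by rewrite !(geE cal) add_lfunE scale_lfunE gpr.
Qed.

Local Notation b := (vbasis {:U}).
Lemma gp_coord y : y = \sum_j gp (gc j y) b`_j.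
Proof.
move: y; apply: (@gp_linear_eq _ id) => // [|f u].
  by apply: klin_bigsum => j; apply: (klin_comp (gpl _)).
rewrite {1}(coord_vbasis (memvf u)) (klin_sum (gpr f)).
by apply: eq_bigr => j _; rewrite (gcE cal) (klinZ (gpl _)) (klinZ (gpr _)).
Qed.

Lemma gp_gm f u : gp f u = gm f (gp 1 u).
Proof. by rewrite (gmE cal) mulr1. Qed.

Variable B : I -> T -> T.
Hypothesis B_add : forall i x y, B i (x + y) = B i x + B i y.
Hypothesis B_gm : forall i f y, B i (gm f y) = gm f (B i y).

Lemma B_linear i : klinear (B i).
Proof. by move=> a x y; rewrite B_add -gmZ B_gm gmZ. Qed.

(** The covariant derivative d_i + B_i. *)
Definition nabla i y := dp i y + B i y.

Lemma nablaM i f y : nabla i (gm f y) = gm (pd i f) y + gm f (nabla i y).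
Proof. by rewrite /nabla dpM B_gm (klinD (gmL f)) addrA. Qed.
Lemma nabla_linear i : klinear (nabla i).
Proof. by apply: klin_add => //; exact: B_linear. Qed.

Section Action.
Variables (v : I -> R) (E : I -> I -> 'End(U)).
(** The action of the vector field sum_i (v i) d_i on pure tensors, where E j i
    stands for the action of the matrix unit E_ji. *)
Definition gauge_formula f u := \sum_i
  (gp (v i * pd i f) u + gm (f * v i) (B i (gp 1 u))
       + \sum_j gp (f * pd j (v i)) (E j i u)).

Lemma gauge_formula_linl u : klinear (gauge_formula^~ u).
Proof.
apply: klin_bigsum => i; apply: klin_add; [apply: klin_add|].
- by move=> a x y; rewrite der_linear mulrDr -scalerAr gpl.
- by move=> a x y; rewrite mulrDl -scalerAl gmP.
- by apply: klin_bigsum => j a x y; rewrite mulrDl -scalerAl gpl.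
Qed.
Lemma gauge_formula_linr f : klinear (gauge_formula f).
Proof.
apply: klin_bigsum => i; apply: klin_add; [apply: klin_add|].
- exact: gpr.
- by move=> a x y; rewrite gpr B_linear gmL.
- by apply: klin_bigsum => j a x y; rewrite linearP gpr.
Qed.

(** Collecting the terms of the defining formula expresses the action by the
    covariant derivatives and by gl_s. *)
Lemma gauge_formulaE (F : T -> T) : klinear F ->
  (forall f u, F (gp f u) = gauge_formula f u) ->
  forall y, F y = \sum_i (gm (v i) (nabla i y) + \sum_j gm (pd j (v i)) (ge (E j i) y)).
Proof.
move=> FL FE; apply: gp_linear_eq => // [|f u].
  apply: klin_bigsum => i; apply: klin_add.
    by apply: klin_comp => //; exact: nabla_linear.
  by apply: klin_bigsum => j; apply: klin_comp.
rewrite FE; apply: eq_bigr => i _; congr (_ + _).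
  rewrite /nabla (klinD (gmL _)) (dpE cal) (gmE cal); congr (_ + _).
  by rewrite (gp_gm f u) B_gm gmM mulrC.
by apply: eq_bigr => j _; rewrite (geE cal) (gmE cal) mulrC.
Qed.
End Action.

Section ActionMul.
Variables (v : I -> R) (E : I -> I -> 'End(U)).
Definition vf_action y :=
  \sum_i (gm (v i) (nabla i y) + \sum_j gm (pd j (v i)) (ge (E j i) y)).
End ActionMul.

Lemma vf_action_mul f v E y :
  vf_action (fun i => f * v i) E y - gm f (vf_action v E y) =
  \sum_i \sum_j gm (pd j f * v i) (ge (E j i) y).
Proof.
rewrite /vf_action (klin_sum (gmL f)) -sumrB; apply: eq_bigr => i _.
rewrite (klinD (gmL f)) (klin_sum (gmL f)) gmM opprD addrACA subrr add0r -sumrB.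
by apply: eq_bigr => j _; rewrite derM gmD gmM addrK.
Qed.

Lemma gm0 y : gm 0 y = 0.
Proof. by apply: (addrI (gm 0 y)); rewrite -gmD !addr0. Qed.

Lemma vf_action_single f i0 E y :
  vf_action (fun i => (i == i0)%:R * f) E y =
  gm f (nabla i0 y) + \sum_j gm (pd j f) (ge (E j i0) y).
Proof.
rewrite /vf_action (bigD1 i0) //= eqxx mul1r [X in _ + X]big1 ?addr0 // => i /negbTE->.
by rewrite mul0r gm0 add0r big1 // => j _; rewrite der0 gm0.
Qed.

(** For f = t_j and h d_i, the difference is h times the action of E_ji. This is
    how submodules over functions and vector fields are stable under gl_s. *)
Lemma vf_action_param f v i0 j0 E y : (forall l, pd l f = (j0 == l)%:R) ->
  vf_action (fun i => f * ((i == i0)%:R * v)) E y -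
    gm f (vf_action (fun i => (i == i0)%:R * v) E y) = gm v (ge (E j0 i0) y).
Proof.
move=> df; rewrite vf_action_mul (bigD1 i0) //= [X in _ + X]big1 ?addr0.
  rewrite (bigD1 j0) //= [X in _ + X]big1 ?addr0 => [|j /negbTE jj0].
    by rewrite df !eqxx !mul1r.
  by rewrite df eq_sym jj0 mul0r gm0.
move=> i /negbTE->; apply: big1 => j _.
by rewrite mul0r mulr0 gm0.
Qed.

Variables (A : comAlgType k) (tl : A -> R) (h : A) (hinv : R).
Hypothesis fr : fractions tl h hinv.
Local Notation ht := (tl h).
Variable E : I -> I -> 'End(U).
Variable N : T -> Prop.
Hypothesis sN : submodule N.
Hypothesis N_gm : forall a y, N y -> N (gm (tl a) y).
Hypothesis N_nabla : forall i y, N y ->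
  N (gm ht (nabla i y) + \sum_j gm (pd j ht) (ge (E j i) y)).
Hypothesis N_ge : forall i j y, N y -> N (gm ht (ge (E j i) y)).

Let tlX a K : tl (a ^+ K) = tl a ^+ K.
Proof.
have [tl1 tlM] := frac_monoid fr.
by elim: K => [|K IH]; rewrite ?tl1 // !exprS tlM IH.
Qed.

(** The submodule N[1/h] over the ring of fractions. *)
Definition localized y := exists K, N (gm (tl (h ^+ K)) y).

Lemma localized_of y : N y -> localized y.
Proof. by move=> Ny; exists 0%N; apply: N_gm. Qed.

Lemma localized_submodule : submodule localized.
Proof.
split=> [|a x y [K NK] [L NL]].
  by apply: localized_of; exact: submodule0.
exists (K + L)%N; rewrite gmL; apply: (proj2 sN).
  rewrite addnC tlX exprD -gmM -!tlX; exact: N_gm.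
by rewrite tlX exprD -gmM -!tlX; exact: N_gm.
Qed.

Lemma localized_gm f y : localized y -> localized (gm f y).
Proof.
move=> [K NK]; have [a [L ea]] := fracE fr f.
exists (K + L)%N; rewrite gmM tlX exprD -mulrA [_ * f]mulrC ea mulrC -gmM -tlX.
exact: N_gm.
Qed.

Lemma localized_ht y : localized (gm ht y) -> localized y.
Proof.
by move=> /(localized_gm hinv); rewrite gmM (frac_hinv fr) gm1.
Qed.

Lemma localized_htX K y : localized (gm (tl (h ^+ K)) y) -> localized y.
Proof.
elim: K y => [|K IH] y; first by rewrite tlX expr0 gm1.
by rewrite tlX exprSr -gmM -tlX => /IH; exact: localized_ht.
Qed.

Lemma localized_ge i j y : localized y -> localized (ge (E j i) y).
Proof.
move=> [K NK]; apply: (@localized_htX K); rewrite -geM; apply: localized_ht.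
by apply: localized_of; exact: N_ge.
Qed.

(** The action of h d_i, of which gl_s-terms can be removed by [localized_ge],
    shows that h times the derivative of h^K y belongs to N[1/h]; Leibniz' rule
    then removes h^K. *)
Lemma localized_nabla i y : localized y -> localized (nabla i y).
Proof.
have sL := localized_submodule.
move=> Ly; have [K NK] := Ly; apply: (@localized_htX K).
have -> : gm (tl (h ^+ K)) (nabla i y) =
    nabla i (gm (tl (h ^+ K)) y) - gm (pd i (tl (h ^+ K))) y.
  by rewrite nablaM addrAC subrr add0r.
apply: (submoduleB sL); last exact: localized_gm.
apply: localized_ht.
set z := gm _ y.
rewrite -[gm ht _](addrK (\sum_j gm (pd j ht) (ge (E j i) z))).
apply: (submoduleB sL); first by apply: localized_of; exact: N_nabla.
apply: (submodule_sum sL) => j _; apply: localized_gm; apply: localized_ge.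
exact: localized_of.
Qed.

Hypothesis burnside_E : forall P : 'End(U) -> Prop, P \1%VF ->
  (forall a r r', P r -> P r' -> P (a *: r + r')) ->
  (forall i j r, P r -> P (E j i \o r)%VF) -> forall r, P r.
Hypothesis simpleR : forall G : R -> Prop,
  ideal G -> (forall i q, G q -> G (pd i q)) -> (exists2 q, G q & q <> 0) -> G 1.
Hypothesis N_neq0 : exists2 y, N y & y <> 0.

(** Since N[1/h] is stable under End(U), projecting an element of N on a basis
    vector and moving it to any u shows that q (x) U lies in N[1/h] for some
    nonzero q. The ideal of all such q is stable under the d_i: apply d_i + B_i
    to q (x) u, and note that q B_i(1 (x) u) is a combination of tensors
    q (x) u'. By differential simplicity this ideal contains 1. *)
Theorem localized_full y : localized y.
Proof.
have sL := localized_submodule.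
have Lge r x : localized x -> localized (ge r x).
  move: r x; apply: burnside_E => [x|a r r' Pr Pr' x Lx|i j r Pr x Lx].
  - by rewrite ge1.
  - by rewrite geP; apply: (proj2 sL); [exact: Pr | exact: Pr'].
  - by rewrite ge_comp; apply: localized_ge; exact: Pr.
pose G q := forall u, localized (gp q u).
have Gid : ideal G.
  split=> [u|p q Gp Gq u|a q Gq u].
  - by rewrite (klin0 (gpl u)); exact: (submodule0 sL).
  - by rewrite (klinD (gpl u)); exact: (submoduleD sL).
  - by rewrite -(gmE cal); exact: localized_gm.
have [G0 GD GM] := Gid.
have Gnabla i q : G q -> G (pd i q).
  move=> Gq u; have -> : gp (pd i q) u = nabla i (gp q u) - gm q (B i (gp 1 u)).
    by rewrite /nabla (dpE cal) (gp_gm q u) B_gm addrK.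
  apply: (submoduleB sL); first exact: localized_nabla.
  rewrite [B i _]gp_coord (klin_sum (gmL q)); apply: (submodule_sum sL) => j _.
  by rewrite (gmE cal) mulrC -(gmE cal); apply: localized_gm.
have G1 : G 1.
  apply: simpleR => //; have [x Nx x0] := N_neq0.
  have [j xj] : exists j, gc j x <> 0.
    apply: contrapT => nj; apply: x0; rewrite [x]gp_coord big1 // => j _.
    suff -> : gc j x = 0 by rewrite (klin0 (gpl _)).
    by apply: contrapT => xj; apply: nj; exists j.
  exists (gc j x) => // u.
  pose F v := coord b j v *: u.
  have FL : linear F by move=> a v w; rewrite /F linearP /= scalerDl scalerA.
  pose FisL := GRing.isLinear.Build k U U _ F FL.
  pose fL : {linear U -> U} := HB.pack F FisL.
  have [r rE] : exists r : 'End(U), forall v, r v = coord b j v *: u.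
    by exists (linfun fL) => v; rewrite lfunE.
  have freeb : free b by exact: basis_free (vbasisP _).
  have := Lge r _ (localized_of Nx).
  rewrite {1}[x]gp_coord (klin_sum (geL _)) (bigD1 j) //= big1 ?addr0 => [|l lj].
    by rewrite (geE cal) rE coord_free // eqxx scale1r.
  by rewrite (geE cal) rE coord_free // (negbTE lj) scale0r (klin0 (gpr _)).
rewrite [y]gp_coord; apply: (submodule_sum sL) => j _.
by rewrite gp_gm; apply: localized_gm.
Qed.

End GaugeCalculus.

(** * Simplicity of gauge modules *)

Section GlTheory.
Variables (k : fieldType) (s : nat) (U : vectType k) (rho : 'M[k]_s -> 'End(U)).
Hypothesis rhoM : gl_module rho.

Lemma rho_klinear u : klinear (fun a => rho a u).
Proof. by move=> c a b; case: rhoM. Qed.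

Lemma rho_delta a u :
  rho a u = \sum_(j < s) \sum_(i < s) a j i *: rho (delta_mx j i) u.
Proof.
rewrite {1}[a]matrix_sum_delta (klin_sum (rho_klinear u)); apply: eq_bigr => j _.
rewrite (klin_sum (rho_klinear u)); apply: eq_bigr => i _.
by rewrite (klinZ (rho_klinear u)).
Qed.

End GlTheory.

Lemma gl_burnside (k : closedFieldType) (s : nat) (U : vectType k)
    (rho : 'M[k]_s -> 'End(U)) : gl_simple rho ->
  forall P : 'End(U) -> Prop, P \1%VF ->
  (forall a r r', P r -> P r' -> P (a *: r + r')) ->
  (forall i j r, P r -> P (rho (delta_mx j i) \o r)%VF) -> forall r, P r.
Proof.
move=> [rhoM U0 irr] P P1 PL Pops.
apply: (burnside (I := ('I_s * 'I_s)%type) (ops := fun ij => rho (delta_mx ij.2 ij.1))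
   U0) => // [W stW|[i j] r Pr]; last exact: Pops.
apply: irr => a w wW; rewrite (rho_delta rhoM).
apply: memv_suml => j _; apply: memv_suml => i _; apply: memvZ.
exact: (stW (i, j)).
Qed.

Section GaugeTheory.
Variables (k : closedFieldType) (n s m : nat) (X : variety k n).
Variables (g : 'I_m -> {mpoly k[n]}) (gX : generates_ideal X g) (c : chart X g s).
Variables (U : vectType k).
Local Notation A := (coord_ring X).
Local Notation h := (minor c).
Local Notation Ah := (loc (minor c)).
Local Notation tl := (to_loc (minor c)).
Local Notation pd := (partial c).
Local Notation GS := (gauge_space c U).
Local Notation gp := (@gpure k n X m g s c U).

Lemma gpure_linl u : klinear (gp^~ u).
Proof. by move=> a f f'; exact: ptensorPl. Qed.
Lemma gpure_linr f : klinear (gp f).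
Proof. by move=> a u u'; exact: ptensorPr. Qed.

Section Lift.
Variables (L : lmodType k) (phi : Ah -> U -> L).
Hypothesis phil : forall u, klinear (phi^~ u).
Hypothesis phir : forall f, klinear (phi f).
Lemma gauge_bilinear : bilinear_balanced
  (fun (f : Ah) (a : k) => a *: f) (fun (a : k) (u : U) => a *: u) phi.
Proof.
split=> [a f f' u|a f u u'|f a u]; rewrite ?phil ?phir //.
by rewrite (klinZ (phil u)) (klinZ (phir f)).
Qed.
Lemma gauge_lift_spec :
  klinear (tensor_lift phi : GS -> L) /\
  forall f u, tensor_lift phi (gp f u : GS) = phi f u.
Proof.
split; first exact: (tensor_lift_linear gauge_bilinear).
exact: (tensor_liftE gauge_bilinear).
Qed.
End Lift.

Definition gend (r : 'End(U)) : GS -> GS := glift (fun f u => gp f (r u)).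
Definition gcoord j : GS -> Ah :=
  tensor_lift (fun (f : Ah) u => coord (vbasis {:U}) j u *: f).

Lemma gmul_spec f : klinear (gmul f : GS -> GS) /\
  forall f' u, gmul f (gp f' u) = gp (f * f') u.
Proof.
apply: gauge_lift_spec => [u a x y|f']; last exact: gpure_linr.
by rewrite mulrDr -scalerAr gpure_linl.
Qed.
Lemma gpartial_spec i : klinear (gpartial i : GS -> GS) /\
  forall f u, gpartial i (gp f u) = gp (pd i f) u.
Proof.
apply: gauge_lift_spec => [u a x y|f']; last exact: gpure_linr.
by rewrite der_linear gpure_linl.
Qed.
Lemma gend_spec (r : 'End(U)) : klinear (gend r) /\
  forall f u, gend r (gp f u) = gp f (r u).
Proof.
apply: gauge_lift_spec => [u|f a x y]; first exact: gpure_linl.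
by rewrite linearP gpure_linr.
Qed.
Lemma gcoord_spec j : klinear (gcoord j) /\
  forall f u, gcoord j (gp f u) = coord (vbasis {:U}) j u *: f.
Proof.
apply: gauge_lift_spec => [u a x y|f a x y].
  by rewrite scalerDr !scalerA mulrC.
by rewrite linearP /= scalerDl scalerA.
Qed.

Lemma gauge_space_calculus :
  gauge_calculus pd gp (@gmul _ _ _ _ _ _ c U) (@gpartial _ _ _ _ _ _ c U) gend gcoord.
Proof.
split.
- exact: gpure_linl.
- exact: gpure_linr.
- exact: tensor_ind.
- by move=> f; case: (gmul_spec f).
- by move=> i; case: (gpartial_spec i).
- by move=> r; case: (gend_spec r).
- by move=> j; case: (gcoord_spec j).
- by move=> f; case: (gmul_spec f).
- by move=> i; case: (gpartial_spec i).
- by move=> r; case: (gend_spec r).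
- by move=> j; case: (gcoord_spec j).
Qed.
Local Notation cal := gauge_space_calculus.

Variables (rho : 'M[k]_s -> 'End(U)) (B : 'I_s -> GS -> GS).
Hypothesis BP : gauge_fields rho B.
Local Notation E := (fun j i => rho (delta_mx j i)).

Let B_add i x y : B i (x + y) = B i x + B i y.
Proof. by case: BP. Qed.
Let B_gm i f y : B i (gmul f y) = gmul f (B i y).
Proof. by case: BP. Qed.

Lemma gaugeV_action D y : gaugeV rho B D y =
  vf_action pd (@gmul _ _ _ _ _ _ c U) (@gpartial _ _ _ _ _ _ c U) gend B
    (coef c D) E y.
Proof.
have [L1 L2] := gauge_lift_spec (gauge_formula_linl cal B (coef c D) E)
  (gauge_formula_linr cal B_add B_gm (coef c D) E).
exact: (gauge_formulaE cal B_add B_gm L1 L2).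
Qed.

Hypotheses (char0 : [pchar k] =i pred0) (dimX : has_dim X s).
Hypothesis rho_simple : gl_simple rho.

(** Instance of [localized_full] for the chart c: stability under gl_s and under
    the covariant derivatives is obtained from the fields h d/dt_i and
    t_j h d/dt_i. *)
Lemma gauge_full (N : GS -> Prop) :
  submodule N -> (forall f y, N y -> N (gaugeA f y)) ->
  (forall D y, N y -> N (gaugeV rho B D y)) -> (exists2 y, N y & y <> 0) ->
  forall y, exists K, N (gaugeA (h ^+ K) y).
Proof.
move=> sN NA NV N0 y.
have ct i : coef c (tau gX c i) = fun j => (j == i)%:R * tl h.
  by apply/funext => j; rewrite coef_tau.
apply: (localized_full cal B_gm (loc_fractions (minor_neq0 c)) (E := E) sN).
- exact: NA.
- by move=> i x /(NV (tau gX c i)); rewrite gaugeV_action ct (vf_action_single cal).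
- move=> i j x Nx.
  have NVx := NV (tau gX c i) _ Nx.
  have := NV (der_mul (param c j) (tau gX c i)) _ Nx.
  move=> /(fun Nz => submoduleB sN Nz (NA (param c j) _ NVx)).
  rewrite !gaugeV_action.
  have -> : coef c (der_mul (param c j) (tau gX c i)) =
      fun l => tl (param c j) * ((l == i)%:R * tl h).
    by apply/funext => l; rewrite coef_mul ct.
  rewrite ct.
  have pdj l := partial_param gX c l j.
  by move: (vf_action_param cal B (tl h) i E x pdj) => <-.
- exact: gl_burnside.
- exact: differentially_simple.
- exact: N0.
Qed.

End GaugeTheory.

Section GaugeSimple.
Variables (k : closedFieldType) (n s m : nat) (X : variety k n).
Variables (g : 'I_m -> {mpoly k[n]}) (U : vectType k) (rho : 'M[k]_s -> 'End(U)).
Hypotheses (char0 : [pchar k] =i pred0) (dimX : has_dim X s).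
Hypotheses (gX : generates_ideal X g) (rho_simple : gl_simple rho).

(** For y in M, the functions sending y into a nonzero submodule N form an
    ideal, which contains a power of each standard minor by [gauge_full]. *)
Theorem gauge_module_simple (M : lmodType k) (actA : coord_ring X -> M -> M)
    (actV : der (coord_ring X) -> M -> M) :
  smooth X g s -> gauge_module g rho actA actV -> (exists x : M, x <> 0) ->
  AV_simple actA actV.
Proof.
move=> sm [AVM gauge] M0; split=> // N [sN NA NV].
have [N0|/existsNP[x /not_implyP[Nx x0]]] := pselect (forall y, N y -> y = 0).
  by left.
right=> y.
pose I f := N (actA f y).
have Iid : ideal I.
  have actAl := AV_A_linl AVM; have actAM := AV_A_mul AVM.
  have actlin : klinear (actA^~ y) by move=> a f f'; exact: actAl.
  split=> [|f f' Nf Nf'|f f' Nf]; rewrite /I.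
  - by rewrite (klin0 actlin); exact: (submodule0 sN).
  - by rewrite (klinD actlin); exact: (submoduleD sN).
  - by rewrite actAM; exact: NA.
suff : I 1 by rewrite /I (AV_A_one AVM).
apply: coord_nullstellensatz => // p Xp.
have [c [_ hp]] := smooth_chart sm Xp.
have [B [BP [_ [_ [phi [phiL phiA phiV phi_inj _]]]]]] := gauge c.
pose N' z := exists2 w, N w & z = phi w.
have phi0 : phi 0 = 0 by exact: (klin0 phiL).
have [|f z [w Nw ->]|D z [w Nw ->]||K [w Nw]] :=
  @gauge_full _ _ _ _ _ _ gX c _ _ _ BP char0 dimX rho_simple N' _ _ _ _ (phi y).
- split; first by exists 0; rewrite ?phi0 //; exact: (submodule0 sN).
  move=> a _ _ [w Nw ->] [w' Nw' ->]; exists (a *: w + w'); last by rewrite phiL.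
  exact: (proj2 sN).
- by exists (actA f w); [exact: NA | rewrite phiA].
- by exists (actV D w); [exact: NV | rewrite phiV].
- exists (phi x); first by exists x.
  by rewrite -phi0 => /phi_inj.
rewrite -phiA => /phi_inj e; exists (minor c ^+ K); first by rewrite /I e.
by rewrite evalAX //; apply/eqP; rewrite expf_neq0.
Qed.

End GaugeSimple.

(** * Smash products *)

Section WordAlgebra.
Variables (k : fieldType) (I : Type) (F : lalgType k) (u : seq I -> F).

(** The free algebra on I, described by its basis of words and by the product of
    words: an operator is then defined on it by its values on the basis. *)
Record word_algebra : Prop := WordAlgebra {
  wa_ind : forall Q : F -> Prop, submodule Q -> (forall w, Q (u w)) -> forall z, Q z;
  wa_mul : forall w w', u w * u w' = u (w ++ w');
  wa_scale : forall c w w', u w * (c *: u w') = c *: u (w ++ w');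
  wa_one : u [::] = 1 }.
Hypothesis waF : word_algebra.

Lemma word_scalerAr c (x y : F) : x * (c *: y) = c *: (x * y).
Proof.
move: x c y; apply: (wa_ind waF) => [|w].
  split=> [c y|a x x' e e' c y]; first by rewrite !mul0r scaler0.
  by rewrite !mulrDl -!scalerAl e e' scalerDr !scalerA mulrC.
move=> c y; move: y c; apply: (wa_ind waF) => [|w'].
  split=> [c|a y y' e e' c]; first by rewrite scaler0 mulr0 scaler0.
  by rewrite scalerDr !mulrDr scalerA !e e' scalerDr scalerA.
by move=> c; rewrite (wa_scale waF) (wa_mul waF).
Qed.

Lemma word_ind (Q : F -> Prop) :
  submodule Q -> Q 1 -> (forall i z, Q z -> Q (u [:: i] * z)) -> forall z, Q z.
Proof.
move=> sQ Q1 QM; apply: (wa_ind waF) => //; elim=> [|i w IH].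
  by rewrite (wa_one waF).
by rewrite -[i :: w]cat1s -(wa_mul waF); apply: QM.
Qed.

Section Action.
Variables (M : lmodType k) (act : I -> M -> M) (fact : F -> M -> M).
Hypothesis act_linear : forall i, klinear (act i).
Hypothesis factl : forall m, klinear (fact^~ m).
Hypothesis fact_word : forall w m, fact (u w) m = foldr act m w.

Lemma foldr_act_linear (w : seq I) : klinear (fun m => foldr act m w).
Proof. by move=> c x y; elim: w => //= i w ->; rewrite act_linear. Qed.

Lemma word_act_linear z : klinear (fact z).
Proof.
move: z; apply: (wa_ind waF) => [|w c x y]; last by rewrite !fact_word foldr_act_linear.
split=> [c x y|a z z' e e' c x y].
  by rewrite !(klin0 (factl _)) scaler0 addr0.
by rewrite !factl e e' !scalerDr !scalerA (mulrC c) addrACA.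
Qed.

Lemma word_actM z z' m : fact (z * z') m = fact z (fact z' m).
Proof.
move: z z' m; apply: (wa_ind waF) => [|w].
  split=> [z' m|c x y e e' z' m]; first by rewrite mul0r !(klin0 (factl _)).
  by rewrite mulrDl -scalerAl !factl e e'.
apply: (wa_ind waF) => [|w' m].
  split=> [m|c x y e e' m].
    by rewrite mulr0 !(klin0 (factl _)) (klin0 (word_act_linear _)).
  by rewrite mulrDr word_scalerAr !factl word_act_linear e e'.
by rewrite (wa_mul waF) !fact_word foldr_cat.
Qed.

Lemma word_act1 m : fact 1 m = m.
Proof. by rewrite -(wa_one waF) fact_word. Qed.
Lemma word_act_gen i m : fact (u [:: i]) m = act i m.
Proof. by rewrite fact_word. Qed.
End Action.
End WordAlgebra.

Section FreeAlgebra.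
Variables (k : fieldType) (I : choiceType).
Local Notation F := (malg (fmonom I) k).

Definition word (w : seq I) : F := mkmalgU (FMonom w) 1.

Lemma mkmalgUZ (c : k) (w : fmonom I) : mkmalgU w c = c *: mkmalgU w 1 :> F.
Proof.
apply/monalg.malgP => w'; rewrite monalg.mcoeffZ !monalg.mcoeffU.
by case: (_ == _); rewrite ?mulr1n ?mulr0n ?mulr1 ?mulr0.
Qed.

Lemma fmmul_cat (w w' : seq I) : fmmul (FMonom w) (FMonom w') = FMonom (w ++ w').
Proof. by rewrite /fmmul fmE. Qed.

Lemma malg_mulU c d (w w' : fmonom I) :
  mkmalgU w c * mkmalgU w' d = mkmalgU (fmmul w w') (c * d) :> F.
Proof. by rewrite monalg.malgM_def fgmulUU. Qed.

Lemma free_word_algebra : word_algebra word.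
Proof.
split=> [Q sQ Qw|w w'|c w w'|].
- by apply: malg_ind => // -[w]; exact: Qw.
- by rewrite /word malg_mulU fmmul_cat mulr1.
- by rewrite /word -mkmalgUZ malg_mulU fmmul_cat mul1r -mkmalgUZ.
- by rewrite /word -fmE.
Qed.

Lemma word_fmu i : mkmalgU (fmu i) 1 = word [:: i].
Proof. by rewrite /fmu fmE. Qed.

Section FreeAct.
Variables (M : lmodType k) (act : I -> M -> M).
Definition free_act (z : F) (m : M) : M :=
  malg_lift (fun w : fmonom I => foldr act m w) z.
Lemma free_act_linear m : klinear (free_act^~ m).
Proof. by move=> c x y; exact: malg_lift_linear. Qed.
Lemma free_act_word w m : free_act (word w) m = foldr act m w.
Proof. exact: malg_liftU. Qed.
End FreeAct.
End FreeAlgebra.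

(** The scalars of the smash product act by multiplication by their images, so
    it has to be checked that they commute with the right factor too. *)
Lemma quotient_bilinear (k : pzRingType) (F : lalgType k) (S : lmodType k)
    (mul : S -> S -> S) (q : F -> S) :
  (forall c (x y : F), x * (c *: y) = c *: (x * y)) -> klinear q ->
  {morph q : x y / x * y >-> mul x y} -> (forall s, exists x, s = q x) ->
  (forall s', klinear (mul^~ s')) /\ (forall s', klinear (mul s')).
Proof.
move=> FA qL qM qS; split=> s' c s1 s2;
  have [[x ->] [x1 ->] [x2 ->]] := And3 (qS s') (qS s1) (qS s2);
  rewrite -!qL -!qM -!qL.
  by rewrite mulrDl scalerAl.
by rewrite mulrDr FA.
Qed.

Section SmashTheory.
Variables (k : closedFieldType) (n : nat) (X : variety k n).
Local Notation A := (coord_ring X).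
Local Notation V := (der A).
Variable P : pred V.
Local Notation S := (smash P).
Local Notation gen := (smash_gen P).
Local Notation quo := (to_quot_alg (@smash_rel k n X P)).

Lemma quo_linear : klinear (quo : _ -> S).
Proof.
move=> c x y; rewrite raddfD /=; congr (_ + _).
transitivity (quo (c%:A * x)); first by rewrite mulr_algl.
by rewrite rmorphM.
Qed.

Lemma quoM x y : quo (x * y) = quo x * quo y.
Proof. exact: to_quot_algM. Qed.
Lemma quo1 : quo 1 = 1.
Proof. by []. Qed.
Lemma smashA_word f : smashA P f = quo (word k [:: (inl f : gen)]).
Proof. by rewrite /smashA /freeA word_fmu. Qed.
Lemma smashV_word D : smashV D = quo (word k [:: (inr D : gen)]).
Proof. by rewrite /smashV /freeV word_fmu. Qed.

Lemma smash_ind (Q : S -> Prop) :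
  submodule Q -> Q 1 -> (forall f s, Q s -> Q (smashA P f * s)) ->
  (forall D s, Q s -> Q (smashV D * s)) -> forall s, Q s.
Proof.
move=> sQ Q1 QA QV s; rewrite -(quot_algK s).
move: (repr s) => {s}; apply: (word_ind (free_word_algebra k gen)) => [||[f|D] z Qz].
- split=> [|c x y Qx Qy]; first by rewrite raddf0; exact: (submodule0 sQ).
  by rewrite quo_linear; apply: (proj2 sQ).
- exact: Q1.
- by rewrite quoM -smashA_word; apply: QA.
- by rewrite quoM -smashV_word; apply: QV.
Qed.

Lemma smash_bilinear :
  (forall s' : S, klinear (fun s : S => s * s')) /\
  (forall s' : S, klinear (fun s : S => s' * s)).
Proof.
apply: (quotient_bilinear (q := quo) (mul := fun s s' : S => s * s')).
- by move=> c x y; exact: (word_scalerAr (free_word_algebra k gen)).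
- exact: quo_linear.
- exact: quoM.
- by move=> s; exists (repr s); rewrite quot_algK.
Qed.
Lemma smash_mulrl (s' : S) : klinear (fun s : S => s * s').
Proof. by case: smash_bilinear. Qed.
Lemma smash_mulrr (s' : S) : klinear (fun s : S => s' * s).
Proof. by case: smash_bilinear. Qed.

Lemma smash_eq x y : smash_rel (x - y) -> quo x = quo y.
Proof. by move=> r; apply/to_quot_algP/asboolP => Q _; apply. Qed.

Lemma smashA_linear : klinear (smashA P).
Proof.
by move=> c f g; exact: etrans (smash_eq (smash_A_lin P c f g)) (quo_linear _ _ _).
Qed.
Lemma smashA1 : smashA P 1 = 1.
Proof. exact: (smash_eq (smash_A_one P)). Qed.
Lemma smashAM f g : smashA P (f * g) = smashA P f * smashA P g.
Proof. exact: etrans (smash_eq (smash_A_mul P f g)) (quoM _ _). Qed.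
Lemma smashV_linear c D E F : val F = c *: val D + val E ->
  smashV F = c *: smashV D + smashV E :> S.
Proof. by move=> e; exact: etrans (smash_eq (smash_V_lin e)) (quo_linear _ _ _). Qed.
Lemma quoB x y : quo (x - y) = quo x - quo y.
Proof. exact: raddfB. Qed.
Lemma smashV_bracket D E F : val F = der_bracket (val D) (val E) ->
  smashV F = smashV D * smashV E - smashV E * smashV D :> S.
Proof.
move=> e; have e1 := smash_eq (smash_V_bracket e).
have e2 := quoB (freeV D * freeV E) (freeV E * freeV D).
have e3 := quoM (freeV D) (freeV E); have e4 := quoM (freeV E) (freeV D).
exact: (etrans e1 (etrans e2 (f_equal2 (fun a b => a - b) e3 e4))).
Qed.
Lemma smash_leib D f :
  smashV D * smashA P f = smashA P (val D f) + smashA P f * smashV D.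
Proof.
have e1 := quoM (freeV D) (freeA P f); have e2 := smash_eq (smash_leibniz D f).
have e3 := klinD quo_linear (freeA P (val D f)) (freeA P f * freeV D).
have e4 := quoM (freeA P f) (freeV D).
exact: (etrans (esym e1) (etrans e2 (etrans e3 (congr1 (fun a => _ + a) e4)))).
Qed.

Section Action.
Variables (M : lmodType k) (act : gen -> M -> M).

(** The defining relations of the smash product, as conditions on the action of
    its generators. *)
Record smash_action : Prop := SmashAction {
  act_linear : forall x, klinear (act x);
  act_A_linear : forall m, klinear (fun f => act (inl f) m);
  act_A1 : forall m, act (inl 1) m = m;
  act_AM : forall f g m, act (inl (f * g)) m = act (inl f) (act (inl g) m);
  act_V_linear : forall c D E F m, val F = c *: val D + val E ->
    act (inr F) m = c *: act (inr D) m + act (inr E) m;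
  act_V_bracket : forall D E F m, val F = der_bracket (val D) (val E) ->
    act (inr F) m = act (inr D) (act (inr E) m) - act (inr E) (act (inr D) m);
  act_leibniz : forall D f m, act (inr D) (act (inl f) m) =
    act (inl (val D f)) m + act (inl f) (act (inr D) m) }.

Hypothesis actP : smash_action.
Let actL := act_linear actP.
Local Notation fact := (free_act act).
Local Notation wa := (free_word_algebra k gen).
Let factl := @free_act_linear k gen M act.
Let factw := @free_act_word k gen M act.
Let factr := word_act_linear wa actL factl factw.
Let factM := word_actM wa actL factl factw.
Let fact1 := word_act1 wa factw.
Let factg := word_act_gen factw.

(** The elements of the free algebra acting by zero form a two-sided ideal,
    which contains the relations by hypothesis: the choice of a representative
    in [smash_act] is immaterial. *)
Lemma smash_act_quo z m : smash_act act (quo z) m = fact z m.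
Proof.
have fB z1 z2 m' : fact (z1 - z2) m' = fact z1 m' - fact z2 m'.
  by rewrite (klinD (factl _)) -[- z2]scaleN1r (klinZ (factl _)) scaleN1r.
pose Q z := forall m, fact z m = 0.
have QI : ideal2 Q.
  split=> [m'|z1 z2 e1 e2 m'|z1 z2 e].
  - exact: (klin0 (factl m')).
  - by rewrite fB e1 e2 subrr.
  - by split=> m'; rewrite factM ?e ?(klin0 (factr _)).
have fA f m' : fact (freeA P f) m' = act (inl f) m' by rewrite /freeA word_fmu factg.
have fV D m' : fact (freeV D) m' = act (inr D) m' by rewrite /freeV word_fmu factg.
have fM x y a a' m' : (fact x =1 a) -> (fact y =1 a') -> fact (x * y) m' = a (a' m').
  by move=> ex ey; rewrite factM ex ey.
have Qrel r : smash_rel r -> Q r.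
  case=> [c f f'||f f'|c D E F e|D E F e|D f] m'; rewrite fB; apply/eqP;
    rewrite subr_eq0; apply/eqP.
  - by rewrite factl !fA (act_A_linear actP).
  - by rewrite fA fact1 (act_A1 actP).
  - by rewrite (fM _ _ _ _ _ (fA f) (fA f')) fA (act_AM actP).
  - by rewrite factl !fV (act_V_linear actP _ e).
  - have eDE := fM _ _ _ _ m' (fV D) (fV E); have eED := fM _ _ _ _ m' (fV E) (fV D).
    have eB := fB (freeV D * freeV E) (freeV E * freeV D) m'.
    have eBr := act_V_bracket actP m' e.
    exact: (etrans (fV F m') (etrans eBr (esym (etrans eB
      (f_equal2 (fun a b => a - b) eDE eED))))).
  - rewrite (fM _ _ _ _ _ (fV D) (fA f)) (klinD (factl _)).
    rewrite (fM _ _ _ _ _ (fA f) (fV D)) fA.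
    exact: (act_leibniz actP).
have /to_quot_algP/asboolP/(_ Q QI Qrel m) : quo (repr (quo z)) = quo z.
  by rewrite quot_algK.
by rewrite fB => /eqP; rewrite subr_eq0 => /eqP.
Qed.

Lemma smash_act_linearl m : klinear (fun s => smash_act act s m).
Proof.
move=> c x y; rewrite -(quot_algK x) -(quot_algK y) -quo_linear !smash_act_quo.
exact: factl.
Qed.
Lemma smash_act_linearr s : klinear (smash_act act s).
Proof. by rewrite -(quot_algK s) => c x y; rewrite !smash_act_quo factr. Qed.
Lemma smash_actM s s' m : smash_act act (s * s') m = smash_act act s (smash_act act s' m).
Proof.
by rewrite -(quot_algK s) -(quot_algK s') -quoM !smash_act_quo factM.
Qed.
Lemma smash_act1 m : smash_act act 1 m = m.
Proof. by rewrite -quo1 smash_act_quo fact1. Qed.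
Lemma smash_actA f m : smash_act act (smashA P f) m = act (inl f) m.
Proof. by rewrite smashA_word smash_act_quo factg. Qed.
Lemma smash_actV D m : smash_act act (smashV D) m = act (inr D) m.
Proof. by rewrite smashV_word smash_act_quo factg. Qed.
End Action.
End SmashTheory.

(** * Coinduced modules *)

Section LinearMaps.
Variables (k : fieldType) (R U : lmodType k).

Definition is_klin (f : R -> U) : bool := `[< klinear f >].

Lemma is_klin_submod : GRing.submod_closed is_klin.
Proof.
split=> [|c f f' /asboolP fL /asboolP f'L]; apply/asboolP.
  by move=> c x y; rewrite -[RHS]/(c *: 0 + 0) scaler0 addr0.
move=> d x y; have e z : (c *: f + f' : R -> U) z = c *: f z + f' z by [].
by rewrite !e fL f'L !scalerDr !scalerA (mulrC c d) addrACA.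
Qed.
HB.instance Definition _ :=
  GRing.isSubmodClosed.Build k (R -> U) is_klin is_klin_submod.

Record lmap : Type := Lmap { lmap_fun :> R -> U; lmapP : is_klin lmap_fun }.
HB.instance Definition _ := [isSub for lmap_fun].
HB.instance Definition _ := [Choice of lmap by <:].
HB.instance Definition _ := [SubChoice_isSubZmodule of lmap by <:].
HB.instance Definition _ := [SubZmodule_isSubLmodule of lmap by <:].

Lemma lmap_linear (f : lmap) : klinear f.
Proof. exact/asboolP/lmapP. Qed.
Lemma lmap_ext (f f' : lmap) : f =1 f' -> f = f'.
Proof. by move=> e; apply: val_inj; apply/funext. Qed.
Lemma lmapDZ c (f f' : lmap) x : (c *: f + f' : lmap) x = c *: f x + f' x.
Proof. by []. Qed.
Lemma lmapB (f f' : lmap) x : (f - f' : lmap) x = f x - f' x.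
Proof. by []. Qed.
Definition mk_lmap (f : R -> U) (fL : klinear f) : lmap := Lmap (asboolT fL).
Lemma mk_lmapE f (fL : klinear f) x : mk_lmap fL x = f x.
Proof. by []. Qed.
End LinearMaps.

Section Coinduced.
Variables (k : fieldType) (A R : comAlgType k) (s : nat) (U : vectType k).
Variables (tl : A -> R) (pd : 'I_s -> der R) (cf : der A -> 'I_s -> R).
Variable rho : 'M[k]_s -> 'End(U).

Definition vf (D : der A) : der R := \sum_i der_mul (cf D i) (pd i).

Record chart_calculus : Prop := ChartCalculus {
  cc_linear : forall c f f', tl (c *: f + f') = c *: tl f + tl f';
  cc_one : tl 1 = 1;
  cc_mul : {morph tl : f f' / f * f'};
  cc_vf : forall D f, vf D (tl f) = tl (D f);
  cc_pd_comm : forall i j x, pd i (pd j x) = pd j (pd i x);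
  cc_cf_linear : forall c D E i, cf (c *: D + E) i = c *: cf D i + cf E i;
  cc_cf_bracket : forall D E i,
    cf (der_bracket D E) i = vf D (cf E i) - vf E (cf D i);
  cc_vf_bracket : forall D E x,
    vf (der_bracket D E) x = vf D (vf E x) - vf E (vf D x) }.
Hypothesis cc : chart_calculus.
Hypothesis rhoM : gl_module rho.

Lemma vfE D x : vf D x = \sum_i cf D i * pd i x.
Proof.
rewrite /vf; elim/big_rec2: _ => [|i y E _ IH]; first by rewrite der_zeroE.
by rewrite der_addE IH.
Qed.

(** The image of D in gl_s(A_(h)), before evaluation at a point. *)
Definition jac (D : der A) : 'M[R]_s := \matrix_(j, i) pd j (cf D i).

(** The cocycle identity that makes the action of vector fields on a twisted
    module compatible with brackets; it rests on the commutation of the d_i. *)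
Lemma jac_bracket D E : jac (der_bracket D E) =
  map_mx (vf D) (jac E) - map_mx (vf E) (jac D) + (jac D *m jac E - jac E *m jac D).
Proof.
have pd_vf D' j x : pd j (vf D' x) = \sum_l pd j (cf D' l) * pd l x + vf D' (pd j x).
  rewrite !vfE der_sum -big_split; apply: eq_bigr => l _ /=.
  by rewrite derM (cc_pd_comm cc).
apply/matrixP => j i; rewrite !mxE (cc_cf_bracket cc) derB !pd_vf.
rewrite opprD addrACA addrC; congr (_ + (_ - _)).
  by apply: eq_bigr => l _; rewrite !mxE.
by apply: eq_bigr => l _; rewrite !mxE.
Qed.

Local Notation L := (lmap R U).
Implicit Types (phi : L) (a b : 'M[R]_s).

(** The action on linear maps R -> U of a matrix with entries in R, the unit
    E_ji acting on the values and the entry a_ji on the argument. *)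
Definition twist a phi g := \sum_j \sum_i rho (delta_mx j i) (phi (g * a j i)).

Lemma twist_linear a phi : klinear (twist a phi).
Proof.
apply: klin_bigsum => j; apply: klin_bigsum => i c x y.
by rewrite mulrDl -scalerAl lmap_linear linearP.
Qed.

Lemma coA_fun_linear f phi : klinear (fun g => phi (tl f * g)).
Proof. by move=> c x y; rewrite mulrDr -scalerAr lmap_linear. Qed.

Lemma coV_fun_linear D phi : klinear (fun g => twist (jac D) phi g - phi (vf D g)).
Proof.
move=> c x y; rewrite twist_linear der_linear lmap_linear.
by rewrite opprD addrACA -scalerBr.
Qed.

Definition coA f phi : L := mk_lmap (coA_fun_linear f phi).
(** Up to sign and to the duality of U, this is the transpose of the action of D
    on the tensor module A_(h) (x) U. *)
Definition coV D phi : L := mk_lmap (coV_fun_linear D phi).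

Lemma coAE f phi g : coA f phi g = phi (tl f * g). Proof. by []. Qed.
Lemma coVE D phi g : coV D phi g = twist (jac D) phi g - phi (vf D g).
Proof. by []. Qed.

Lemma twistD a b phi g : twist (a + b) phi g = twist a phi g + twist b phi g.
Proof.
rewrite /twist -big_split; apply: eq_bigr => j _ /=.
rewrite -big_split; apply: eq_bigr => i _ /=.
by rewrite mxE mulrDr (klinD (lmap_linear phi)) linearD.
Qed.
Lemma twistZ c a phi g : twist (map_mx ( *:%R c) a) phi g = c *: twist a phi g.
Proof.
rewrite /twist scaler_sumr; apply: eq_bigr => j _; rewrite scaler_sumr.
by apply: eq_bigr => i _; rewrite mxE -scalerAr (klinZ (lmap_linear phi)) linearZ.
Qed.
Lemma twistN a phi g : twist (- a) phi g = - twist a phi g.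
Proof.
rewrite /twist -sumrN; apply: eq_bigr => j _; rewrite -sumrN; apply: eq_bigr => i _.
by rewrite mxE mulrN -scaleN1r (klinZ (lmap_linear phi)) linearZ /= scaleN1r.
Qed.
Lemma twist_phiDZ c a phi phi' g :
  twist a (c *: phi + phi') g = c *: twist a phi g + twist a phi' g.
Proof.
rewrite /twist scaler_sumr -big_split; apply: eq_bigr => j _ /=.
rewrite scaler_sumr -big_split; apply: eq_bigr => i _.
exact: linearP.
Qed.

Definition twist_map a phi : L := mk_lmap (twist_linear a phi).

(** Expansion of both factors in matrix units. *)
Lemma twist_mulmx a b phi g :
  twist (a *m b) phi g = \sum_p \sum_q
    rho (delta_mx p.1 p.2 *m delta_mx q.1 q.2) (phi (g * (a p.1 p.2 * b q.1 q.2))).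
Proof.
have rho0 u : rho 0 u = 0 by exact: (klin0 (rho_klinear rhoM u)).
rewrite -(pair_bigA _ (fun j i => \sum_q rho (delta_mx j i *m delta_mx q.1 q.2)
  (phi (g * (a j i * b q.1 q.2))))) /=.
apply: eq_bigr => j _.
transitivity (\sum_m \sum_i rho (delta_mx j m) (phi (g * (a j i * b i m)))).
  apply: eq_bigr => m _.
  by rewrite mxE mulr_sumr (klin_sum (lmap_linear phi)) linear_sum.
rewrite exchange_big; apply: eq_bigr => i _ /=.
rewrite -(pair_bigA _ (fun l m => rho (delta_mx j i *m delta_mx l m)
  (phi (g * (a j i * b l m))))) /= [RHS](bigD1 i) //= [X in _ = _ + X]big1 ?addr0.
  by apply: eq_bigr => m _; rewrite mul_delta_mx_cond eqxx mulr1n.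
move=> l li; rewrite big1 // => m _.
by rewrite mul_delta_mx_cond eq_sym (negbTE li) mulr0n rho0.
Qed.

Lemma twist_comm a b phi g :
  twist a (twist_map b phi) g - twist b (twist_map a phi) g =
  twist (a *m b - b *m a) phi g.
Proof.
have TE a' b' : twist a' (twist_map b' phi) g = \sum_p \sum_q
    rho (delta_mx p.1 p.2) (rho (delta_mx q.1 q.2)
      (phi (g * (a' p.1 p.2 * b' q.1 q.2)))).
  rewrite /twist pair_bigA /=; apply: eq_bigr => p _.
  rewrite /twist pair_bigA linear_sum /=; apply: eq_bigr => q _.
  by rewrite mulrA.
rewrite twistD twistN !TE !twist_mulmx -[X in _ - X = _]exchange_big /=.
rewrite -[X in _ = _ - X]exchange_big /= -!sumrB; apply: eq_bigr => p _.
rewrite -!sumrB; apply: eq_bigr => q _; rewrite ![b _ _ * a _ _]mulrC.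
have [_ rho_comm] := rhoM; rewrite -rho_comm.
have rhoB x y u : rho (x - y) u = rho x u - rho y u.
  have := rho_klinear rhoM u (-1) y x; rewrite /= !scaleN1r addrC => ->.
  by rewrite addrC.
exact: rhoB.
Qed.

Lemma der_twist D b phi g :
  \sum_j \sum_i rho (delta_mx j i) (phi (vf D (g * b j i))) =
  twist b phi (vf D g) + twist (map_mx (vf D) b) phi g.
Proof.
rewrite /twist -big_split; apply: eq_bigr => j _ /=.
rewrite -big_split; apply: eq_bigr => i _ /=.
by rewrite derM (klinD (lmap_linear phi)) linearD mxE.
Qed.

Lemma coV_bracket D E phi :
  coV (der_bracket D E) phi = coV D (coV E phi) - coV E (coV D phi).
Proof.
apply: lmap_ext => g; rewrite lmapB.
have expand D' E' : coV D' (coV E' phi) g =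
    twist (jac D') (twist_map (jac E') phi) g
    - (twist (jac D') phi (vf E' g) + twist (map_mx (vf E') (jac D')) phi g)
    - twist (jac E') phi (vf D' g) + phi (vf E' (vf D' g)).
  rewrite coVE coVE opprB [X in _ + X = _]addrC addrA; congr (_ + _); congr (_ - _).
  rewrite -der_twist.
  rewrite -sumrB; apply: eq_bigr => j _; rewrite -sumrB; apply: eq_bigr => i _.
  by rewrite coVE linearB.
have eJ : twist (jac (der_bracket D E)) phi g =
    twist (map_mx (vf D) (jac E)) phi g - twist (map_mx (vf E) (jac D)) phi g +
    (twist (jac D) (twist_map (jac E) phi) g - twist (jac E) (twist_map (jac D) phi) g).
  by rewrite twist_comm -twistN -!twistD jac_bracket.
rewrite !expand coVE eJ (cc_vf_bracket cc).
have phiB x y : phi (x - y) = phi x - phi y.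
  by rewrite (klinD (lmap_linear phi)) -scaleN1r (klinZ (lmap_linear phi)) scaleN1r.
rewrite phiB opprB; apply/esym; rewrite !opprD !opprK !addrA.
rewrite [LHS](ACl (8*3*(1*6)*(5*10)*(2*9)*(4*7)))%AC /=.
by rewrite !addNr !addr0 !addrA.
Qed.

Lemma coA_linearr f : klinear (coA f).
Proof. by move=> c phi phi'; apply: lmap_ext. Qed.
Lemma coA_linearl phi : klinear (coA^~ phi).
Proof.
move=> c f f'; apply: lmap_ext => g; rewrite lmapDZ !coAE (cc_linear cc).
by rewrite mulrDl -scalerAl lmap_linear.
Qed.
Lemma coA1 phi : coA 1 phi = phi.
Proof. by apply: lmap_ext => g; rewrite coAE (cc_one cc) mul1r. Qed.
Lemma coAM f f' phi : coA (f * f') phi = coA f (coA f' phi).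
Proof. by apply: lmap_ext => g; rewrite !coAE (cc_mul cc) mulrCA mulrA. Qed.
Lemma coV_linearr D : klinear (coV D).
Proof.
move=> c phi phi'; apply: lmap_ext => g; rewrite lmapDZ !coVE twist_phiDZ lmapDZ.
by rewrite scalerBr opprD addrACA.
Qed.
Lemma coV_linearl c D E phi : coV (c *: D + E) phi = c *: coV D phi + coV E phi.
Proof.
apply: lmap_ext => g; rewrite lmapDZ !coVE.
have -> : jac (c *: D + E) = map_mx ( *:%R c) (jac D) + jac E.
  by apply/matrixP => j i; rewrite !mxE (cc_cf_linear cc) derD derZ.
have -> : vf (c *: D + E) g = c *: vf D g + vf E g.
  rewrite !vfE scaler_sumr -big_split; apply: eq_bigr => i _ /=.
  by rewrite (cc_cf_linear cc) mulrDl -scalerAl.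
by rewrite twistD twistZ (lmap_linear phi) scalerBr opprD addrACA.
Qed.
Lemma coV_leibniz D f phi : coV D (coA f phi) = coA (D f) phi + coA f (coV D phi).
Proof.
apply: lmap_ext => g; rewrite -[coA (D f) phi]scale1r lmapDZ scale1r !coAE coVE coAE coVE.
rewrite derM (cc_vf cc) (klinD (lmap_linear phi)) opprD [RHS]addrCA.
rewrite [X in _ = _ + X]addrA subrr add0r; congr (_ - _).
by apply: eq_bigr => j _; apply: eq_bigr => i _; rewrite coAE mulrA.
Qed.

End Coinduced.

Section ChartCoinduced.
Variables (k : closedFieldType) (n s m : nat) (X : variety k n).
Variables (g : 'I_m -> {mpoly k[n]}) (gX : generates_ideal X g) (c : chart X g s).

Lemma standard_chart_calculus :
  chart_calculus (to_loc (minor c)) (partial c) (coef c).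
Proof.
split.
- by move=> a f f'; rewrite rmorphD /= to_locZ.
- exact: rmorph1.
- by move=> f f'; rewrite rmorphM.
- by move=> D f; exact: (loc_der_to_loc gX).
- by move=> i j x; exact: (partialC gX).
- by move=> a D E i; exact: coefP.
- by move=> D E i; exact: (coef_bracket gX).
- move=> D E x; rewrite -der_bracketE; congr (der_fun _ x).
  apply: (der_param_eq gX) => i.
  rewrite [LHS](loc_der_to_loc gX) !der_bracketE.
  rewrite ![vf _ _ _ (to_loc _ _)](loc_der_to_loc gX) rmorphB /=.
  by congr (_ - _); rewrite [RHS](loc_der_to_loc gX).
Qed.

Variables (U : vectType k) (rho : 'M[k]_s -> 'End(U)).
Hypothesis rhoM : gl_module rho.
Local Notation cc := standard_chart_calculus.
Local Notation L := (lmap (loc (minor c)) U).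

Definition coinduced_act (x : smash_gen (fun=> true : bool)) (phi : L) : L :=
  match x with
  | inl f => coA (to_loc (minor c)) f phi
  | inr D => coV (partial c) (coef c) rho (val D) phi
  end.

Lemma coinduced_smash_action : smash_action coinduced_act.
Proof.
split.
- by case=> [f|D]; [exact: coA_linearr | exact: coV_linearr].
- by move=> phi; exact: (coA_linearl cc).
- by move=> phi; exact: (coA1 cc).
- by move=> f f' phi; exact: (coAM cc).
- by move=> a D E F phi e; rewrite /= e; exact: (coV_linearl rho cc).
- by move=> D E F phi e; rewrite /= e; exact: (coV_bracket cc rhoM).
- by move=> D f phi; exact: (coV_leibniz rho cc).
Qed.
End ChartCoinduced.

(** * Induced modules *)

Section InducedTheory.
Variables (k : closedFieldType) (n : nat) (X : variety k n).
Local Notation A := (coord_ring X).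
Local Notation V := (der A).
Variables (P : pred V) (U : lmodType k) (act : smash_gen P -> U -> U).
Hypothesis actP : smash_action act.
Local Notation S := (smash_full X).
Local Notation pt := (ptensor (fun (s : S) (b : smash P) => s * smash_incl b) (smash_act act)).
Local Notation T := (induced act).
Local Notation allV := (fun _ : V => true).
Local Notation sA := (smashA allV).
Local Notation sV D := (smashV (exist allV D isT)).

(** The smash product of A and all vector fields, with left multiplications,
    is a module over the smash product of A and the fields in P. *)
Lemma full_smash_action :
  smash_action (P := P) (fun x (s : S) => full_gen x * s).
Proof.
split.
- by move=> x; exact: smash_mulrr.
- move=> s c f f'.
  exact: etrans (congr1 (fun a => a * s) (smashA_linear allV c f f')) (smash_mulrl s c _ _).
- by move=> s; exact: etrans (congr1 (fun a => a * s) (smashA1 allV)) (mul1r s).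
- move=> f f' s.
  exact: etrans (congr1 (fun a => a * s) (smashAM allV f f')) (esym (mulrA _ _ _)).
- move=> c D E F s e.
  have e' : val (exist allV (val F) isT) =
    c *: val (exist allV (val D) isT) + val (exist allV (val E) isT) by [].
  exact: etrans (congr1 (fun a => a * s) (smashV_linear e')) (smash_mulrl s c _ _).
- move=> D E F s e.
  have e' : val (exist allV (val F) isT) =
    der_bracket (val (exist allV (val D) isT)) (val (exist allV (val E) isT)) by [].
  have e1 := congr1 (fun a => a * s) (smashV_bracket e').
  have e2 := mulrBl s (sV (val D) * sV (val E)) (sV (val E) * sV (val D)).
  have e3 := esym (mulrA (sV (val D)) (sV (val E)) s).
  have e4 := esym (mulrA (sV (val E)) (sV (val D)) s).
  exact: (etrans e1 (etrans e2 (f_equal2 (fun a b => a - b) e3 e4))).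
- move=> D f s.
  have e1 := mulrA (sV (val D)) (sA f) s.
  have e2 := congr1 (fun a => a * s) (smash_leib (exist allV (val D) isT) f).
  have e3 := mulrDl (sA (val D f)) (sA f * sV (val D)) s.
  have e4 := esym (mulrA (sA f) (sV (val D)) s).
  exact: (etrans e1 (etrans e2 (etrans e3 (congr1 (fun a => sA (val D f) * s + a) e4)))).
Qed.
Local Notation fullP := full_smash_action.

Lemma smash_incl_genA f (b : smash P) : smash_incl (smashA P f * b) = sA f * smash_incl b.
Proof. exact: etrans (smash_actM fullP _ _ _) (smash_actA fullP _ _). Qed.
Lemma smash_incl_genV (D : {D : V | P D}) b : smash_incl (smashV D * b) = sV (val D) * smash_incl b.
Proof. exact: etrans (smash_actM fullP _ _ _) (smash_actV fullP _ _). Qed.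
Lemma smash_incl1 : smash_incl (1 : smash P) = 1.
Proof. exact: (smash_act1 fullP 1). Qed.
Lemma smash_incl_linear : klinear (@smash_incl _ _ _ P).
Proof. exact: (smash_act_linearl fullP 1). Qed.
Lemma smash_inclA f : smash_incl (smashA P f) = sA f.
Proof. exact: etrans (smash_actA fullP _ _) (mulr1 _). Qed.
Lemma smash_inclV (D : {D : V | P D}) : smash_incl (smashV D) = sV (val D).
Proof. exact: etrans (smash_actV fullP _ _) (mulr1 _). Qed.

Lemma ptl u : klinear (fun s : S => pt s u : T).
Proof. by move=> c s s'; exact: ptensorPl. Qed.
Lemma ptr s : klinear (fun u => pt s u : T).
Proof. by move=> c u u'; exact: ptensorPr. Qed.
Lemma pt_bal s b u : pt (s * smash_incl b) u = pt s (smash_act act b u) :> T.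
Proof. exact: ptensor_balanced. Qed.
Lemma pt_congr (s s' : S) u : s = s' -> pt s u = pt s' u :> T.
Proof. by move=> ->. Qed.

Lemma induced_eq (L : lmodType k) (F F' : T -> L) : klinear F -> klinear F' ->
  (forall s u, F (pt s u) = F' (pt s u)) -> F =1 F'.
Proof.
move=> FL F'L e; apply: tensor_ind => [|s u]; last exact: e.
by split=> [|c x y ex ey]; rewrite ?(klin0 FL) ?(klin0 F'L) // FL F'L ex ey.
Qed.

Lemma induced_mul_spec (s : S) : klinear (induced_mul s : T -> T) /\
  forall s' u, induced_mul s (pt s' u : T) = pt (s * s') u.
Proof.
have bil : bilinear_balanced (fun (s : S) (b : smash P) => s * smash_incl b)
    (smash_act act) (fun s' u => pt (s * s') u : T).
  split=> [c s1 s2 u|c s1 u u'|s1 b u].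
  - have e1 := pt_congr u (smash_mulrr s c s1 s2).
    exact: (etrans e1 (ptl u c (s * s1) (s * s2))).
  - exact: (ptr (s * s1) c u u').
  - have e1 := pt_congr u (mulrA s s1 (smash_incl b)).
    exact: (etrans e1 (pt_bal (s * s1) b u)).
split; first exact: (tensor_lift_linear bil).
exact: (tensor_liftE bil).
Qed.

Lemma induced_mulE (s s' : S) u : induced_mul s (pt s' u : T) = pt (s * s') u.
Proof. by case: (induced_mul_spec s). Qed.
Lemma induced_mul_linear (s : S) : klinear (induced_mul s : T -> T).
Proof. by case: (induced_mul_spec s). Qed.

Lemma induced_mul_linearl (x : T) : klinear (fun s : S => induced_mul s x).
Proof.
move=> c s s'; move: x; apply: induced_eq => [||s1 u].
- exact: induced_mul_linear.
- apply: klin_add; last exact: induced_mul_linear.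
  by apply: klin_scale; exact: induced_mul_linear.
- have e1 := induced_mulE (c *: s + s') s1 u.
  have e2 := pt_congr u (smash_mulrl s1 c s s').
  have e3 := ptl u c (s * s1) (s' * s1).
  have e4 := f_equal2 (fun a b : T => c *: a + b) (induced_mulE s s1 u) (induced_mulE s' s1 u).
  exact: (etrans e1 (etrans e2 (etrans e3 (esym e4)))).
Qed.
Lemma induced_mulM (s s' : S) (x : T) : induced_mul (s * s') x = induced_mul s (induced_mul s' x).
Proof.
move: x; apply: induced_eq => [||s1 u].
- exact: induced_mul_linear.
- by apply: klin_comp; exact: induced_mul_linear.
- have e1 := induced_mulE (s * s') s1 u.
  have e2 := pt_congr u (esym (mulrA s s' s1)).
  have e3 := esym (induced_mulE s (s' * s1) u).
  have e4 := congr1 (induced_mul s) (esym (induced_mulE s' s1 u)).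
  exact: (etrans e1 (etrans e2 (etrans e3 e4))).
Qed.
Lemma induced_mul1 (x : T) : induced_mul 1 x = x.
Proof.
move: x; apply: induced_eq => [||s1 u] //; first exact: induced_mul_linear.
exact: (etrans (induced_mulE 1 s1 u) (pt_congr u (mul1r s1))).
Qed.

Lemma induced_AV_module : AV_module (inducedA (act := act)) (inducedV (act := act)).
Proof.
have lin x := induced_mul_linearl x.
split.
- move=> c f f' x.
  have e1 := congr1 (fun s => induced_mul s x) (smashA_linear allV c f f').
  exact: (etrans e1 (lin x c (sA f) (sA f'))).
- by move=> f; exact: induced_mul_linear.
- move=> x; have e1 := congr1 (fun s => induced_mul s x) (smashA1 allV).
  exact: (etrans e1 (induced_mul1 x)).
- move=> f f' x.
  have e1 := congr1 (fun s => induced_mul s x) (smashAM allV f f').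
  exact: (etrans e1 (induced_mulM (sA f) (sA f') x)).
- move=> c D E x.
  have e : val (exist allV (c *: D + E) isT) =
    c *: val (exist allV D isT) + val (exist allV E isT) by [].
  have e1 := congr1 (fun s => induced_mul s x) (smashV_linear e).
  exact: (etrans e1 (lin x c (sV D) (sV E))).
- by move=> D; exact: induced_mul_linear.
- move=> D E x.
  have e : val (exist allV (der_bracket D E) isT) =
    der_bracket (val (exist allV D isT)) (val (exist allV E isT)) by [].
  have e1 := congr1 (fun s => induced_mul s x) (smashV_bracket e).
  have e2 := klinB (lin x) (sV D * sV E) (sV E * sV D).
  have e3 := induced_mulM (sV D) (sV E) x; have e4 := induced_mulM (sV E) (sV D) x.
  exact: (etrans e1 (etrans e2 (f_equal2 (fun a b => a - b) e3 e4))).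
- move=> D f x.
  have e1 := esym (induced_mulM (sV D) (sA f) x).
  have e2 := congr1 (fun s => induced_mul s x) (smash_leib (exist allV D isT) f).
  have e3 := klinD (lin x) (sA (D f)) (sA f * sV D).
  have e4 := induced_mulM (sA f) (sV D) x.
  exact: (etrans e1 (etrans e2 (etrans e3 (congr1 (fun a => induced_mul (sA (D f)) x + a) e4)))).
Qed.

Lemma induced_one_A f u : inducedA (act := act) f (pt 1 u) = pt 1 (act (inl f) u).
Proof.
have e1 := induced_mulE (sA f) 1 u.
have e2 : sA f * 1 = 1 * smash_incl (smashA P f) :=
  etrans (mulr1 (sA f)) (etrans (esym (smash_inclA f)) (esym (mul1r (smash_incl (smashA P f))))).
have e3 := pt_bal 1 (smashA P f) u.
have e4 := congr1 (pt 1) (smash_actA actP f u).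
exact: (etrans e1 (etrans (pt_congr u e2) (etrans e3 e4))).
Qed.
Lemma induced_one_V D u :
  inducedV (act := act) (val D) (pt 1 u) = pt 1 (act (inr D) u).
Proof.
have e1 := induced_mulE (sV (val D)) 1 u.
have e2 : sV (val D) * 1 = 1 * smash_incl (smashV D) :=
  etrans (mulr1 (sV (val D))) (etrans (esym (smash_inclV D)) (esym (mul1r (smash_incl (smashV D))))).
have e3 := pt_bal 1 (smashV D) u.
have e4 := congr1 (pt 1) (smash_actV actP D u).
exact: (etrans e1 (etrans (pt_congr u e2) (etrans e3 e4))).
Qed.

Lemma induced_ind (Q : T -> Prop) : submodule Q -> (forall u, Q (pt 1 u)) ->
  (forall f x, Q x -> Q (inducedA (act := act) f x)) ->
  (forall D x, Q x -> Q (inducedV (act := act) D x)) -> forall x, Q x.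
Proof.
move=> sQ Q1 QA QV; apply: (tensor_ind sQ) => s.
move: s; apply: (smash_ind (Q := fun s => forall u, Q (pt s u))) => [||f s Qs u|D s Qs u].
- split=> [u|c s s' Qs Qs' u].
    by rewrite (klin0 (ptl u)); exact: (submodule0 sQ).
  by rewrite (ptl u); apply: (proj2 sQ).
- exact: Q1.
- have e := induced_mulE (sA f) s u.
  by rewrite -e; exact: (QA f _ (Qs u)).
- have e : pt (smashV D * s) u = inducedV (act := act) (val D) (pt s u) :> T.
    case: D => D t; rewrite (bool_irrelevance t isT).
    exact: (esym (induced_mulE (sV D) s u)).
  by rewrite e; exact: (QV (val D) _ (Qs u)).
Qed.

Section Universal.
Variables (M : lmodType k) (actM : smash_gen allV -> M -> M) (e : U -> M).
Hypothesis actMP : smash_action actM.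
Hypothesis eL : klinear e.
Hypothesis eA : forall f u, e (act (inl f) u) = actM (inl f) (e u).
Hypothesis eV : forall D u, e (act (inr D) u) = actM (inr (exist allV (val D) isT)) (e u).

Lemma universal_incl b u :
  smash_act actM (smash_incl b) (e u) = e (smash_act act b u).
Proof.
move: b u; apply: smash_ind => [|u|f b IH u|D b IH u].
- split=> [u|c b b' IH IH' u].
    rewrite (klin0 smash_incl_linear) (klin0 (smash_act_linearl actMP _)).
    by rewrite (klin0 (smash_act_linearl actP _)) (klin0 eL).
  rewrite smash_incl_linear (smash_act_linearl actMP) (smash_act_linearl actP) eL.
  exact: (f_equal2 (fun a a' => c *: a + a') (IH u) (IH' u)).
- by rewrite smash_incl1 (smash_act1 actMP) (smash_act1 actP).
- rewrite smash_incl_genA (smash_actM actMP) (smash_actA actMP) IH.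
  by rewrite (smash_actM actP) (smash_actA actP) eA.
- rewrite smash_incl_genV (smash_actM actMP) (smash_actV actMP) IH.
  by rewrite (smash_actM actP) (smash_actV actP) eV.
Qed.

(** Frobenius reciprocity. *)
Lemma induced_universal : exists F : T -> M, klinear F /\ forall u, F (pt 1 u) = e u.
Proof.
have bil : bilinear_balanced (fun (s : S) (b : smash P) => s * smash_incl b)
    (smash_act act) (fun s u => smash_act actM s (e u)).
  split=> [c s1 s2 u|c s1 u u'|s1 b u].
  - exact: (smash_act_linearl actMP).
  - by rewrite eL (smash_act_linearr actMP).
  - by rewrite (smash_actM actMP) universal_incl.
exists (tensor_lift (fun s u => smash_act actM s (e u))); split.
  exact: (tensor_lift_linear bil).
by move=> u; rewrite (tensor_liftE bil) (smash_act1 actMP).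
Qed.
End Universal.

End InducedTheory.

(** * Simplicity of Rudakov modules *)

Section DeltaModule.
Variables (k : closedFieldType) (n s : nat) (X : variety k n).
Local Notation A := (coord_ring X).
Local Notation V := (der A).
Variables (p : 'I_n -> k) (Xp : X p).
Variables (U : vectType k) (rho : 'M[k]_s -> 'End(U)).
Hypotheses (char0 : [pchar k] =i pred0) (rho_simple : gl_simple rho).
Variables (M : lmodType k) (actA : A -> M -> M) (actV : V -> M -> M).
Hypothesis AVM : AV_module actA actV.
Variable delta : U -> M.
Variables (t : 'I_s -> A) (tau : 'I_s -> V) (gl : V -> 'M[k]_s).
Local Notation ev := (evalA p).
Local Notation vanishing_at_p D := (forall f, ev (D f) = 0).

Hypothesis delta_linear : klinear delta.
Hypothesis delta_A : forall f u, actA f (delta u) = delta (ev f *: u).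
Hypothesis delta_V : forall (D : V) u, vanishing_at_p D ->
  actV D (delta u) = delta (rho (gl D) u).
Hypothesis delta_gen : forall Q : M -> Prop, submodule Q -> (forall u, Q (delta u)) ->
  (forall f x, Q x -> Q (actA f x)) -> (forall D x, Q x -> Q (actV D x)) -> forall x, Q x.
Hypothesis delta_neq0 : exists u, delta u <> 0.
Hypothesis t_p : forall i, ev (t i) = 0.
Hypothesis tau_t : forall i j, ev (tau i (t j)) = (j == i)%:R.
Hypothesis vanishing_t : forall D : V, (forall i, ev (D (t i)) = 0) -> vanishing_at_p D.
Hypothesis gl_t_tau : forall i j, gl (der_mul (t j) (tau i)) = delta_mx j i.

Let AL f : klinear (actA f).
Proof. by move=> c x y; exact: (AV_A_linr AVM). Qed.
Let Al x : klinear (actA^~ x).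
Proof. by move=> c f g; exact: (AV_A_linl AVM). Qed.
Let VL D : klinear (actV D).
Proof. by move=> c x y; exact: (AV_V_linr AVM). Qed.
Let Vl x : klinear (actV^~ x).
Proof. by move=> c D E; exact: (AV_V_linl AVM). Qed.

(** The elements obtained by applying fewer than d of the fields tau_i to the
    image of U. *)
Fixpoint filt (d : nat) (x : M) : Prop :=
  if d is d'.+1 then exists u (y : 'I_s -> M),
    (forall i, filt d' (y i)) /\ x = delta u + \sum_i actV (tau i) (y i)
  else x = 0.

Lemma filt_submodule d : submodule (filt d).
Proof.
elim: d => [|d IH]; first by split=> [//|c x y /= -> ->]; rewrite scaler0 addr0.
split=> [|c _ _ [u [y [oy ->]]] [u' [y' [oy' ->]]]].
  exists 0, (fun=> 0); split=> [i|]; first exact: (submodule0 IH).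
  by rewrite (klin0 delta_linear) add0r big1 // => i _; rewrite (klin0 (VL _)).
exists (c *: u + u'), (fun i => c *: y i + y' i); split=> [i|].
  exact: (proj2 IH c (y i) (y' i) (oy i) (oy' i)).
under [in RHS]eq_bigr do rewrite VL.
by rewrite delta_linear big_split /= -scaler_sumr scalerDr addrACA.
Qed.

Lemma filt_delta d u : filt d.+1 (delta u).
Proof.
exists u, (fun=> 0); split=> [i|]; first exact: (submodule0 (filt_submodule d)).
by rewrite big1 ?addr0 // => i _; rewrite (klin0 (VL _)).
Qed.

Lemma filt_tau d i x : filt d x -> filt d.+1 (actV (tau i) x).
Proof.
move=> ox; exists 0, (fun j => if j == i then x else 0); split=> [j|].
  by case: (j == i) => //; exact: (submodule0 (filt_submodule d)).
rewrite (klin0 delta_linear) add0r (bigD1 i) //= eqxx big1 ?addr0 // => j /negbTE->.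
exact: (klin0 (VL _)).
Qed.

Lemma filtS d x : filt d x -> filt d.+1 x.
Proof.
elim: d x => [|d IH] x; first by move=> /= ->; exact: (submodule0 (filt_submodule 1)).
move=> [u [y [oy ->]]]; apply: (submoduleD (filt_submodule _)); first exact: filt_delta.
by apply: (submodule_sum (filt_submodule _)) => i _; apply: filt_tau; exact: (IH _ (oy i)).
Qed.

(** Writing f as f(p) plus a function vanishing at p, it suffices to move such a
    function through the tau_i: the commutators are functions, multiplying an
    element with one field less. *)
Lemma filt_A d f x : filt d x ->
  filt d (actA f x) /\ (ev f = 0 -> filt d.-1 (actA f x)).
Proof.
elim: d f x => [|d IH] f x; first by move=> /= ->; rewrite (klin0 (AL f)).
move=> ox; have vanish f' : ev f' = 0 -> filt d (actA f' x).
  move=> f'p; case: ox => u [y [oy ->]]; have sd := filt_submodule d.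
  rewrite (klinD (AL f')) delta_A f'p scale0r (klin0 delta_linear) add0r.
  rewrite (klin_sum (AL f')); apply: (submodule_sum sd) => i _.
  have -> : actA f' (actV (tau i) (y i)) =
      actV (tau i) (actA f' (y i)) - actA (tau i f') (y i).
    by rewrite (AV_leibniz AVM) addrAC subrr add0r.
  apply: (submoduleB sd); last exact: (IH _ _ (oy i)).1.
  have := (IH f' _ (oy i)).2 f'p; case: (d) => [/= ->|d'].
    exact: (klin0 (VL _)).
  exact: filt_tau.
split; last exact: vanish.
have -> : actA f x = ev f *: x + actA (f - (ev f)%:A) x.
  by rewrite (klinB (Al x)) (klinZ (Al x)) (AV_A_one AVM) addrC subrK.
apply: (proj2 (filt_submodule _)) => //; apply/filtS/vanish.
by rewrite evalAB // evalAZ // evalA1 // mulr1 subrr.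
Qed.

(** A vector field differs from a combination of the tau_i by one that vanishes
    at p. Moving the latter through the tau_i creates brackets, which are
    applied to an element with one field less. *)
Lemma filt_V d (D : V) x : filt d x ->
  filt d.+1 (actV D x) /\ (vanishing_at_p D -> filt d (actV D x)).
Proof.
elim: d D x => [|d IH] D x.
  by move=> /= ->; rewrite (klin0 (VL D)); split=> //; exact: (submodule0 (filt_submodule 1)).
move=> ox; have vanish (D' : V) : vanishing_at_p D' -> filt d.+1 (actV D' x).
  move=> D'p; case: ox => u [y [oy ->]]; have sd := filt_submodule d.+1.
  rewrite (klinD (VL D')) delta_V //; apply: (submoduleD sd); first exact: filt_delta.
  rewrite (klin_sum (VL D')); apply: (submodule_sum sd) => i _.
  have -> : actV D' (actV (tau i) (y i)) =
      actV (tau i) (actV D' (y i)) + actV (der_bracket D' (tau i)) (y i).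
    by rewrite (AV_V_bracket AVM) addrC subrK.
  apply: (submoduleD sd); last exact: (IH _ _ (oy i)).1.
  by apply: filt_tau; exact: (IH _ _ (oy i)).2.
split; last exact: vanish.
pose D0 := \sum_i ev (D (t i)) *: tau i.
have -> : actV D x = actV (D - D0) x + actV D0 x.
  by rewrite -(klinD (Vl x)) subrK.
have sd := filt_submodule d.+2; apply: (submoduleD sd).
  apply/filtS/vanish/vanishing_t => j.
  rewrite der_addE der_oppE evalAB //.
  suff -> : ev (D0 (t j)) = ev (D (t j)) by rewrite subrr.
  have -> : D0 (t j) = \sum_i ev (D (t i)) *: tau i (t j).
    rewrite /D0; elim/big_rec2: _ => [|i z E _ e]; first exact: der_zeroE.
    by rewrite der_addE e.
  rewrite (big_morph ev (evalAD Xp) (evalA0 Xp)) (bigD1 j) //= evalAZ // tau_t eqxx mulr1.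
  rewrite big1 ?addr0 // => i ij; rewrite evalAZ // tau_t eq_sym (negbTE ij).
  by rewrite mulr0.
rewrite /D0 (klin_sum (Vl x)); apply: (submodule_sum sd) => i _.
by rewrite (klinZ (Vl x)); apply: (submoduleZ sd); apply: filt_tau.
Qed.

Definition euler x := \sum_j actV (tau j) (actA (t j) x).

Lemma euler_linear : klinear euler.
Proof. by apply: klin_bigsum => j; exact: klin_comp. Qed.

(** Moving tau_i to the left through sum_j tau_j t_j adds - tau_i, up to lower
    order: each of the d fields contributes - 1. *)
Lemma filt_euler d x : filt d.+1 x -> filt d (euler x + d%:R *: x).
Proof.
elim: d x => [|d IH] x.
  move=> ox; rewrite /= scale0r addr0 /euler big1 // => j _.
  have /= -> := (filt_A (t j) ox).2 (t_p j).
  exact: (klin0 (VL _)).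
have sd := filt_submodule d.+1.
have eL : klinear (fun x => euler x + d.+1%:R *: x).
  by apply: klin_add; [exact: euler_linear | exact: (@klin_scale k _ M M id)].
move=> [u [y [oy ->]]]; rewrite (klinD eL) (klin_sum eL); apply: (submoduleD sd).
  rewrite /euler big1 ?add0r => [|j _]; last first.
    by rewrite delta_A t_p scale0r (klin0 delta_linear) (klin0 (VL _)).
  by apply: (submoduleZ sd); exact: filt_delta.
apply: (submodule_sum sd) => i _; set z := y i; have oz : filt d.+1 z by exact: oy.
pose rest j := actV (der_bracket (tau j) (tau i)) (actA (t j) z)
  - actV (tau j) (actA (tau i (t j) - (j == i)%:R) z).
have -> : euler (actV (tau i) z) + d.+1%:R *: actV (tau i) z =
    actV (tau i) (euler z + d%:R *: z) + \sum_j rest j.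
  have term j : actV (tau j) (actA (t j) (actV (tau i) z)) =
      actV (tau i) (actV (tau j) (actA (t j) z)) + rest j
      - (j == i)%:R *: actV (tau j) z.
    rewrite /rest (AV_V_bracket AVM) (klinB (Al z)) (klinB (VL _)).
    have -> : actA (t j) (actV (tau i) z) =
        actV (tau i) (actA (t j) z) - actA (tau i (t j)) z.
      by rewrite (AV_leibniz AVM) addrAC subrr add0r.
    rewrite (klinB (VL _)).
    have -> : actA (j == i)%:R z = (j == i)%:R *: z.
      by case: (j == i); rewrite ?scale1r ?(AV_A_one AVM) ?scale0r ?(klin0 (Al z)).
    rewrite (klinZ (VL _)); move: (actV _ (actV _ _)) (actV _ (actV _ _)).
    move: (actV _ _) (_ *: _) => e f b a.
    by rewrite opprB addrA [b + _]addrC subrK [f - e]addrC addrA addrK.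
  rewrite /euler (eq_bigr _ (fun j _ => term j)) sumrB big_split /=.
  rewrite (klinD (VL _)) (klinZ (VL _)) (klin_sum (VL _)).
  rewrite [X in _ - X + _](bigD1 i) //= eqxx scale1r [X in _ - (_ + X) + _]big1 => [|j /negbTE->].
    rewrite addr0 -natr1 scalerDl scale1r.
    by rewrite [X in _ - _ + X = _]addrC addrA subrK addrAC.
  by rewrite scale0r.
apply: (submoduleD sd); first by apply/filt_tau/IH.
apply: (submodule_sum sd) => j _; apply: (submoduleB sd).
  by apply: (filt_V _ _).1; exact: (filt_A _ oz).2.
apply: filt_tau; apply: (filt_A _ oz).2.
rewrite evalAB // tau_t.
by case: (j == i); rewrite ?evalA1 ?evalA0 // subrr.
Qed.

(** Take x <> 0 in the submodule, in the least possible step of the filtration.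
    If some t_j x is not zero, it lies in a smaller step. Otherwise the Euler
    operator kills x, which by [filt_euler] and characteristic 0 belongs to a
    smaller step, unless x is in the image of U. *)
Theorem delta_module_simple : AV_simple actA actV.
Proof.
split=> //; first by have [u ?] := delta_neq0; exists (delta u).
move=> N [sN NA NV].
have [N0|/existsNP[x /not_implyP[Nx /eqP x0]]] := pselect (forall x, N x -> x = 0).
  by left.
right.
have ord y : exists d, filt d y.
  apply: (delta_gen (Q := fun y => exists d, filt d y)) => [|u|f z [d oz]|D z [d oz]].
  - split=> [|c z z' [d oz] [d' oz']]; first by exists 0%N.
    have leq_filt e e' w : (e <= e')%N -> filt e w -> filt e' w.
      by move=> /subnK <-; elim: (e' - e)%N => [|l IH] // /IH; exact: filtS.
    exists (maxn d d'); apply: (proj2 (filt_submodule _)).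
      by apply: leq_filt oz; exact: leq_maxl.
    by apply: leq_filt oz'; exact: leq_maxr.
  - by exists 1%N; exact: filt_delta.
  - by exists d; exact: (filt_A _ oz).1.
  - by exists d.+1; exact: (filt_V _ oz).1.
have [u Nu u0] : exists2 u, N (delta u) & u <> 0.
  have [d od] := ord x; elim: d x x0 Nx od => [|d IH] x x0 Nx od.
    by move: x0; rewrite od eqxx.
  have [tx|/existsNP[j /eqP tjx]] := pselect (forall j, actA (t j) x = 0); last first.
    by apply: (IH (actA (t j) x)) => //; [exact: NA | exact: (filt_A _ od).2].
  have eu : euler x = 0.
    by rewrite /euler big1 // => j _; rewrite tx (klin0 (VL _)).
  have := filt_euler od; rewrite eu add0r.
  case: d IH od => [_ [u [y [y0 ex]]] _|d IH od odx].
    have xu : x = delta u.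
      by rewrite ex big1 ?addr0 // => i _; rewrite (y0 i) (klin0 (VL _)).
    exists u; first by rewrite -xu.
    by move=> u0; move: x0; rewrite xu u0 (klin0 delta_linear) eqxx.
  apply: (IH x) => //.
  have d0 : d.+1%:R != 0 :> k by rewrite (iffLR (pcharf0P k) char0).
  by rewrite -[x](scalerK d0); apply: (submoduleZ (filt_submodule _)).
have Ndelta v : N (delta v).
  have [rhoM U0 irr] := rho_simple.
  have [W WP] : exists W : {vspace U}, forall u, u \in W <-> N (delta u).
    apply: prop_vspace => [|c a b Na Nb].
      by rewrite (klin0 delta_linear); exact: (submodule0 sN).
    by rewrite delta_linear; apply: (proj2 sN).
  case: (irr W) => [a w wW|W0|Wf].
  - rewrite (rho_delta rhoM); apply: memv_suml => j _; apply: memv_suml => i _.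
    apply: memvZ; apply/WP; rewrite -gl_t_tau -delta_V; last first.
      by move=> f; rewrite der_mulE evalAM // t_p mul0r.
    by apply: NV; apply/WP.
  - by move/WP: Nu; rewrite W0 memv0 => /eqP/u0.
  - by apply/WP; rewrite Wf memvf.
exact: delta_gen.
Qed.

End DeltaModule.

Section Rudakov.
Variables (k : closedFieldType) (n s m : nat) (X : variety k n).
Variables (g : 'I_m -> {mpoly k[n]}) (gX : generates_ideal X g) (c : chart X g s).
Variables (U : vectType k) (rho : 'M[k]_s -> 'End(U)).
Variable p : 'I_n -> k.
Hypothesis pc : in_chart c p.
Hypotheses (char0 : [pchar k] =i pred0) (rho_simple : gl_simple rho).
Local Notation A := (coord_ring X).
Local Notation V := (der A).
Local Notation h := (minor c).
Local Notation tl := (to_loc (minor c)).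
Local Notation pd := (partial c).
Local Notation ev := (evalA p).
Local Notation evl := (@eval_loc k n X (minor c) p).
Local Notation act := (rudakov_act c rho (p := p)).

Let Xp : X p. Proof. by case: pc. Qed.
Let hp : ev h != 0. Proof. by case: pc. Qed.
Let rhoM : gl_module rho. Proof. by case: rho_simple. Qed.
Let evlM : forall x y, evl (x * y) = evl x * evl y.
Proof. by case: (eval_loc_morph (minor_neq0 c) Xp hp). Qed.
Let evlP : forall a x y, evl (a *: x + y) = a * evl x + evl y.
Proof. by case: (eval_loc_morph (minor_neq0 c) Xp hp). Qed.
Let evlE : forall a, evl (tl a) = ev a.
Proof. by case: (eval_loc_morph (minor_neq0 c) Xp hp). Qed.
Let evl_lin : klinear (evl : loc h -> k^o). Proof. exact: evlP. Qed.

(** The matrix of [rudakov_gl], given by its entries. *)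
Definition glmx (D : V) : 'M[k]_s := \matrix_(j, i) evl (pd j (coef c D i)).

Lemma rudakov_glE D : rudakov_gl c p D = glmx D.
Proof.
rewrite /rudakov_gl [RHS]matrix_sum_delta exchange_big.
by apply: eq_bigr => j _; apply: eq_bigr => i _; rewrite mxE.
Qed.

Lemma evl_vf (D : V) x : (forall i, ev (D (param c i)) = 0) -> evl (loc_der c D x) = 0.
Proof.
move=> Dp; rewrite loc_derE (klin_sum evl_lin) big1 // => i _.
by rewrite evlM /coef evlE Dp mul0r.
Qed.

Lemma Vplus_param (D : V) : (forall i, ev (D (param c i)) = 0) -> forall f, ev (D f) = 0.
Proof. by move=> Dp f; rewrite -evlE -(loc_der_to_loc gX) evl_vf. Qed.

Lemma glmx_linear a D E : glmx (a *: D + E) = a *: glmx D + glmx E.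
Proof. by apply/matrixP => j i; rewrite !mxE coefP der_linear evlP. Qed.

(** In the derivatives of the coefficients of a bracket, the second derivatives
    are multiplied by coefficients that vanish at p. *)
Lemma glmx_bracket (D E : V) : (forall f, ev (D f) = 0) -> (forall f, ev (E f) = 0) ->
  glmx (der_bracket D E) = glmx D *m glmx E - glmx E *m glmx D.
Proof.
move=> Dp Ep; have key (D' : V) x j : (forall f, ev (D' f) = 0) ->
    evl (pd j (loc_der c D' x)) = \sum_l evl (pd j (coef c D' l)) * evl (pd l x).
  move=> D'p; rewrite loc_derE der_sum (klin_sum evl_lin).
  apply: eq_bigr => l _; rewrite derM (klinD evl_lin) !evlM.
  by rewrite [evl (coef _ _ _)]evlE D'p mul0r addr0.
apply/matrixP => j i; rewrite !mxE (coef_bracket gX) derB (klinB evl_lin).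
by rewrite !key //; congr (_ - _); apply: eq_bigr => l _; rewrite !mxE.
Qed.

Lemma VplusP (D : {D : V | Vplus p D}) f : ev (val D f) = 0.
Proof. by have /asboolP := valP D. Qed.

Lemma rudakov_smash_action : smash_action act.
Proof.
have rhoL u := rho_klinear rhoM u.
split.
- by case=> [f|D] a x y; rewrite /= ?linearP // scalerDr !scalerA mulrC.
- by move=> u a f f'; rewrite /= evalAD // evalAZ // scalerDl scalerA.
- by move=> u; rewrite /= evalA1 // scale1r.
- by move=> f f' u; rewrite /= evalAM // scalerA.
- by move=> a D E F u e; rewrite /= !rudakov_glE e glmx_linear rhoL.
- move=> D E F u e; rewrite /= !rudakov_glE e glmx_bracket; try exact: VplusP.
  by case: rhoM.
- by move=> D f u; rewrite /= VplusP scale0r add0r linearZ.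
Qed.
Local Notation actP := rudakov_smash_action.

Local Notation S := (smash_full X).
Local Notation delta u := (ptensor (fun (s : S) (b : smash (Vplus p)) => s * smash_incl b)
  (smash_act act) 1 u).

(** The linear maps g |-> g(p) u form a copy of U, with its action of V_+, inside
    the coinduced module, to which R_p(U) is then mapped. *)
Lemma rudakov_delta_neq0 : exists u, delta u <> 0.
Proof.
have [_ [u u0] _] := rho_simple; exists u => du.
pose M := lmap (loc h) U.
have eL (v : U) : klinear (fun x : loc h => evl x *: v).
  by move=> a x y; rewrite evlP scalerDl scalerA.
pose e v : M := mk_lmap (eL v).
have [] := @induced_universal _ _ _ _ _ _ actP M (@coinduced_act k n s m X g c U rho) e (coinduced_smash_action gX c rhoM).
- by move=> a v w; apply: lmap_ext => x; rewrite lmapDZ !mk_lmapE scalerDr !scalerA mulrC.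
- move=> f v; apply: lmap_ext => x.
  by rewrite /= evlM evlE scalerA mulrC.
- move=> D v; apply: lmap_ext => x.
  have ev0 := evl_vf x (fun i => VplusP D (param c i)).
  rewrite /= [evl (vf _ _ _ _)]ev0 scale0r subr0 rudakov_glE (rho_delta rhoM) /twist scaler_sumr.
  apply: eq_bigr => j _; rewrite scaler_sumr; apply: eq_bigr => i _.
  by rewrite /= !mxE evlM [RHS]linearZ scalerA.
move=> F [FL FE]; have := FE u; rewrite du (klin0 FL) => /(congr1 (fun f : M => f 1)).
rewrite /= -(rmorph1 tl) evlE evalA1 // scale1r => e0; apply: u0.
by rewrite -e0.
Qed.

Theorem rudakov_simple :
  AV_simple (rudakovA (c := c) (rho := rho) (p := p))
            (rudakovV (c := c) (rho := rho) (p := p)).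
Proof.
pose t i : A := param c i - (ev (param c i))%:A.
pose tau' i : V := (ev h)^-1 *: tau gX c i.
have tE (D : V) i : D (t i) = D (param c i) by rewrite /t derB derC subr0.
suff : AV_simple (inducedA (act := act)) (inducedV (act := act)) by [].
apply: (@delta_module_simple k n s X p Xp U rho char0 rho_simple _ _ _
  (induced_AV_module act) (fun u => delta u) t tau' glmx).
- by move=> a u v; exact: ptensorPr.
- by move=> f u; exact: (induced_one_A actP).
- move=> D u Dp; have VD : Vplus p D by apply/asboolP.
  have := induced_one_V actP (exist _ D VD) u; rewrite /= rudakov_glE; exact.
- by move=> Q sQ Qd QA QV; exact: (induced_ind sQ Qd QA QV).
- exact: rudakov_delta_neq0.
- by move=> i; rewrite /t evalAB // evalAZ // evalA1 // mulr1 subrr.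
- move=> i j; rewrite /tau' der_scaleE tE tau_param evalAZ // evalAM //.
  case: (j == i); rewrite ?evalA1 ?evalA0 // ?mul0r ?mulr0 //.
  by rewrite mul1r mulVf.
- by move=> D Dp; apply: Vplus_param => i; rewrite -tE.
- move=> i j; apply/matrixP => j' i'; rewrite !mxE coef_mul derM (klinD evl_lin) !evlM.
  rewrite [evl (tl (t j))]evlE /t evalAB // evalAZ // evalA1 // mulr1 subrr mul0r addr0.
  rewrite rmorphB /= to_locZ derB rmorph1 derC subr0 (partial_param gX).
  rewrite /tau' /coef der_scaleE to_locZ (klinZ evl_lin) evlE tau_param evalAM //.
  have evl1 : evl 1 = 1 by rewrite -(rmorph1 tl) evlE evalA1.
  rewrite eq_sym; case: (j' == j) => /=; rewrite ?evl1 ?(klin0 evl_lin) ?mul0r // mul1r.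
  by case: (i' == i); rewrite ?evalA1 ?evalA0 // ?mul0r ?mul1r ?scaler0 //; exact: mulVf.
Qed.

End Rudakov.

Theorem mainTheorem1 (k : closedFieldType) (n s : nat) (X : variety k n)
    (m : nat) (g : 'I_m -> {mpoly k[n]})
    (U : vectType k) (rho : 'M[k]_s -> 'End(U)) :
  [pchar k] =i pred0 ->
  has_dim X s ->
  generates_ideal X g ->
  gl_simple rho ->
  (forall (p : 'I_n -> k) (c : chart X g s),
     nonsingular X g s p -> in_chart c p ->
     AV_simple (rudakovA (c := c) (rho := rho) (p := p))
               (rudakovV (c := c) (rho := rho) (p := p)))
  /\
  (smooth X g s ->
   forall (M : lmodType k) (actA : coord_ring X -> M -> M)
          (actV : der (coord_ring X) -> M -> M),
     gauge_module g rho actA actV -> (exists x : M, x <> 0) ->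
     AV_simple actA actV).
Proof.
move=> char0 dimX gX rho_simple; split.
  by move=> p c _ pc; exact: rudakov_simple.
by move=> sm M actA actV; exact: gauge_module_simple.
Qed.
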